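(* Let $\varphi:\mathbb D\to\mathbb D$ be holomorphic and let $\sigma\in\partial\mathbb D$. Then the following conditions are pairwise equivalent: (a) $D_h\varphi(r\sigma)\to 1$ as $r\to1^-$. (b) $\displaystyle \angle\lim_{z,w\to\sigma}\frac{\mathrm k_{\mathbb D}(\varphi(z),\varphi(w))}{\mathrm k_{\mathbb D}(z,w)}=1$. (c) $\varphi$ is conformal at $\sigma$ in the weak sense.
   Context: $\mathbb D=\{z\in\mathbb C:|z|<1\}$. The hyperbolic metric is $\lambda_{\mathbb D}(z)|dz|$ with $\lambda_{\mathbb D}(z)=\frac{2}{1-|z|^2}$, and the hyperbolic distance is $\mathrm k_{\mathbb D}(z,w)=\log\frac{1+\varrho_{\mathbb D}(z,w)}{1-\varrho_{\mathbb D}(z,w)}$, where $\varrho_{\mathbb D}(z,w)=\left|\frac{z-w}{1-\overline w z}\right|$. For holomorphic $\varphi:\mathbb D\to\mathbb D$ the hyperbolic distortion is $D_h\varphi(z)=\lim_{w\to z}\frac{\mathrm k_{\mathbb D}(\varphi(z),\varphi(w))}{\mathrm k_{\mathbb D}(z,w)}=(1-|z|^2)\frac{|\varphi'(z)|}{1-|\varphi(z)|^2}$. Convention: for $w=z$ the quotient $\mathrm k_{\mathbb D}(\varphi(z),\varphi(w))/\mathrm k_{\mathbb D}(z,w)$ is understood as $D_h\varphi(z)$. Angular (non-tangential) limits: for $\sigma\in\partial\mathbb D$ and $M>1$ let $S_M=\{z\in\mathbb D:|z-\sigma|<M(1-|z|)\}$ (Stolz region with vertex $\sigma$). $\angle\lim_{z\to\sigma}f(z)=\ell$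 means that for every $M>1$, $f(z)\to\ell$ as $z\to\sigma$ with $z\in S_M$; $\angle\lim_{z,w\to\sigma}f(z,w)=\ell$ means that for every $M>1$, $f(z,w)\to\ell$ as $z\to\sigma$ and $w\to\sigma$ with $z,w\in S_M$. $\varphi$ is called conformal at $\sigma$ in the weak sense if the angular limit $\varphi(\sigma):=\angle\lim_{z\to\sigma}\varphi(z)$ exists and belongs to $\partial\mathbb D$, and $\angle\lim_{z\to\sigma}\arg\frac{1-\overline{\varphi(\sigma)}\varphi(z)}{1-\overline\sigma z}=0$. *)

(* Defs.v *)
From Stdlib Require Import Reals Lra.
From Coquelicot Require Export Coquelicot.

Open Scope R_scope.

Definition unit_disc (z : C) : Prop := Cmod z < 1.

Definition unit_circle (z : C) : Prop := Cmod z = 1.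

(* Maps of the disc are total functions on C whose values outside the disc are
   irrelevant; the disc is open, so two-sided differentiability at its points
   only involves the restriction of [phi] to the disc. *)
Definition holomorphic_on_disc (phi : C -> C) : Prop :=
  forall z : C, unit_disc z -> ex_derive (K := C_AbsRing) (V := C_NormedModule) phi z.

Definition pseudo_hyp_dist (z w : C) : R :=
  Cmod ((z - w) / (1 - Cconj w * z))%C.

Definition hyp_dist (z w : C) : R :=
  ln ((1 + pseudo_hyp_dist z w) / (1 - pseudo_hyp_dist z w)).

Definition hyp_distortion (phi : C -> C) (z : C) : R :=
  (1 - Cmod z ^ 2) * (Cmod (C_derive phi z) / (1 - Cmod (phi z) ^ 2)).

(* On the diagonal, [hyp_distortion phi z] is the limit of the quotient as
   [w] tends to [z]. *)
Definition hyp_quotient (phi : C -> C) (z w : C) : R :=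
  if Ceq_dec z w then hyp_distortion phi z
  else hyp_dist (phi z) (phi w) / hyp_dist z w.

Definition stolz (sigma : C) (M : R) (z : C) : Prop :=
  unit_disc z /\ Cmod (z - sigma)%C < M * (1 - Cmod z).

Definition stolz_filter (sigma : C) (M : R) : (C -> Prop) -> Prop :=
  within (stolz sigma M) (locally sigma).

Definition is_angular_lim {U : UniformSpace} (f : C -> U) (sigma : C) (l : U) : Prop :=
  forall M : R, 1 < M -> filterlim f (stolz_filter sigma M) (locally l).

Definition is_angular_lim2 {U : UniformSpace} (f : C -> C -> U) (sigma : C) (l : U) : Prop :=
  forall M : R, 1 < M ->
    filterlim (fun p : C * C => f (fst p) (snd p))
      (filter_prod (stolz_filter sigma M) (stolz_filter sigma M)) (locally l).

(* Principal argument, with values in (-PI, PI]; the value at 0 is junk. *)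
Definition Carg (z : C) : R :=
  if Rle_dec 0 (Im z) then acos (Re z / Cmod z) else - acos (Re z / Cmod z).

Lemma Carg_correct (z : C) : z <> 0%C ->
  - PI < Carg z <= PI /\
  z = (Cmod z * cos (Carg z), Cmod z * sin (Carg z)).
Proof.
intros Hz.
assert (Hm : 0 < Cmod z) by (apply Cmod_gt_0; exact Hz).
destruct z as [x y].
assert (Hsq : Cmod (x, y) * Cmod (x, y) = x * x + y * y).
{ unfold Cmod; simpl; rewrite sqrt_sqrt; nra. }
unfold Carg; simpl Re; simpl Im.
set (m := Cmod (x, y)) in *.
assert (Hc : (x / m) * m = x) by (field; lra).
set (c := x / m) in *.
assert (Hcm : (c * m) * (c * m) <= m * m) by (rewrite Hc; nra).
assert (Hcc : c * c <= 1).
{ apply Rmult_le_reg_r with (m * m); [nra|]; lra. }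
assert (Hb : -1 <= c <= 1) by (split; nra).
assert (Hs : sqrt (1 - c²) * m = Rabs y).
{ rewrite <- (sqrt_Rsqr_abs y).
  transitivity (sqrt (1 - c²) * sqrt (m²)).
  { rewrite sqrt_Rsqr by lra; reflexivity. }
  rewrite <- sqrt_mult by (unfold Rsqr; nra).
  f_equal; unfold Rsqr.
  replace ((1 - c * c) * (m * m)) with (m * m - (c * m) * (c * m)) by ring.
  rewrite Hc; lra. }
destruct (acos_bound c) as [H0 H1].
destruct (Rle_dec 0 y) as [Hy|Hy].
- split; [pose proof PI_RGT_0; lra|].
  rewrite cos_acos, sin_acos by exact Hb.
  rewrite Rabs_pos_eq in Hs by exact Hy.
  f_equal; lra.
- rewrite cos_neg, sin_neg, cos_acos, sin_acos by exact Hb.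
  rewrite Rabs_left in Hs by lra.
  split; [|f_equal; lra].
  assert (Hy2 : 0 < y * y) by nra.
  assert (Hlt : (c * m) * (c * m) < m * m) by (rewrite Hc; lra).
  assert (Hc2 : c * c < 1) by (apply Rmult_lt_reg_r with (m * m); nra).
  assert (Hc1 : -1 < c < 1) by (split; nra).
  destruct (acos_bound_lt c Hc1); lra.
Qed.

Definition weakly_conformal_at (phi : C -> C) (sigma : C) : Prop :=
  exists tau : C,
    unit_circle tau /\
    is_angular_lim phi sigma tau /\
    is_angular_lim
      (fun z => Carg ((1 - Cconj tau * phi z) / (1 - Cconj sigma * z))%C) sigma 0.

(* Main.v *)
(* Seen from hyperbolic frames at z and phi z, phi becomes a self-map psi of the disc with psi 0 = 0 and
   psi'(0) = D_h phi(z). If psi'(0) is close to 1, then psi is close to the identity on compact sets: its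
   mean square distance to the identity on circles is small. So (a) makes phi an approximate isometry on
   hyperbolic balls of fixed radius centred on the radius to sigma. Consecutive frames at hyperbolic distance
   ln 3 then differ by almost the translation T(w) = (w + 1/2) / (1 + w/2), and the contraction of T towards
   its attracting fixed point 1 shows that the frames in the image accumulate at a boundary point tau lying
   asymptotically straight ahead of each of them. In half-plane coordinates with poles sigma and tau, phi is
   then asymptotically multiplication by a slowly varying positive factor; this gives (c), and, with
   Busemann functions for pairs of points far apart, (b). Conversely (b) contains (a) on the diagonal, and
   under (c) the quotient (1 - conj tau phi) / (1 - conj sigma z) maps the discs |z - r sigma| < (1 - r)/2
   into thin sectors, which bounds its derivative and yields (a). *)
Require Import Defs.
From Stdlib Require Import Reals Lra Lia Classical ClassicalEpsilon.
From Coquelicot Require Import Coquelicot.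

Open Scope R_scope.

(** * Complex continuity and differentiability *)

(** Condition (a) carries no rate: [1 - D_h] may tend to 0 arbitrarily slowly along the radius, so
    the errors made in successive frames cannot be summed. Everything beyond a single frame
    therefore rests on halving: old errors are halved at each step, which keeps the accumulated
    error below twice the error of one step. For the same reason [tau] is found by compactness, the
    ratios of consecutive heights only tend to 3, and the positive factor between the half-plane
    coordinates need not converge. An argument does not see such a factor, and for far pairs the
    loss is a small fraction of the distance by which one divides. The function theory is built from
    Goursat's lemma: the exponential turns annuli into rectangles, which yields mean values and the
    Cauchy formula on circles; powers of a function replace the maximum principle in the Schwarz
    lemma. The spacing ln 3 is the distance from 0 to 1/2, where the shift has rational values and
    all constants can be computed. *)

Lemma common_pos (a b : R) : 0 < a -> 0 < b -> exists k, 0 < k /\ k <= a /\ k <= b.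
Proof.
  intros Ha Hb. exists (Rmin a b).
  auto using Rmin_pos, Rmin_l, Rmin_r.
Qed.

Lemma small_factor (e m : R) : 0 < e -> 0 < m -> exists k, 0 < k /\ k <= 1 /\ k * m <= e.
Proof.
  intros He Hm. destruct (common_pos 1 (e / m)) as [k [H0 [H1 H2]]];
    [lra|apply Rdiv_lt_0_compat; lra|].
  exists k. repeat split; auto. apply Rle_div_r; assumption.
Qed.

Lemma div_le (a b c : R) : 0 < c -> a <= b * c -> a / c <= b.
Proof. intros Hc H. apply Rle_div_l; assumption. Qed.

Lemma le_div (a b c : R) : 0 < c -> a * c <= b -> a <= b / c.
Proof. intros Hc H. apply -> Rle_div_r; assumption. Qed.

Lemma div_lt (a b c : R) : 0 < c -> a < b * c -> a / c < b.
Proof. intros Hc H. apply Rlt_div_l; assumption. Qed.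

Lemma lt_div (a b c : R) : 0 < c -> a * c < b -> a < b / c.
Proof. intros Hc H. apply -> Rlt_div_r; assumption. Qed.

Lemma Cconj_R (r : R) : Cconj (RtoC r) = RtoC r.
Proof. apply injective_projections; simpl; ring. Qed.

Lemma Cmod_minus_sym (z w : C) : Cmod (z - w)%C = Cmod (w - z)%C.
Proof.
  replace (z - w)%C with (- (w - z))%C by ring. apply Cmod_opp.
Qed.

Lemma Cmod_triangle_minus (z w : C) : Cmod (z - w)%C <= Cmod z + Cmod w.
Proof.
  unfold Cminus. eapply Rle_trans; [apply Cmod_triangle|]. rewrite Cmod_opp. lra.
Qed.

Lemma Cmod_triangle_rev (z w : C) : Cmod z - Cmod w <= Cmod (z - w)%C.
Proof.
  pose proof (Cmod_triangle (z - w) w) as H.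
  replace (z - w + w)%C with z in H by ring. lra.
Qed.

Lemma Cmod_triangle_via (a b c : C) : Cmod (a - c)%C <= Cmod (a - b)%C + Cmod (b - c)%C.
Proof.
  replace (a - c)%C with ((a - b) + (b - c))%C by ring. apply Cmod_triangle.
Qed.

Lemma Cmod_le_Re_Im (z : C) : Cmod z <= Rabs (Re z) + Rabs (Im z).
Proof.
  destruct z as [x y]; simpl.
  replace (x, y) with (RtoC x + Ci * RtoC y)%C
    by (unfold RtoC, Ci, Cplus, Cmult; simpl; f_equal; ring).
  eapply Rle_trans; [apply Cmod_triangle|].
  rewrite Cmod_mult, Cmod_Ci, !Cmod_R. lra.
Qed.

Lemma im_le_Cmod (z : C) : Rabs (Im z) <= Cmod z.
Proof.
  pose proof (Rmax_Cmod z). destruct z as [x y]; simpl in *.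
  eapply Rle_trans; [apply Rmax_r|exact H].
Qed.

Definition ccont (f : C -> C) (z : C) : Prop :=
  forall eps, 0 < eps -> exists del, 0 < del /\
    forall w, Cmod (w - z)%C < del -> Cmod (f w - f z)%C < eps.

(** Caratheodory's form of the derivative: the slope is a total function, continuous at [z]. Product
    and chain rules need no division, and the same factor later serves as the quotient [psi z / z]
    of the Schwarz lemma and as the divided difference in the Cauchy formula. *)
Definition is_cder (f : C -> C) (z l : C) : Prop :=
  exists h : C -> C, h z = l /\ ccont h z /\ forall w, (f w - f z = h w * (w - z))%C.

Lemma ccont_const (c z : C) : ccont (fun _ => c) z.
Proof.
  intros e He. exists 1. split; [lra|]. intros w _.
  replace (c - c)%C with (RtoC 0) by ring. rewrite Cmod_0; lra.
Qed.

Lemma ccont_id (z : C) : ccont (fun w => w) z.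
Proof. intros e He. exists e. split; [lra|]. auto. Qed.

Lemma ccont_plus (f g : C -> C) (z : C) :
  ccont f z -> ccont g z -> ccont (fun w => f w + g w)%C z.
Proof.
  intros Hf Hg e He.
  destruct (Hf (e / 2)) as [d1 [Hd1 H1]]; [lra|].
  destruct (Hg (e / 2)) as [d2 [Hd2 H2]]; [lra|].
  destruct (common_pos d1 d2) as [d [Hd [Hl Hr]]]; auto.
  exists d. split; [exact Hd|]. intros w Hw.
  specialize (H1 w ltac:(lra)). specialize (H2 w ltac:(lra)).
  replace (f w + g w - (f z + g z))%C with ((f w - f z) + (g w - g z))%C by ring.
  eapply Rle_lt_trans; [apply Cmod_triangle|]. lra.
Qed.

Lemma ccont_mult (f g : C -> C) (z : C) :
  ccont f z -> ccont g z -> ccont (fun w => f w * g w)%C z.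
Proof.
  intros Hf Hg e He.
  set (A := Cmod (f z)). set (B := Cmod (g z)).
  assert (HA : 0 <= A) by apply Cmod_ge_0. assert (HB : 0 <= B) by apply Cmod_ge_0.
  destruct (small_factor e (A + B + 2)) as [k [Hk [Hk1 Hk2]]]; [lra..|].
  destruct (Hf k Hk) as [d1 [Hd1 H1]].
  destruct (Hg k Hk) as [d2 [Hd2 H2]].
  destruct (common_pos d1 d2) as [d [Hd [Hl Hr]]]; auto.
  exists d. split; [exact Hd|]. intros w Hw.
  specialize (H1 w ltac:(lra)). specialize (H2 w ltac:(lra)).
  replace (f w * g w - f z * g z)%C
    with ((f w - f z) * (g w - g z) + f z * (g w - g z) + (f w - f z) * g z)%C by ring.
  eapply Rle_lt_trans; [apply Cmod_triangle|].
  eapply Rle_lt_trans; [apply Rplus_le_compat_r, Cmod_triangle|].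
  rewrite !Cmod_mult. fold A B.
  pose proof (Cmod_ge_0 (f w - f z)%C).
  nra.
Qed.

Lemma ccont_comp (f g : C -> C) (z : C) :
  ccont g z -> ccont f (g z) -> ccont (fun w => f (g w)) z.
Proof.
  intros Hg Hf e He. destruct (Hf e He) as [d1 [Hd1 H1]].
  destruct (Hg d1 Hd1) as [d2 [Hd2 H2]]. exists d2. split; auto.
Qed.

Lemma ccont_inv_at (z : C) : z <> 0%C -> ccont Cinv z.
Proof.
  intros Hz e He. pose proof (proj1 (Cmod_gt_0 z) Hz) as Hm.
  set (m := Cmod z) in *.
  destruct (common_pos (m / 2) (e * (m * m) / 2)) as [d [Hd [H1 H2]]];
    [lra|assert (0 < m * m) by nra; nra|].
  exists d. split; [exact Hd|]. intros w Hw.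
  pose proof (Cmod_triangle_rev z w) as H3. rewrite Cmod_minus_sym in H3. fold m in H3.
  assert (Hw0 : w <> 0%C) by (apply Cmod_gt_0; lra).
  replace (/ w - / z)%C with (- ((w - z) / (w * z)))%C by (field; auto).
  rewrite Cmod_opp, Cmod_div by (apply Cmult_neq_0; auto).
  rewrite Cmod_mult. fold m.
  apply Rmult_lt_reg_r with (Cmod w * m); [nra|].
  unfold Rdiv; rewrite Rmult_assoc, Rinv_l by nra. rewrite Rmult_1_r.
   nra.
Qed.

Lemma ccont_inv (f : C -> C) (z : C) : ccont f z -> f z <> 0%C -> ccont (fun w => / f w)%C z.
Proof. intros Hf H0. apply (ccont_comp Cinv f z Hf). apply ccont_inv_at; exact H0. Qed.

Lemma ccont_opp (f : C -> C) (z : C) : ccont f z -> ccont (fun w => - f w)%C z.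
Proof.
  intros Hf e He. destruct (Hf e He) as [d [Hd H]]. exists d. split; [exact Hd|].
  intros w Hw. replace (- f w - - f z)%C with (- (f w - f z))%C by ring.
  rewrite Cmod_opp. auto.
Qed.

Lemma ccont_minus (f g : C -> C) (z : C) :
  ccont f z -> ccont g z -> ccont (fun w => f w - g w)%C z.
Proof. intros Hf Hg. apply ccont_plus; [exact Hf|apply ccont_opp, Hg]. Qed.

Lemma ccont_div (f g : C -> C) (z : C) :
  ccont f z -> ccont g z -> g z <> 0%C -> ccont (fun w => f w / g w)%C z.
Proof. intros Hf Hg H0. apply ccont_mult; [exact Hf|apply ccont_inv; auto]. Qed.

Lemma ccont_ext_loc (f g : C -> C) (z : C) (d : R) :
  0 < d -> (forall w, Cmod (w - z)%C < d -> f w = g w) -> ccont f z -> ccont g z.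
Proof.
  intros Hd He Hf e Hep. destruct (Hf e Hep) as [d1 [Hd1 H1]].
  destruct (common_pos d d1) as [d2 [Hd2 [Hl Hr]]]; auto.
  exists d2. split; [exact Hd2|]. intros w Hw.
  rewrite <- (He w), <- (He z) by (try replace (z - z)%C with (RtoC 0) by ring; rewrite ?Cmod_0; lra).
  apply H1. lra.
Qed.

Lemma ccont_ext (f g : C -> C) (z : C) : (forall w, f w = g w) -> ccont f z -> ccont g z.
Proof. intros He. apply (ccont_ext_loc f g z 1); [lra|auto]. Qed.

Lemma ccont_pow (f : C -> C) (n : nat) (z : C) : ccont f z -> ccont (fun w => f w ^ n)%C z.
Proof.
  intros Hf. induction n as [|n IH]; simpl.
  - apply ccont_const.
  - apply ccont_mult; assumption.
Qed.

Lemma is_cder_ccont (f : C -> C) (z l : C) : is_cder f z l -> ccont f z.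
Proof.
  intros [h [_ [Hc He]]].
  apply ccont_ext with (fun w => h w * (w - z) + f z)%C.
  - intros w. rewrite <- He. ring.
  - apply ccont_plus; [|apply ccont_const].
    apply ccont_mult; [exact Hc|]. apply ccont_minus; [apply ccont_id|apply ccont_const].
Qed.

Lemma is_cder_const (c z : C) : is_cder (fun _ => c) z 0%C.
Proof.
  exists (fun _ => RtoC 0). repeat split; [apply ccont_const|]. intros w; ring.
Qed.

Lemma is_cder_id (z : C) : is_cder (fun w => w) z 1%C.
Proof.
  exists (fun _ => RtoC 1). repeat split; [apply ccont_const|]. intros w; ring.
Qed.

Lemma is_cder_plus (f g : C -> C) (z a b : C) :
  is_cder f z a -> is_cder g z b -> is_cder (fun w => f w + g w)%C z (a + b)%C.
Proof.
  intros [h [Ha [Hc He]]] [k [Hb [Kc Ke]]].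
  exists (fun w => h w + k w)%C. repeat split.
  - rewrite Ha, Hb; reflexivity.
  - apply ccont_plus; assumption.
  - intros w. replace (f w + g w - (f z + g z))%C with ((f w - f z) + (g w - g z))%C by ring.
    rewrite He, Ke. ring.
Qed.

Lemma is_cder_mult (f g : C -> C) (z a b : C) :
  is_cder f z a -> is_cder g z b -> is_cder (fun w => f w * g w)%C z (a * g z + f z * b)%C.
Proof.
  intros Hf [k [Hb [Kc Ke]]]. pose proof (is_cder_ccont _ _ _ Hf) as Hfc.
  destruct Hf as [h [Ha [Hc He]]].
  exists (fun w => h w * g z + f w * k w)%C. repeat split.
  - rewrite Ha, Hb; reflexivity.
  - apply ccont_plus; apply ccont_mult; auto using ccont_const.
  - intros w.
    replace (f w * g w - f z * g z)%C with ((f w - f z) * g z + f w * (g w - g z))%C by ring.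
    rewrite He, Ke. ring.
Qed.

Lemma is_cder_comp (f g : C -> C) (z a b : C) :
  is_cder g z a -> is_cder f (g z) b -> is_cder (fun w => f (g w)) z (b * a)%C.
Proof.
  intros Hg [k [Hb [Kc Ke]]]. pose proof (is_cder_ccont _ _ _ Hg) as Hgc.
  destruct Hg as [h [Ha [Hc He]]].
  exists (fun w => k (g w) * h w)%C. repeat split.
  - rewrite Ha, Hb; reflexivity.
  - apply ccont_mult; [apply (ccont_comp k g); assumption|assumption].
  - intros w. rewrite Ke, He. ring.
Qed.

(** The factor must satisfy its identity at every point of the plane, so it is rebuilt as the
    difference quotient of [g]; continuity at [z] is inherited from the old factor, with which it
    agrees near [z]. *)
Lemma is_cder_ext_loc (f g : C -> C) (z l : C) (d : R) :
  0 < d -> (forall w, Cmod (w - z)%C < d -> f w = g w) -> is_cder f z l -> is_cder g z l.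
Proof.
  intros Hd Heq [h [Hl [Hc He]]].
  exists (fun w => if Ceq_dec w z then l else (g w - g z) / (w - z))%C.
  assert (Hz : f z = g z).
  { apply Heq. replace (z - z)%C with (RtoC 0) by ring. rewrite Cmod_0; lra. }
  repeat split.
  - destruct (Ceq_dec z z); [reflexivity|congruence].
  - apply (ccont_ext_loc h _ z d Hd); [|exact Hc].
    intros w Hw. destruct (Ceq_dec w z) as [->|Hne]; [exact Hl|].
    rewrite <- (Heq w Hw), <- Hz, He. field. apply Cminus_eq_contra; exact Hne.
  - intros w. destruct (Ceq_dec w z) as [->|Hne]; [ring|].
    field. apply Cminus_eq_contra; exact Hne.
Qed.

Lemma is_cder_ext (f g : C -> C) (z l : C) :
  (forall w, f w = g w) -> is_cder f z l -> is_cder g z l.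
Proof. intros He. apply (is_cder_ext_loc f g z l 1); [lra|auto]. Qed.

Lemma is_cder_inv_at (z : C) : z <> 0%C -> is_cder Cinv z (- / (z * z))%C.
Proof.
  intros Hz. pose proof (proj1 (Cmod_gt_0 z) Hz) as Hm.
  (* The formula [- / (w * z)] breaks down at [w = 0], where [/ w] is only a default value. That
     point is at distance [Cmod z] from [z], so the exception does not affect continuity at [z]. *)
  exists (fun w => if Ceq_dec w 0 then (/ w - / z) / (w - z) else - / (w * z))%C.
  repeat split.
  - destruct (Ceq_dec z 0); [contradiction|reflexivity].
  - apply (ccont_ext_loc (fun w => - / (w * z))%C _ z (Cmod z) Hm).
    + intros w Hw. destruct (Ceq_dec w 0) as [->|_]; [|reflexivity].
      exfalso. replace (0 - z)%C with (- z)%C in Hw by ring.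
      rewrite Cmod_opp in Hw. lra.
    + apply ccont_opp, ccont_inv.
      * apply ccont_mult; [apply ccont_id|apply ccont_const].
      * apply Cmult_neq_0; assumption.
  - intros w. destruct (Ceq_dec w 0) as [Hw|Hw].
    + unfold Cdiv. rewrite <- Cmult_assoc, Cinv_l; [ring|].
      apply Cminus_eq_contra; congruence.
    + field; auto.
Qed.

Lemma is_cder_inv (f : C -> C) (z a : C) : f z <> 0%C -> is_cder f z a ->
  is_cder (fun w => / f w)%C z (- / (f z * f z) * a)%C.
Proof. intros H0 Hf. apply (is_cder_comp Cinv f); [exact Hf|apply is_cder_inv_at, H0]. Qed.

Lemma is_cder_scal (c : C) (f : C -> C) (z l : C) :
  is_cder f z l -> is_cder (fun w => c * f w)%C z (c * l)%C.
Proof.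
  intros Hf. pose proof (is_cder_mult (fun _ => c) f z 0 l (is_cder_const c z) Hf) as H.
  replace (c * l)%C with (0 * f z + c * l)%C by ring. exact H.
Qed.

Lemma is_cder_minus (f g : C -> C) (z a b : C) :
  is_cder f z a -> is_cder g z b -> is_cder (fun w => f w - g w)%C z (a - b)%C.
Proof.
  intros Hf Hg. replace (a - b)%C with (a + - (1) * b)%C by ring.
  apply (is_cder_ext (fun w => f w + - (1) * g w)%C); [intros w; ring|].
  apply is_cder_plus; [exact Hf|apply is_cder_scal, Hg].
Qed.

Definition cdiff (f : C -> C) (z : C) : Prop := exists l, is_cder f z l.

Lemma cdiff_ccont (f : C -> C) (z : C) : cdiff f z -> ccont f z.
Proof. intros [l H]. exact (is_cder_ccont _ _ _ H). Qed.
Lemma cdiff_const (c z : C) : cdiff (fun _ => c) z.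
Proof. eexists; apply is_cder_const. Qed.
Lemma cdiff_id (z : C) : cdiff (fun w => w) z.
Proof. eexists; apply is_cder_id. Qed.
Lemma cdiff_plus (f g : C -> C) (z : C) : cdiff f z -> cdiff g z -> cdiff (fun w => f w + g w)%C z.
Proof. intros [a Ha] [b Hb]. eexists; apply is_cder_plus; eassumption. Qed.
Lemma cdiff_mult (f g : C -> C) (z : C) : cdiff f z -> cdiff g z -> cdiff (fun w => f w * g w)%C z.
Proof. intros [a Ha] [b Hb]. eexists; apply is_cder_mult; eassumption. Qed.
Lemma cdiff_minus (f g : C -> C) (z : C) : cdiff f z -> cdiff g z -> cdiff (fun w => f w - g w)%C z.
Proof. intros [a Ha] [b Hb]. eexists; apply is_cder_minus; eassumption. Qed.
Lemma cdiff_inv (f : C -> C) (z : C) : f z <> 0%C -> cdiff f z -> cdiff (fun w => / f w)%C z.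
Proof. intros H0 [a Ha]. eexists. exact (is_cder_inv f z a H0 Ha). Qed.
Lemma cdiff_div (f g : C -> C) (z : C) : cdiff f z -> cdiff g z -> g z <> 0%C -> cdiff (fun w => f w / g w)%C z.
Proof. intros Hf Hg H0. apply cdiff_mult; [exact Hf|apply cdiff_inv; auto]. Qed.
Lemma cdiff_comp (f g : C -> C) (z : C) : cdiff g z -> cdiff f (g z) -> cdiff (fun w => f (g w)) z.
Proof. intros [a Ha] [b Hb]. eexists; apply (is_cder_comp f g); eassumption. Qed.
Lemma cdiff_ext_loc (f g : C -> C) (z : C) (d : R) : 0 < d -> (forall w, Cmod (w - z)%C < d -> f w = g w) ->
  cdiff f z -> cdiff g z.
Proof. intros Hd He [a Ha]. exists a. exact (is_cder_ext_loc f g z a d Hd He Ha). Qed.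
Lemma cdiff_pow (f : C -> C) (n : nat) (z : C) : cdiff f z -> cdiff (fun w => f w ^ n)%C z.
Proof.
  intros Hf. induction n as [|n IH]; simpl; [apply cdiff_const|apply cdiff_mult; assumption].
Qed.

Lemma is_cder_iff_eps (f : C -> C) (z l : C) :
  is_cder f z l <->
  forall eps, 0 < eps -> exists del, 0 < del /\ forall w, Cmod (w - z)%C < del ->
    Cmod (f w - f z - l * (w - z))%C <= eps * Cmod (w - z)%C.
Proof.
  split.
  - intros [h [Hl [Hc He]]] e Hep. destruct (Hc e Hep) as [d [Hd H]].
    exists d. split; [exact Hd|]. intros w Hw.
    rewrite He, <- Hl.
    replace (h w * (w - z) - h z * (w - z))%C with ((h w - h z) * (w - z))%C by ring.
    rewrite Cmod_mult. apply Rmult_le_compat_r; [apply Cmod_ge_0|left; auto].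
  - intros H.
    exists (fun w => if Ceq_dec w z then l else (f w - f z) / (w - z))%C.
    destruct (Ceq_dec z z) as [_|]; [|congruence].
    split; [reflexivity|]. split.
    + intros e Hep. destruct (H (e / 2)) as [d [Hd Hw]]; [lra|].
      exists d. split; [exact Hd|]. intros w Hwd.
      destruct (Ceq_dec z z) as [_|]; [|congruence].
      destruct (Ceq_dec w z) as [->|Hne].
      { replace (l - l)%C with (RtoC 0) by ring. rewrite Cmod_0; lra. }
      assert (Hm : 0 < Cmod (w - z)%C) by (apply Cmod_gt_0, Cminus_eq_contra, Hne).
      replace ((f w - f z) / (w - z) - l)%C with ((f w - f z - l * (w - z)) / (w - z))%C
        by (field; apply Cminus_eq_contra, Hne).
      rewrite Cmod_div by (apply Cminus_eq_contra, Hne).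
      apply Rle_lt_trans with (e / 2); [|lra].
      apply div_le; auto.
    + intros w. destruct (Ceq_dec w z) as [->|Hne]; [ring|].
      field. apply Cminus_eq_contra, Hne.
Qed.

Lemma holomorphic_is_cder (phi : C -> C) (z : C) :
  ex_derive (K := C_AbsRing) (V := C_NormedModule) phi z -> is_cder phi z (C_derive phi z).
Proof.
  intros H. apply is_cder_iff_eps. intros e He.
  pose proof (C_derive_correct phi z z H) as [_ Hd].
  specialize (Hd z (fun P HP => HP) (mkposreal e He)).
  destruct Hd as [d Hd].
  exists d. split; [apply cond_pos|]. intros w Hw. specialize (Hd w).
  simpl in Hd. unfold minus, plus, opp, scal, norm in Hd. simpl in Hd.
  unfold minus, plus, opp in Hd. simpl in Hd.
  replace (phi w - phi z - C_derive phi z * (w - z))%C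
    with (phi w + - phi z + - ((w + - z) * C_derive phi z))%C by ring.
  apply Hd, Hw.
Qed.
Lemma locally_Cmod (P : C -> Prop) (z : C) :
  locally z P <-> exists del, 0 < del /\ forall w, Cmod (w - z)%C < del -> P w.
Proof.
  rewrite (locally_C z P). split.
  - intros [d Hd]. exists d. split; [apply cond_pos|]. intros w Hw. apply Hd, Hw.
  - intros [d [Hd H]]. exists (mkposreal d Hd). intros w Hw. apply H, Hw.
Qed.

(** * Integrals of complex-valued functions and rectangles *)

(* The type of a Coquelicot integral is not syntactically [R], which stops [ring]. *)
Ltac ringR := match goal with |- @eq _ ?l ?r => change (@eq R l r) end; ring.

(** Continuity of a path is continuity of its extension that is constant on vertical lines, so the
    closure lemmas for [ccont] apply to paths as they stand. *)
Definition rcont (F : R -> C) (x : R) : Prop := ccont (fun z => F (Re z)) (RtoC x).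

Lemma ccont_rcont (f : C -> C) (g : R -> C) (x : R) :
  rcont g x -> ccont f (g x) -> rcont (fun t => f (g t)) x.
Proof. exact (ccont_comp f (fun z => g (Re z)) (RtoC x)). Qed.

Lemma rcont_lipschitz (p : C -> R) (F : R -> C) (x : R) :
  (forall z w, Rabs (p z - p w) <= Cmod (z - w)%C) -> rcont F x -> continuous (fun t => p (F t)) x.
Proof.
  intros Hp H. apply filterlim_locally. intros e.
  destruct (H e (cond_pos e)) as [d [Hd Hw]]. exists (mkposreal d Hd).
  intros t Ht. eapply Rle_lt_trans; [apply Hp|]. apply (Hw (RtoC t)).
  rewrite <- RtoC_minus, Cmod_R. exact Ht.
Qed.

Lemma rcont_Re (F : R -> C) (x : R) : rcont F x -> continuous (fun t => Re (F t)) x.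
Proof. apply (rcont_lipschitz Re). intros z w. exact (re_le_Cmod (z - w)%C). Qed.

Lemma rcont_Im (F : R -> C) (x : R) : rcont F x -> continuous (fun t => Im (F t)) x.
Proof. apply (rcont_lipschitz Im). intros z w. exact (im_le_Cmod (z - w)%C). Qed.

Lemma rcont_minus (F G : R -> C) (x : R) :
  rcont F x -> rcont G x -> rcont (fun t => F t - G t)%C x.
Proof. exact (ccont_minus _ _ _). Qed.

Lemma rcont_const (c : C) (x : R) : rcont (fun _ => c) x.
Proof. apply ccont_const. Qed.

Lemma rcont_scal (c : C) (F : R -> C) (x : R) : rcont F x -> rcont (fun t => c * F t)%C x.
Proof. exact (ccont_mult _ _ _ (ccont_const c _)). Qed.

Lemma rcont_pair (f g : R -> R) (x : R) :
  continuous f x -> continuous g x -> rcont (fun t => (f t, g t)) x.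
Proof.
  intros Hf Hg e He. assert (He2 : 0 < e / 2) by lra.
  pose proof (proj1 (filterlim_locally f (f x)) Hf (mkposreal _ He2)) as [d1 H1].
  pose proof (proj1 (filterlim_locally g (g x)) Hg (mkposreal _ He2)) as [d2 H2].
  destruct (common_pos d1 d2) as [d [Hd [L1 L2]]]; [apply cond_pos..|].
  exists d. split; [exact Hd|]. intros w Hw.
  pose proof (re_le_Cmod (w - RtoC x)%C) as HR. change (Re (w - RtoC x)%C) with (Re w - x) in HR.
  specialize (H1 (Re w) ltac:(eapply Rle_lt_trans; [exact HR|lra])).
  specialize (H2 (Re w) ltac:(eapply Rle_lt_trans; [exact HR|lra])).
  eapply Rle_lt_trans; [apply Cmod_le_Re_Im|].
  change (Rabs (f (Re w) - f x) < e / 2) in H1. change (Rabs (g (Re w) - g x) < e / 2) in H2.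
  simpl. unfold Rminus in *. lra.
Qed.

Definition Cint (F : R -> C) (a b : R) : C :=
  (RInt (fun t => Re (F t)) a b, RInt (fun t => Im (F t)) a b).

Lemma ex_RInt_Re (F : R -> C) (a b : R) : a <= b ->
  (forall t, a <= t <= b -> rcont F t) -> ex_RInt (fun t => Re (F t)) a b.
Proof.
  intros Hab H. apply (ex_RInt_continuous (V := R_CompleteNormedModule)).
  rewrite Rmin_left, Rmax_right by lra. intros t Ht. apply rcont_Re; auto.
Qed.

Lemma ex_RInt_Im (F : R -> C) (a b : R) : a <= b ->
  (forall t, a <= t <= b -> rcont F t) -> ex_RInt (fun t => Im (F t)) a b.
Proof.
  intros Hab H. apply (ex_RInt_continuous (V := R_CompleteNormedModule)).
  rewrite Rmin_left, Rmax_right by lra. intros t Ht. apply rcont_Im; auto.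
Qed.

Lemma RInt_plus_R (f g : R -> R) (a b : R) : ex_RInt f a b -> ex_RInt g a b ->
  RInt (fun t => f t + g t) a b = RInt f a b + RInt g a b.
Proof. intros Hf Hg. apply (RInt_plus (V := R_CompleteNormedModule)); assumption. Qed.

Lemma RInt_scal_R (k : R) (f : R -> R) (a b : R) : ex_RInt f a b ->
  RInt (fun t => k * f t) a b = k * RInt f a b.
Proof. intros Hf. apply (RInt_scal (V := R_CompleteNormedModule)); assumption. Qed.

Lemma ex_RInt_plus_R (f g : R -> R) (a b : R) : ex_RInt f a b -> ex_RInt g a b ->
  ex_RInt (fun t => f t + g t) a b.
Proof. intros Hf Hg. apply (ex_RInt_plus (V := R_NormedModule)); assumption. Qed.

Lemma ex_RInt_scal_R (k : R) (f : R -> R) (a b : R) : ex_RInt f a b ->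
  ex_RInt (fun t => k * f t) a b.
Proof. intros Hf. apply (ex_RInt_scal (V := R_NormedModule)); assumption. Qed.

Lemma RInt_Chasles_R (f : R -> R) (a b c : R) : ex_RInt f a b -> ex_RInt f b c ->
  RInt f a b + RInt f b c = RInt f a c.
Proof. intros Hf Hg. exact (RInt_Chasles (V := R_CompleteNormedModule) f a b c Hf Hg). Qed.

Lemma Cint_ext (F G : R -> C) (a b : R) : a <= b ->
  (forall t, a <= t <= b -> F t = G t) -> Cint F a b = Cint G a b.
Proof.
  intros Hab H. unfold Cint. f_equal; apply RInt_ext;
    rewrite Rmin_left, Rmax_right by lra; intros t Ht; rewrite H; auto; lra.
Qed.

Lemma Cint_plus (F G : R -> C) (a b : R) : a <= b ->
  (forall t, a <= t <= b -> rcont F t) -> (forall t, a <= t <= b -> rcont G t) ->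
  Cint (fun t => F t + G t)%C a b = (Cint F a b + Cint G a b)%C.
Proof.
  intros Hab HF HG. unfold Cint, Cplus; simpl. f_equal.
  - apply RInt_plus_R; apply ex_RInt_Re; assumption.
  - apply RInt_plus_R; apply ex_RInt_Im; assumption.
Qed.

Lemma Cint_scal (c : C) (F : R -> C) (a b : R) : a <= b ->
  (forall t, a <= t <= b -> rcont F t) ->
  Cint (fun t => c * F t)%C a b = (c * Cint F a b)%C.
Proof.
  intros Hab HF. unfold Cint. destruct c as [p q].
  pose proof (ex_RInt_Re F a b Hab HF) as E1. pose proof (ex_RInt_Im F a b Hab HF) as E2.
  unfold Cmult; simpl. f_equal.
  - rewrite <- RInt_scal_R with (k := p), <- RInt_scal_R with (k := q) by assumption.
    rewrite (RInt_ext _ (fun t => p * Re (F t) + (-1) * (q * Im (F t)))).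
    + rewrite RInt_plus_R, (RInt_scal_R (-1) (fun t => q * Im (F t))); [ringR|..];
        [apply (ex_RInt_scal_R q)|apply (ex_RInt_scal_R p)
        |apply (ex_RInt_scal_R (-1)), (ex_RInt_scal_R q)]; assumption.
    + intros t _. unfold Re, Im. simpl. ring.
  - rewrite <- RInt_scal_R with (k := p), <- RInt_scal_R with (k := q) by assumption.
    rewrite <- RInt_plus_R; [reflexivity|apply (ex_RInt_scal_R p)|apply (ex_RInt_scal_R q)];
      assumption.
Qed.

Lemma Cint_minus (F G : R -> C) (a b : R) : a <= b ->
  (forall t, a <= t <= b -> rcont F t) -> (forall t, a <= t <= b -> rcont G t) ->
  Cint (fun t => F t - G t)%C a b = (Cint F a b - Cint G a b)%C.
Proof.
  intros Hab HF HG.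
  rewrite (Cint_ext _ (fun t => F t + (- (1)) * G t)%C) by (auto; intros; ring).
  rewrite Cint_plus, Cint_scal; auto; [ring|]. intros t Ht. apply rcont_scal; auto.
Qed.

Lemma Cint_const (c : C) (a b : R) : Cint (fun _ => c) a b = (RtoC (b - a) * c)%C.
Proof.
  unfold Cint. rewrite !RInt_const. destruct c as [p q].
  unfold scal; simpl. unfold mult; simpl. unfold RtoC, Cmult; simpl. f_equal; ring.
Qed.

Lemma Cint_Chasles (F : R -> C) (a b c : R) : a <= b -> b <= c ->
  (forall t, a <= t <= c -> rcont F t) ->
  Cint F a c = (Cint F a b + Cint F b c)%C.
Proof.
  intros Hab Hbc HF. unfold Cint, Cplus; simpl. f_equal; symmetry;
    apply RInt_Chasles_R.
  1, 2: apply (ex_RInt_Re F).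
  5, 6: apply (ex_RInt_Im F).
  all: auto; intros t Ht; apply HF; lra.
Qed.

Lemma Cint_Re_le (F : R -> C) (g : R -> R) (a b : R) : a <= b ->
  (forall t, a <= t <= b -> rcont F t) -> ex_RInt g a b ->
  (forall t, a <= t <= b -> Re (F t) <= g t) -> Re (Cint F a b) <= RInt g a b.
Proof.
  intros Hab HF Hg H. simpl. apply RInt_le; auto.
  - apply ex_RInt_Re; assumption.
  - intros t Ht. apply H; lra.
Qed.

(** A unimodular [u] rotates the integral onto the positive real axis; its modulus is then the real
    part of the integral of [u * F], and real parts are compared pointwise. *)
Lemma Cint_norm_le (F : R -> C) (g : R -> R) (a b : R) : a <= b ->
  (forall t, a <= t <= b -> rcont F t) -> ex_RInt g a b ->
  (forall t, a <= t <= b -> Cmod (F t) <= g t) -> Cmod (Cint F a b) <= RInt g a b.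
Proof.
  intros Hab HF Hg H. set (I := Cint F a b).
  destruct (Ceq_dec I 0) as [->|HI].
  { rewrite Cmod_0. apply RInt_ge_0; auto. intros t Ht.
    eapply Rle_trans; [apply Cmod_ge_0|apply H; lra]. }
  assert (Hm : 0 < Cmod I) by (apply Cmod_gt_0, HI).
  set (u := (Cconj I / RtoC (Cmod I))%C).
  assert (Hm0 : RtoC (Cmod I) <> 0%C) by (intros E; apply RtoC_inj in E; lra).
  assert (Hu : Cmod u = 1).
  { unfold u. rewrite Cmod_div, Cmod_conj, Cmod_R, Rabs_pos_eq by (auto; lra).
    field; lra. }
  assert (HuI : (u * I)%C = RtoC (Cmod I)).
  { unfold u. replace (Cconj I / RtoC (Cmod I) * I)%C with ((I * Cconj I) / RtoC (Cmod I))%C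
      by (field; auto).
    rewrite <- Cmod2_conj. rewrite RtoC_pow. field; auto. }
  replace (Cmod I) with (Re (u * I)%C) by (rewrite HuI; reflexivity).
  unfold I. rewrite <- Cint_scal by auto.
  apply Cint_Re_le; auto.
  - intros t Ht. apply rcont_scal; auto.
  - intros t Ht. eapply Rle_trans; [apply Rle_abs|].
    eapply Rle_trans; [apply re_le_Cmod|]. rewrite Cmod_mult, Hu, Rmult_1_l. auto.
Qed.

Lemma Cint_norm_le_const (F : R -> C) (M a b : R) : a <= b ->
  (forall t, a <= t <= b -> rcont F t) ->
  (forall t, a <= t <= b -> Cmod (F t) <= M) -> Cmod (Cint F a b) <= M * (b - a).
Proof.
  intros Hab HF H.
  replace (M * (b - a)) with (RInt (fun _ => M) a b)
    by (rewrite RInt_const; unfold scal; simpl; unfold mult; simpl; ring).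
  apply Cint_norm_le; auto. apply ex_RInt_const.
Qed.

Lemma Cint_affine (c d : C) (a b : R) : a <= b ->
  Cint (fun t => c + RtoC t * d)%C a b
  = (RtoC (b - a) * c + RtoC ((b * b - a * a) / 2) * d)%C.
Proof.
  intros Hab.
  assert (Hr : forall p q : R, RInt (fun t => p + t * q) a b = (b - a) * p + (b * b - a * a) / 2 * q).
  { intros p q. apply is_RInt_unique.
    pose (g := fun t : R => p * t + t * t / 2 * q).
    replace ((b - a) * p + (b * b - a * a) / 2 * q) with (minus (g b) (g a))
      by (unfold g, minus, plus, opp; simpl; field).
    apply (is_RInt_derive (V := R_CompleteNormedModule) g).
    - intros x _. unfold g. auto_derive; [exact I|]. field.
    - intros x _. apply continuity_pt_filterlim. reg. }
  unfold Cint. destruct c as [p q], d as [r s]. unfold RtoC, Cplus, Cmult; simpl.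
  f_equal.
  - rewrite (RInt_ext _ (fun t => p + t * r)) by (intros; simpl; ring). rewrite Hr. ringR.
  - rewrite (RInt_ext _ (fun t => q + t * s)) by (intros; simpl; ring). rewrite Hr. ringR.
Qed.

(* Boundary integral of the rectangle [x, x + a] x [y, y + b]. *)
Definition rect_int (F : C -> C) (x y a b : R) : C :=
  (Cint (fun t => F (t, y)) x (x + a) - Cint (fun t => F (t, y + b)%R) x (x + a)
   + Ci * (Cint (fun t => F (x + a, t)%R) y (y + b) - Cint (fun t => F (x, t)) y (y + b)))%C.

Definition in_rect (x y a b : R) (z : C) : Prop :=
  x <= Re z <= x + a /\ y <= Im z <= y + b.

Lemma rcont_hor (F : C -> C) (x y : R) : ccont F (x, y) -> rcont (fun t => F (t, y)) x.
Proof.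
  intros H. apply (ccont_rcont F (fun t => (t, y))); [|exact H].
  apply rcont_pair; [apply continuous_id|apply continuous_const].
Qed.

Lemma rcont_ver (F : C -> C) (x y : R) : ccont F (x, y) -> rcont (fun t => F (x, t)) y.
Proof.
  intros H. apply (ccont_rcont F (fun t => (x, t))); [|exact H].
  apply rcont_pair; [apply continuous_const|apply continuous_id].
Qed.

Lemma rect_int_split_hor (F : C -> C) (x y a1 a2 b : R) : 0 <= a1 -> 0 <= a2 -> 0 <= b ->
  (forall z, in_rect x y (a1 + a2) b z -> ccont F z) ->
  rect_int F x y (a1 + a2) b = (rect_int F x y a1 b + rect_int F (x + a1) y a2 b)%C.
Proof.
  intros H1 H2 Hb HF. unfold rect_int.
  rewrite <- !Rplus_assoc.
  rewrite (Cint_Chasles (fun t => F (t, y)) x (x + a1) (x + a1 + a2)),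
    (Cint_Chasles (fun t => F (t, y + b)) x (x + a1) (x + a1 + a2)); try lra.
  - ring.
  - intros t Ht. apply rcont_hor, HF. split; simpl; lra.
  - intros t Ht. apply rcont_hor, HF. split; simpl; lra.
Qed.

Lemma rect_int_split_ver (F : C -> C) (x y a b1 b2 : R) : 0 <= a -> 0 <= b1 -> 0 <= b2 ->
  (forall z, in_rect x y a (b1 + b2) z -> ccont F z) ->
  rect_int F x y a (b1 + b2) = (rect_int F x y a b1 + rect_int F x (y + b1) a b2)%C.
Proof.
  intros Ha H1 H2 HF. unfold rect_int.
  rewrite <- !Rplus_assoc.
  rewrite (Cint_Chasles (fun t => F (x, t)) y (y + b1) (y + b1 + b2)),
    (Cint_Chasles (fun t => F (x + a, t)%R) y (y + b1) (y + b1 + b2)); try lra.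
  - ring.
  - intros t Ht. apply rcont_ver, HF. split; simpl; lra.
  - intros t Ht. apply rcont_ver, HF. split; simpl; lra.
Qed.

Lemma rect_int_affine (c d : C) (x y a b : R) : 0 <= a -> 0 <= b ->
  rect_int (fun z => c + z * d)%C x y a b = 0%C.
Proof.
  intros Ha Hb. unfold rect_int.
  assert (Hh : forall y0, Cint (fun t => c + (t, y0) * d)%C x (x + a)
     = Cint (fun t => (c + (0, y0) * d) + RtoC t * d)%C x (x + a)).
  { intros y0. apply Cint_ext; [lra|]. intros t _.
    replace ((t, y0) : C) with ((0, y0) + RtoC t)%C; [ring|].
    unfold RtoC, Cplus; simpl; f_equal; ring. }
  assert (Hv : forall x0, Cint (fun t => c + (x0, t) * d)%C y (y + b)
     = Cint (fun t => (c + RtoC x0 * d) + RtoC t * (Ci * d))%C y (y + b)).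
  { intros x0. apply Cint_ext; [lra|]. intros t _.
    replace ((x0, t) : C) with (RtoC x0 + RtoC t * Ci)%C; [ring|].
    unfold RtoC, Ci, Cplus, Cmult; simpl; f_equal; ring. }
  rewrite !Hh, !Hv, !Cint_affine by lra.
  destruct c as [p q], d as [r s]. unfold RtoC, Ci, Cminus, Copp, Cplus, Cmult; simpl.
  f_equal; field.
Qed.

Lemma rect_int_minus (F G : C -> C) (x y a b : R) : 0 <= a -> 0 <= b ->
  (forall z, in_rect x y a b z -> ccont F z) -> (forall z, in_rect x y a b z -> ccont G z) ->
  rect_int (fun z => F z - G z)%C x y a b = (rect_int F x y a b - rect_int G x y a b)%C.
Proof.
  intros Ha Hb HF HG. unfold rect_int.
  rewrite !Cint_minus; try lra; [ring|..];
    intros t Ht; (apply rcont_ver || apply rcont_hor); (apply HF || apply HG);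
    split; simpl; lra.
Qed.

Lemma rect_int_bound (F : C -> C) (x y a b M : R) : 0 <= a -> 0 <= b ->
  (forall z, in_rect x y a b z -> ccont F z) ->
  (forall z, in_rect x y a b z -> Cmod (F z) <= M) ->
  Cmod (rect_int F x y a b) <= M * (2 * (a + b)).
Proof.
  intros Ha Hb HF HM. unfold rect_int.
  eapply Rle_trans; [apply Cmod_triangle|].
  rewrite Cmod_mult, Cmod_Ci, Rmult_1_l.
  eapply Rle_trans; [apply Rplus_le_compat; apply Cmod_triangle_minus|].
  assert (B1 : forall y0, y <= y0 <= y + b -> Cmod (Cint (fun t => F (t, y0)) x (x + a)) <= M * (x + a - x)).
  { intros y0 Hy. apply Cint_norm_le_const; [lra|..]; intros t Ht;
      [apply rcont_hor, HF|apply HM]; split; simpl; lra. }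
  assert (B2 : forall x0, x <= x0 <= x + a -> Cmod (Cint (fun t => F (x0, t)) y (y + b)) <= M * (y + b - y)).
  { intros y0 Hy. apply Cint_norm_le_const; [lra|..]; intros t Ht;
      [apply rcont_ver, HF|apply HM]; split; simpl; lra. }
  pose proof (B1 y ltac:(lra)). pose proof (B1 (y + b) ltac:(lra)).
  pose proof (B2 x ltac:(lra)). pose proof (B2 (x + a) ltac:(lra)).
  nra.
Qed.

(** * Goursat's lemma *)

Lemma nested_intervals (u : nat -> R) (c : R) : 0 <= c ->
  (forall n, u n <= u (S n)) ->
  (forall n, u (S n) + c / 2 ^ (S n) <= u n + c / 2 ^ n) ->
  exists p, forall n, u n <= p <= u n + c / 2 ^ n.
Proof.
  intros Hc Hu Hv.
  assert (Hmono : forall n m, u n <= u (n + m)%nat).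
  { intros n m; induction m as [|m IH]; [rewrite Nat.add_0_r; lra|].
    rewrite Nat.add_succ_r. eapply Rle_trans; [exact IH|apply Hu]. }
  assert (Hanti : forall n m, u (n + m)%nat + c / 2 ^ (n + m) <= u n + c / 2 ^ n).
  { intros n m; induction m as [|m IH]; [rewrite Nat.add_0_r; lra|].
    rewrite Nat.add_succ_r. eapply Rle_trans; [apply Hv|exact IH]. }
  assert (Hpos : forall n, 0 <= c / 2 ^ n).
  { intros n. apply Rle_mult_inv_pos; [exact Hc|apply pow_lt; lra]. }
  assert (Hub : forall n m, u m <= u n + c / 2 ^ n).
  { intros n m. destruct (Nat.le_ge_cases n m) as [H|H].
    - replace m with (n + (m - n))%nat by lia.
      pose proof (Hanti n (m - n)%nat). pose proof (Hpos (n + (m - n))%nat). lra.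
    - pose proof (Hmono m (n - m)%nat) as H1. replace (m + (n - m))%nat with n in H1 by lia.
      pose proof (Hpos n). lra. }
  destruct (completeness (fun x => exists n, x = u n)) as [p [Hp1 Hp2]].
  - exists (u 0%nat + c / 2 ^ 0). intros x [n ->]. apply Hub.
  - exists (u 0%nat), 0%nat. reflexivity.
  - exists p. intros n. split.
    + apply Hp1. exists n; reflexivity.
    + apply Hp2. intros x [m ->]. apply Hub.
Qed.

Section Goursat.

Variables (F : C -> C) (a b : R).

(** One step of the bisection. The tests look for a quarter whose boundary integral is at least a
    fourth of the whole; the last quarter is the default because, by the triangle inequality, it
    qualifies when the other three fail. *)
Definition quarter (p : R * R) (n : nat) : R * R :=
  let x := fst p in let y := snd p in
  let a' := a / 2 ^ S n in let b' := b / 2 ^ S n in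
  let t := Cmod (rect_int F x y (a / 2 ^ n) (b / 2 ^ n)) / 4 in
  if Rle_dec t (Cmod (rect_int F x y a' b')) then (x, y)
  else if Rle_dec t (Cmod (rect_int F (x + a') y a' b')) then (x + a', y)
  else if Rle_dec t (Cmod (rect_int F x (y + b') a' b')) then (x, y + b')
  else (x + a', y + b').

Fixpoint corner (p : R * R) (n : nat) : R * R :=
  match n with
  | O => p
  | S m => quarter (corner p m) m
  end.

Lemma quarter_cases (p : R * R) (n : nat) :
  (fst (quarter p n) = fst p \/ fst (quarter p n) = fst p + a / 2 ^ S n) /\
  (snd (quarter p n) = snd p \/ snd (quarter p n) = snd p + b / 2 ^ S n).
Proof.
  unfold quarter. repeat (destruct (Rle_dec _ _); simpl; auto).
Qed.

Lemma quarter_int (p : R * R) (n : nat) : 0 <= a -> 0 <= b ->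
  (forall z, in_rect (fst p) (snd p) (a / 2 ^ n) (b / 2 ^ n) z -> ccont F z) ->
  Cmod (rect_int F (fst p) (snd p) (a / 2 ^ n) (b / 2 ^ n)) / 4 <=
  Cmod (rect_int F (fst (quarter p n)) (snd (quarter p n)) (a / 2 ^ S n) (b / 2 ^ S n)).
Proof.
  intros Ha Hb HF. unfold quarter. destruct p as [x y]; cbn [fst snd] in *.
  set (a' := a / 2 ^ S n). set (b' := b / 2 ^ S n).
  assert (Hp : 0 < 2 ^ n) by (apply pow_lt; lra).
  assert (Ea : a / 2 ^ n = a' + a') by (unfold a'; simpl; field; lra).
  assert (Eb : b / 2 ^ n = b' + b') by (unfold b'; simpl; field; lra).
  assert (Ha' : 0 <= a') by (apply Rle_mult_inv_pos; [auto|apply pow_lt; lra]).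
  assert (Hb' : 0 <= b') by (apply Rle_mult_inv_pos; [auto|apply pow_lt; lra]).
  rewrite Ea, Eb in HF |- *.
  assert (E : rect_int F x y (a' + a') (b' + b') =
    (rect_int F x y a' b' + rect_int F (x + a') y a' b'
    + (rect_int F x (y + b') a' b' + rect_int F (x + a') (y + b') a' b'))%C).
  { rewrite rect_int_split_ver by (auto; lra).
    rewrite !rect_int_split_hor; auto; intros z [Hz1 Hz2]; apply HF; split; lra. }
  rewrite E.
  pose proof (Cmod_triangle (rect_int F x y a' b' + rect_int F (x + a') y a' b')
    (rect_int F x (y + b') a' b' + rect_int F (x + a') (y + b') a' b')) as T1.
  pose proof (Cmod_triangle (rect_int F x y a' b') (rect_int F (x + a') y a' b')) as T2.
  pose proof (Cmod_triangle (rect_int F x (y + b') a' b') (rect_int F (x + a') (y + b') a' b')) as T3.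
  repeat (destruct (Rle_dec _ _) as [|?%Rnot_le_lt]; cbn [fst snd]; [assumption|]). lra.
Qed.

(** The bisection loses at most a factor 4 per step. At the limit point [q] the function is affine
    up to [e * Cmod (z - q)], affine functions integrate to 0, and the remaining error is [e] times
    side length times perimeter, which shrinks by exactly 4 per step. So the integral is below a
    fixed multiple of every [e]. *)
Lemma goursat (x y : R) : 0 <= a -> 0 <= b ->
  (forall z, in_rect x y a b z -> cdiff F z) -> rect_int F x y a b = 0%C.
Proof.
  intros Ha Hb HF.
  set (p := corner (x, y)).
  assert (Hdiv : forall c n, 0 <= c -> 0 <= c / 2 ^ n).
  { intros c n Hc. apply Rle_mult_inv_pos; [exact Hc|apply pow_lt; lra]. }
  assert (Hhalf : forall c n, c / 2 ^ n = c / 2 ^ S n + c / 2 ^ S n).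
  { intros c n. simpl. field. apply pow_nonzero; lra. }
  assert (H1 : forall n, fst (p n) <= fst (p (S n)) /\
      fst (p (S n)) + a / 2 ^ S n <= fst (p n) + a / 2 ^ n).
  { intros n. pose proof (proj1 (quarter_cases (p n) n)) as H.
    change (quarter (p n) n) with (p (S n)) in H.
    pose proof (Hdiv a (S n) Ha). rewrite (Hhalf a n). lra. }
  assert (H2 : forall n, snd (p n) <= snd (p (S n)) /\
      snd (p (S n)) + b / 2 ^ S n <= snd (p n) + b / 2 ^ n).
  { intros n. pose proof (proj2 (quarter_cases (p n) n)) as H.
    change (quarter (p n) n) with (p (S n)) in H.
    pose proof (Hdiv b (S n) Hb). rewrite (Hhalf b n). lra. }
  assert (Hin : forall n z, in_rect (fst (p n)) (snd (p n)) (a / 2 ^ n) (b / 2 ^ n) z ->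
      in_rect x y a b z).
  { induction n as [|n IH]; intros z Hz.
    - simpl in Hz. unfold Rdiv in Hz. rewrite Rinv_1, !Rmult_1_r in Hz. exact Hz.
    - apply IH. destruct Hz as [Hz1 Hz2]. specialize (H1 n). specialize (H2 n).
      split; lra. }
  assert (Hint : forall n, Cmod (rect_int F x y a b) / 4 ^ n <=
      Cmod (rect_int F (fst (p n)) (snd (p n)) (a / 2 ^ n) (b / 2 ^ n))).
  { induction n as [|n IH].
    - simpl. unfold Rdiv. rewrite Rinv_1, !Rmult_1_r. lra.
    - eapply Rle_trans; [|apply quarter_int; auto].
      + simpl. apply Rle_trans with (Cmod (rect_int F x y a b) / 4 ^ n / 4).
        * right. field. apply pow_nonzero; lra.
        * unfold Rdiv at 1 3. apply Rmult_le_compat_r; [lra|exact IH].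
      + intros z Hz. apply cdiff_ccont, HF, (Hin n), Hz. }
  destruct (nested_intervals (fun n => fst (p n)) a Ha (fun n => proj1 (H1 n)) (fun n => proj2 (H1 n)))
    as [px Hpx].
  destruct (nested_intervals (fun n => snd (p n)) b Hb (fun n => proj1 (H2 n)) (fun n => proj2 (H2 n)))
    as [py Hpy].
  set (q := (px, py) : C).
  assert (Hq : forall n, in_rect (fst (p n)) (snd (p n)) (a / 2 ^ n) (b / 2 ^ n) q).
  { intros n. split; simpl; [apply Hpx|apply Hpy]. }
  destruct (HF q (Hin 0%nat q (Hq 0%nat))) as [l Hl].
  assert (Hsmall : forall e, 0 < e -> Cmod (rect_int F x y a b) <= e * (2 * (a + b) * (a + b))).
  { intros e He.
    destruct (proj1 (is_cder_iff_eps F q l) Hl e He) as [d [Hd Hlin]].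
    (* The [+ 1] in the denominator covers the degenerate rectangle with [a + b = 0]. *)
    assert (Hn : exists n, (a + b) / 2 ^ n < d).
    { destruct (pow_lt_1_zero (/ 2) ltac:(rewrite Rabs_pos_eq; lra) (d / (a + b + 1)))
        as [N HN]; [apply Rdiv_lt_0_compat; lra|].
      exists N. specialize (HN N (le_n N)). rewrite Rabs_pos_eq in HN
        by (apply pow_le; lra).
      rewrite pow_inv in HN.
      assert (0 < / 2 ^ N) by (apply Rinv_0_lt_compat, pow_lt; lra).
      apply Rlt_div_r in HN; [|lra]. unfold Rdiv. lra. }
    destruct Hn as [n Hn].
    specialize (Hint n).
    set (xn := fst (p n)) in *. set (yn := snd (p n)) in *.
    assert (Hp2 : 0 < 2 ^ n) by (apply pow_lt; lra).
    set (an := a / 2 ^ n) in *. set (bn := b / 2 ^ n) in *.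
    assert (Han : 0 <= an) by (apply Hdiv; auto).
    assert (Hbn : 0 <= bn) by (apply Hdiv; auto).
    assert (Hab : an + bn < d).
    { unfold an, bn. replace (a / 2 ^ n + b / 2 ^ n) with ((a + b) / 2 ^ n) by (field; lra). exact Hn. }
    set (A := fun z : C => ((F q - l * q) + z * l)%C).
    assert (HA : forall z, ccont A z).
    { intros z. apply ccont_plus; [apply ccont_const|].
      apply ccont_mult; [apply ccont_id|apply ccont_const]. }
    assert (Hdist : forall z, in_rect xn yn an bn z -> Cmod (z - q)%C <= an + bn).
    { intros z [Hz1 Hz2]. eapply Rle_trans; [apply Cmod_le_Re_Im|].
      destruct z as [zx zy]. simpl in *. specialize (Hpx n). specialize (Hpy n).
      fold xn an in Hpx. fold yn bn in Hpy.
      apply Rplus_le_compat; apply Rabs_le; lra. }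
    assert (HFc : forall z, in_rect xn yn an bn z -> ccont F z).
    { intros z Hz. apply cdiff_ccont, HF, (Hin n), Hz. }
    assert (Hbd : Cmod (rect_int F xn yn an bn) <= e * (an + bn) * (2 * (an + bn))).
    { replace (rect_int F xn yn an bn)
        with (rect_int (fun z => F z - A z)%C xn yn an bn).
      - apply rect_int_bound; auto.
        + intros z Hz. apply ccont_minus; auto.
        + intros z Hz. specialize (Hdist z Hz).
          replace (F z - A z)%C with (F z - F q - l * (z - q))%C by (unfold A; ring).
          eapply Rle_trans; [apply Hlin; lra|]. apply Rmult_le_compat_l; lra.
      - rewrite rect_int_minus by auto. unfold A. rewrite rect_int_affine by auto. ring. }
    assert (H4 : 0 < 4 ^ n) by (apply pow_lt; lra).
    assert (E4 : 4 ^ n = 2 ^ n * 2 ^ n) by (rewrite <- Rpow_mult_distr; f_equal; lra).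
    apply Rmult_le_reg_r with (/ 4 ^ n); [apply Rinv_0_lt_compat; auto|].
    apply Rle_trans with (1 := Hint). apply Rle_trans with (1 := Hbd).
    right. unfold an, bn. rewrite E4. field. lra. }
  apply Cmod_eq_0. apply Rle_antisym; [|apply Cmod_ge_0].
  apply le_epsilon. intros e He. rewrite Rplus_0_l.
  assert (Hk : 0 < 2 * (a + b) * (a + b) + 1) by nra.
  eapply Rle_trans; [apply (Hsmall (e / (2 * (a + b) * (a + b) + 1)))|].
  - apply Rdiv_lt_0_compat; lra.
  - apply Rmult_le_reg_r with (2 * (a + b) * (a + b) + 1); [exact Hk|].
    replace (e / (2 * (a + b) * (a + b) + 1) * (2 * (a + b) * (a + b)) * (2 * (a + b) * (a + b) + 1))
      with (e * (2 * (a + b) * (a + b))) by (field; lra).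
    nra.
Qed.

End Goursat.

(** * The complex exponential *)

Definition cis (t : R) : C := (cos t, sin t).

Definition cexp (z : C) : C := (RtoC (exp (Re z)) * cis (Im z))%C.

Lemma Cmod_cis (t : R) : Cmod (cis t) = 1.
Proof.
  unfold Cmod, cis. cbn [fst snd].
  replace (cos t ^ 2 + sin t ^ 2) with 1; [apply sqrt_1|].
  pose proof (sin2_cos2 t) as H. unfold Rsqr in H. nra.
Qed.

Lemma cexp_neq_0 (z : C) : cexp z <> 0%C.
Proof.
  apply Cmod_gt_0. unfold cexp. rewrite Cmod_mult, Cmod_cis, Cmod_R, Rmult_1_r.
  apply Rabs_pos_lt. pose proof (exp_pos (Re z)). lra.
Qed.

Lemma cexp_plus (z w : C) : cexp (z + w) = (cexp z * cexp w)%C.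
Proof.
  destruct z as [x y], w as [u v]. unfold cexp, cis; simpl.
  rewrite exp_plus, cos_plus, sin_plus. unfold RtoC, Cmult; simpl. f_equal; ring.
Qed.

Lemma derivable_pt_lim_eps (f : R -> R) (l : R) : derivable_pt_lim f 0 l ->
  forall eps, 0 < eps -> exists del, 0 < del /\ forall h, Rabs h < del ->
    Rabs (f h - f 0 - l * h) <= eps * Rabs h.
Proof.
  intros H e He. destruct (H e He) as [d Hd]. exists d. split; [apply cond_pos|].
  intros h Hh. destruct (Req_dec h 0) as [->|H0].
  - replace (f 0 - f 0 - l * 0) with 0 by ring. rewrite Rabs_R0. lra.
  - specialize (Hd h H0 Hh). rewrite Rplus_0_l in Hd.
    replace (f h - f 0 - l * h) with (((f h - f 0) / h - l) * h) by (field; auto).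
    rewrite Rabs_mult. apply Rmult_le_compat_r; [apply Rabs_pos|lra].
Qed.

(** The functional equation moves the point to 0, where the real expansions of exp, cos and sin are
    combined. The 9 in the choice of [k] is the sum of the bounds 4 and 5 obtained for the real and
    imaginary parts. *)
Lemma is_cder_cexp (z : C) : is_cder cexp z (cexp z).
Proof.
  apply is_cder_iff_eps. intros e He.
  set (m := Cmod (cexp z)).
  assert (Hm : 0 < m) by (apply Cmod_gt_0, cexp_neq_0).
  destruct (small_factor e (9 * m)) as [k [Hk [Hk1 Hk2]]]; [lra..|].
  pose proof (derivable_pt_lim_exp 0) as De. pose proof (derivable_pt_lim_cos 0) as Dc.
  pose proof (derivable_pt_lim_sin 0) as Ds.
  rewrite exp_0 in De. rewrite sin_0 in Dc. rewrite cos_0 in Ds.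
  destruct (derivable_pt_lim_eps _ _ De k Hk) as [d1 [Hd1 H1]].
  destruct (derivable_pt_lim_eps _ _ Dc k Hk) as [d2 [Hd2 H2]].
  destruct (derivable_pt_lim_eps _ _ Ds k Hk) as [d3 [Hd3 H3]].
  rewrite exp_0 in H1. rewrite cos_0 in H2. rewrite sin_0 in H3.
  destruct (common_pos d1 k) as [d4 [Hd4 [L1 L2]]]; auto.
  destruct (common_pos d2 d3) as [d5 [Hd5 [L3 L4]]]; auto.
  destruct (common_pos d4 d5) as [d [Hd [L5 L6]]]; auto.
  exists d. split; [exact Hd|]. intros w Hw.
  set (h := (w - z)%C) in *.
  assert (Ew : w = (z + h)%C) by (unfold h; ring).
  rewrite Ew at 1. rewrite cexp_plus.
  replace (cexp z * cexp h - cexp z - cexp z * h)%C with (cexp z * (cexp h - 1 - h))%C by ring.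
  rewrite Cmod_mult. fold m.
  pose proof (re_le_Cmod h) as Hr. pose proof (im_le_Cmod h) as Hi.
  pose proof (Cmod_le_Re_Im (cexp h - 1 - h)%C) as Hn.
  clearbody h. destruct h as [x y]. set (c := Cmod ((x, y) : C)) in *. simpl in Hr, Hi.
  specialize (H1 x ltac:(lra)). specialize (H2 y ltac:(lra)). specialize (H3 y ltac:(lra)).
  assert (HE : Rabs (exp x - 1) <= 2 * Rabs x).
  { replace (exp x - 1) with ((exp x - 1 - 1 * x) + x) by ring.
    eapply Rle_trans; [apply Rabs_triang|]. pose proof (Rabs_pos x). nra. }
  assert (HE3 : exp x <= 3).
  { pose proof (Rle_abs (exp x - 1)). lra. }
  pose proof (exp_pos x) as HE0.
  unfold cexp, cis in Hn |- *; simpl in Hn |- *.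
  set (re := exp x * cos y - 0 * sin y + - (1) + - x) in *.
  assert (Hre : Rabs re <= 4 * k * c).
  { replace re with (exp x * (cos y - 1 - - 0 * y) + (exp x - 1 - 1 * x)) by (unfold re; ring).
    eapply Rle_trans; [apply Rabs_triang|]. rewrite Rabs_mult, (Rabs_pos_eq (exp x)) by lra.
    pose proof (Rabs_pos (cos y - 1 - - 0 * y)).
    nra. }
  set (im := exp x * sin y + 0 * cos y + - 0 + - y) in *.
  assert (Him : Rabs im <= 5 * k * c).
  { replace im with (exp x * (sin y - 0 - 1 * y) + (exp x - 1) * y) by (unfold im; ring).
    eapply Rle_trans; [apply Rabs_triang|]. rewrite !Rabs_mult, (Rabs_pos_eq (exp x)) by lra.
    pose proof (Rabs_pos (sin y - 0 - 1 * y)). pose proof (Rabs_pos y).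
    nra. }
  assert (Hc : 0 <= c) by apply Cmod_ge_0.
  match goal with |- m * ?q <= _ => set (nq := q) in * end.
  apply Rle_trans with (m * (9 * k * c)); [apply Rmult_le_compat_l; lra|].
  apply Rle_trans with ((k * (9 * m)) * c); [right; ring|].
  apply Rmult_le_compat_r; lra.
Qed.

(** * Mean values and the Cauchy formula on circles *)

Definition circ (r t : R) : C := (RtoC r * cis t)%C.

Lemma Cmod_circ (r t : R) : 0 <= r -> Cmod (circ r t) = r.
Proof.
  intros Hr. unfold circ. rewrite Cmod_mult, Cmod_cis, Cmod_R, Rabs_pos_eq; lra.
Qed.

Lemma rcont_cis (t : R) : rcont cis t.
Proof.
  apply rcont_pair; apply continuity_pt_filterlim; [apply continuity_cos|apply continuity_sin].
Qed.

Lemma rcont_circ (r t : R) : rcont (circ r) t.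
Proof. apply rcont_scal, rcont_cis. Qed.

Definition circle_int (G : C -> C) (r : R) : C := Cint (fun t => G (circ r t)) 0 (2 * PI).

Lemma two_PI_pos : 0 < 2 * PI.
Proof. pose proof PI_RGT_0. lra. Qed.

Lemma rcont_on_circle (G : C -> C) (r : R) :
  0 <= r -> (forall z, Cmod z = r -> ccont G z) ->
  forall t, rcont (fun t => G (circ r t)) t.
Proof.
  intros Hr HG t. apply (ccont_rcont G (circ r)).
  - apply rcont_circ.
  - apply HG, Cmod_circ, Hr.
Qed.

(* In the coordinate [u = ln z] the annulus is a rectangle whose horizontal sides cancel by periodicity. *)
Lemma circle_int_annulus (G : C -> C) (r1 r2 : R) : 0 < r1 -> r1 < r2 ->
  (forall z, r1 <= Cmod z <= r2 -> cdiff G z) -> circle_int G r1 = circle_int G r2.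
Proof.
  intros H1 H2 HG.
  pose proof two_PI_pos as HPI.
  assert (Hln : ln r1 < ln r2) by (apply ln_increasing; lra).
  pose proof (goursat (fun u => G (cexp u)) (ln r2 - ln r1) (2 * PI) (ln r1) 0
    ltac:(lra) ltac:(lra)) as HR.
  assert (HF : forall z : C, in_rect (ln r1) 0 (ln r2 - ln r1) (2 * PI) z ->
     cdiff (fun u => G (cexp u)) z).
  { intros z [Hz _]. apply (cdiff_comp G cexp); [eexists; apply is_cder_cexp|].
    apply HG. unfold cexp. rewrite Cmod_mult, Cmod_cis, Cmod_R, Rmult_1_r.
    rewrite Rabs_pos_eq by (left; apply exp_pos).
    rewrite <- (exp_ln r1), <- (exp_ln r2) by lra.
    replace (ln r1 + (ln r2 - ln r1)) with (ln r2) in Hz by ring.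
    assert (Hexp : forall p q, p <= q -> exp p <= exp q).
    { intros p q [Hpq| ->]; [left; apply exp_increasing; exact Hpq|right; reflexivity]. }
    split; apply Hexp; lra. }
  specialize (HR HF). unfold rect_int in HR. rewrite Rplus_0_l in HR.
  replace (ln r1 + (ln r2 - ln r1)) with (ln r2) in HR by ring.
  assert (Ec : forall r t, 0 < r -> G (cexp (ln r, t)) = G (circ r t)).
  { intros r t Hr. unfold cexp, circ; simpl. rewrite exp_ln by exact Hr. reflexivity. }
  assert (Eh : forall t, G (cexp (t, 2 * PI)%R) = G (cexp (t, 0))).
  { intros t. unfold cexp, cis; simpl. rewrite cos_2PI, sin_2PI, cos_0, sin_0. reflexivity. }
  rewrite (Cint_ext (fun t => G (cexp (t, 2 * PI)%R)) (fun t => G (cexp (t, 0)))) in HR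
    by (auto; lra).
  rewrite (Cint_ext (fun t => G (cexp (ln r1, t))) (fun t => G (circ r1 t))) in HR
    by (auto; lra).
  rewrite (Cint_ext (fun t => G (cexp (ln r2, t))) (fun t => G (circ r2 t))) in HR
    by (intros; try apply Ec; lra).
  fold (circle_int G r1) in HR. fold (circle_int G r2) in HR.
  match type of HR with (?h - ?h + Ci * (?p - ?q))%C = _ =>
    assert (E : (p - q)%C = ((- Ci) * (h - h + Ci * (p - q)))%C) end.
  { apply injective_projections; simpl; ring. }
  rewrite HR in E.
  replace (circle_int G r1) with (circle_int G r2 - (circle_int G r2 - circle_int G r1))%C by ring.
  rewrite E. ring.
Qed.

(** Continuity at the points of the circle gives a radius of control that depends on the point;
    choice makes it a gauge on the parameter interval, and compactness of that interval makes it
    uniform. *)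
Lemma circle_uniform (G : C -> C) (r0 : R) : 0 <= r0 ->
  (forall z, Cmod z = r0 -> ccont G z) ->
  forall eps, 0 < eps -> exists del, 0 < del /\ forall r t, 0 <= t <= 2 * PI ->
    Rabs (r - r0) < del -> Cmod (G (circ r t) - G (circ r0 t))%C < eps.
Proof.
  intros Hr HG e He.
  assert (Hloc : forall t, exists d : posreal, forall r s, Rabs (s - t) < d ->
    Rabs (r - r0) < d -> Cmod (G (circ r s) - G (circ r0 t))%C < e / 2).
  { intros t. destruct (HG (circ r0 t) (Cmod_circ r0 t Hr) (e / 2)) as [d [Hd H]]; [lra|].
    destruct (rcont_circ r0 t (d / 2)) as [d' [Hd' H']]; [lra|].
    assert (H2 : forall s, Rabs (s - t) < d' -> Cmod (circ r0 s - circ r0 t)%C < d / 2).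
    { intros s Hs. apply (H' (RtoC s)). rewrite <- RtoC_minus, Cmod_R. exact Hs. }
    assert (Hm : 0 < Rmin (d / 2) d') by (apply Rmin_pos; lra).
    exists (mkposreal _ Hm). simpl. intros r s Hs Hrr.
    apply H. eapply Rle_lt_trans; [apply (Cmod_triangle_via _ (circ r0 s))|].
    specialize (H2 s ltac:(eapply Rlt_le_trans; [exact Hs|apply Rmin_r])).
    replace (circ r s - circ r0 s)%C with (RtoC (r - r0) * cis s)%C
      by (unfold circ; rewrite RtoC_minus; ring).
    rewrite Cmod_mult, Cmod_cis, Cmod_R, Rmult_1_r.
    pose proof (Rmin_l (d / 2) d'). lra. }
  set (delta := fun t => proj1_sig (constructive_indefinite_description _ (Hloc t))).
  assert (Hdelta : forall t r s, Rabs (s - t) < delta t ->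
    Rabs (r - r0) < delta t -> Cmod (G (circ r s) - G (circ r0 t))%C < e / 2).
  { intros t. unfold delta. apply proj2_sig. }
  clearbody delta.
  destruct (compactness_value_1d 0 (2 * PI) delta) as [d Hd].
  exists d. split; [apply cond_pos|]. intros r t Ht Hrr.
  destruct (NNPP _ (Hd t Ht)) as [s [_ [Hs Hds]]].
  eapply Rle_lt_trans; [apply (Cmod_triangle_via _ (G (circ r0 s)))|].
  pose proof (Hdelta s r t Hs ltac:(lra)).
  pose proof (Hdelta s r0 t Hs ltac:(rewrite Rminus_diag, Rabs_R0; apply cond_pos)) as H2.
  rewrite Cmod_minus_sym in H2. lra.
Qed.

Lemma circle_int_cont (G : C -> C) (R0 r0 : R) : 0 <= r0 < R0 ->
  (forall z, Cmod z < R0 -> ccont G z) ->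
  forall eps, 0 < eps -> exists del, 0 < del /\ forall r, 0 <= r < R0 ->
    Rabs (r - r0) < del -> Cmod (circle_int G r - circle_int G r0)%C < eps.
Proof.
  intros Hr0 HG e He. pose proof two_PI_pos as HPI.
  destruct (circle_uniform G r0 (proj1 Hr0)) with (eps := e / (2 * (2 * PI)))
    as [d [Hd H]].
  { intros z Hz. apply HG; lra. }
  { apply Rdiv_lt_0_compat; lra. }
  exists d. split; [exact Hd|]. intros r Hr Hrr.
  assert (C1 : forall s, 0 <= s < R0 -> forall t, rcont (fun t => G (circ s t)) t).
  { intros s Hs. apply rcont_on_circle; [lra|]. intros z Hz. apply HG; lra. }
  unfold circle_int. rewrite <- Cint_minus by (auto; lra).
  apply Rle_lt_trans with (e / (2 * (2 * PI)) * (2 * PI - 0)).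
  - apply Cint_norm_le_const; [lra|..].
    + intros t _. apply rcont_minus; auto.
    + intros t Ht. left. apply H; auto.
  - replace (e / (2 * (2 * PI)) * (2 * PI - 0)) with (e / 2) by (field; lra). lra.
Qed.

(** Lets the radius reach an exceptional value: where Goursat's lemma stops, continuity in the
    radius carries the value of the integral to the end of the interval. *)
Lemma circle_int_endpoint (G : C -> C) (R0 r0 r1 : R) : 0 <= r0 < R0 -> 0 <= r1 < R0 ->
  r0 <> r1 -> (forall z, Cmod z < R0 -> ccont G z) ->
  (forall r, Rmin r0 r1 < r < Rmax r0 r1 -> circle_int G r = circle_int G r1) ->
  circle_int G r0 = circle_int G r1.
Proof.
  intros H0 H1 Hne HG Hc. apply Ceq_minus, Cmod_eq_0, Rle_antisym; [|apply Cmod_ge_0].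
  apply le_epsilon. intros e He. rewrite Rplus_0_l.
  destruct (circle_int_cont G R0 r0 H0 HG e He) as [d [Hd H]].
  assert (Habs : 0 < Rabs (r1 - r0)) by (apply Rabs_pos_lt; lra).
  destruct (small_factor d (Rabs (r1 - r0) + 1)) as [k [Hk0 [Hk1 Hk2]]]; [lra..|].
  set (s := k / 2). assert (Hs0 : 0 < s <= 1 / 2) by (unfold s; lra).
  assert (Hs2 : s * (2 * (Rabs (r1 - r0) + 1)) <= d) by (unfold s; lra). clearbody s.
  set (r := r0 + s * (r1 - r0)).
  assert (Hr : Rmin r0 r1 < r < Rmax r0 r1).
  { unfold r, Rmin, Rmax. destruct (Rle_dec r0 r1); split; nra. }
  rewrite <- (Hc r Hr), Cmod_minus_sym. left. apply H.
  - unfold r; split; nra.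
  - replace (r - r0) with (s * (r1 - r0)) by (unfold r; ring).
    rewrite Rabs_mult, (Rabs_pos_eq s) by lra. nra.
Qed.

Lemma circle_int_0 (G : C -> C) : circle_int G 0 = (RtoC (2 * PI) * G 0)%C.
Proof.
  unfold circle_int. rewrite (Cint_ext _ (fun _ => G 0%C)).
  - rewrite Cint_const, Rminus_0_r. reflexivity.
  - left; apply two_PI_pos.
  - intros t _. f_equal. unfold circ. ring.
Qed.

(* The exceptional points [0] and [p] only affect two radii, across which [circle_int G] is continuous. *)
Lemma mean_value (G : C -> C) (p : C) (R0 r : R) : 0 <= r < R0 ->
  (forall z, Cmod z < R0 -> ccont G z) ->
  (forall z, Cmod z < R0 -> z <> 0%C -> z <> p -> cdiff G z) ->
  circle_int G r = (RtoC (2 * PI) * G 0)%C.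
Proof.
  intros Hr HG HD. rewrite <- circle_int_0.
  assert (Hann : forall r1 r2, 0 < r1 -> 0 < r2 -> r1 < R0 -> r2 < R0 ->
     (Rmax r1 r2 < Cmod p \/ Cmod p < Rmin r1 r2) -> circle_int G r1 = circle_int G r2).
  { assert (Haux : forall r1 r2, 0 < r1 -> r1 < r2 -> r2 < R0 -> (r2 < Cmod p \/ Cmod p < r1) ->
      circle_int G r1 = circle_int G r2).
    { intros r1 r2 H1 H2 H3 H4. apply circle_int_annulus; auto. intros z Hz. apply HD; [lra|..].
      - intros ->. rewrite Cmod_0 in Hz. lra.
      - intros ->. lra. }
    intros r1 r2 H1 H2 H3 H4 H5.
    destruct (Rtotal_order r1 r2) as [H|[->|H]]; [|reflexivity|symmetry];
      apply Haux; auto; unfold Rmin, Rmax in H5;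
      destruct (Rle_dec r1 r2); lra. }
  assert (Hend : forall r0 r1, 0 <= r0 < R0 -> 0 <= r1 < R0 -> r0 <> r1 ->
     (forall s, Rmin r0 r1 < s < Rmax r0 r1 -> circle_int G s = circle_int G r1) ->
     circle_int G r0 = circle_int G r1).
  { intros r0 r1 H0 H1 Hne. apply (circle_int_endpoint G R0); auto. }
  pose proof (Cmod_ge_0 p) as Hp.
  destruct (Req_dec r 0) as [->|Hr0]; [reflexivity|].
  assert (Hin : forall s, 0 < s < Cmod p \/ (Cmod p = 0 /\ 0 < s) -> s < R0 ->
     circle_int G 0 = circle_int G s).
  { intros s Hs Hs1. apply Hend; try lra. rewrite Rmin_left, Rmax_right by lra.
    intros q Hq. apply Hann; try lra.
    rewrite Rmin_left, Rmax_right by lra. lra. }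
  assert (Hat : Cmod p < R0 -> circle_int G (Cmod p) = circle_int G 0).
  { intros HpR. destruct (Req_dec (Cmod p) 0) as [E|E]; [rewrite E; reflexivity|].
    apply Hend; try lra. rewrite Rmin_right, Rmax_left by lra.
    intros s Hs. symmetry. apply Hin; lra. }
  destruct (Rtotal_order r (Cmod p)) as [H|[->|H]].
  - symmetry. apply Hin; lra.
  - apply Hat; lra.
  - rewrite <- Hat by lra. symmetry. apply Hend; try lra.
    rewrite Rmin_left, Rmax_right by lra. intros s Hs. apply Hann; try lra.
    rewrite Rmin_left by lra. lra.
Qed.

(** On a circle around 0 one has [dz = i z dt]; the numerator [z] turns the usual contour integral
    of [F z / (z - a)] into an integral over the angle. *)
Definition cauchy_kernel (a z : C) : C := (z / (z - a))%C.

Lemma kernel_cdiff (a z : C) : z <> a -> cdiff (cauchy_kernel a) z.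
Proof.
  intros H. apply cdiff_div; [apply cdiff_id| |apply Cminus_eq_contra, H].
  apply cdiff_minus; [apply cdiff_id|apply cdiff_const].
Qed.

(* The integral does not depend on [r > |a|], and the kernel tends to [1] at infinity. *)
Lemma circle_int_kernel (a : C) (r : R) : Cmod a < r ->
  circle_int (cauchy_kernel a) r = RtoC (2 * PI).
Proof.
  intros Ha. pose proof (Cmod_ge_0 a) as Ha0. pose proof two_PI_pos as HPI.
  apply Ceq_minus, Cmod_eq_0, Rle_antisym; [|apply Cmod_ge_0].
  apply le_epsilon. intros e He. rewrite Rplus_0_l.
  set (A := Cmod a) in *. set (q := 2 * PI * A / e).
  assert (Hq : 0 <= q) by (apply Rle_mult_inv_pos; nra).
  assert (HR : r < r + A + q + 1) by lra. set (R0 := r + A + q + 1) in *.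
  assert (Hne : forall z, r <= Cmod z -> z <> a) by (intros z Hz ->; unfold A in Ha; lra).
  rewrite (circle_int_annulus _ r R0) by (try (intros; apply kernel_cdiff, Hne); lra).
  assert (HK : forall t, rcont (fun t => cauchy_kernel a (circ R0 t)) t).
  { apply rcont_on_circle; [lra|]. intros z Hz. apply cdiff_ccont, kernel_cdiff, Hne. lra. }
  replace (RtoC (2 * PI)) with (Cint (fun _ => RtoC 1) 0 (2 * PI))
    by (rewrite Cint_const, Rminus_0_r; ring).
  unfold circle_int. rewrite <- Cint_minus by (auto using rcont_const; lra).
  apply Rle_trans with (A / (R0 - A) * (2 * PI - 0)).
  - apply Cint_norm_le_const; [lra|..].
    + intros t _. apply rcont_minus; auto using rcont_const.
    + intros t _. pose proof (Cmod_circ R0 t ltac:(lra)) as Hz. set (z := circ R0 t) in *.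
      pose proof (Cmod_triangle_rev z a) as T. fold A in T.
      assert (Nz : (z - a)%C <> 0%C) by (apply Cminus_eq_contra, Hne; lra).
      replace (cauchy_kernel a z - 1)%C with (a / (z - a))%C by (unfold cauchy_kernel; field; exact Nz).
      rewrite Cmod_div by exact Nz. fold A.
      apply Rmult_le_compat_l; [exact Ha0|apply Rinv_le_contravar; lra].
  - rewrite Rminus_0_r. replace (A / (R0 - A) * (2 * PI)) with (2 * PI * A / (R0 - A)) by (unfold R0; field; lra).
    apply div_le; [lra|]. replace (2 * PI * A) with (e * q) by (unfold q; field; lra).
    apply Rmult_le_compat_l; unfold R0; lra.
Qed.

(* [F] may fail to be differentiable at the centre, as for [psi z / z] below. *)
Lemma cauchy_formula (F : C -> C) (a : C) (R0 r : R) : Cmod a < r -> r < R0 ->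
  (forall z, Cmod z < R0 -> ccont F z) ->
  (forall z, Cmod z < R0 -> z <> 0%C -> cdiff F z) ->
  circle_int (fun z => cauchy_kernel a z * F z)%C r = (RtoC (2 * PI) * F a)%C.
Proof.
  intros Ha Hr HF HD. pose proof (Cmod_ge_0 a) as Ha0. pose proof two_PI_pos.
  (* At the centre [F] may lack a derivative, but there the kernel is identically 1 on the circle
     and the claim is the mean value property of [F]. *)
  destruct (Ceq_dec a 0) as [->|Hne].
  - rewrite <- (mean_value F 0 R0 r); auto; [|lra].
    unfold circle_int. apply Cint_ext; [lra|]. intros t _. unfold cauchy_kernel.
    assert (Hz : circ r t <> 0%C) by (apply Cmod_gt_0; rewrite Cmod_circ; lra).
    field. intros E. apply Hz. rewrite <- E. ring.
  - destruct (HD a ltac:(lra) Hne) as [l [h [Hl [Hh He]]]].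
    (* Away from [a] this is the kernel times [F z - F a], and it stays continuous at [a]. Its value
       at 0 is 0, so its integral vanishes, and only the integral of the kernel times the constant
       [F a] remains. *)
    set (G := fun z : C => (z * h z)%C).
    assert (HGe : forall z, z <> a -> G z = (cauchy_kernel a z * (F z - F a))%C).
    { intros z Hz. unfold G, cauchy_kernel. rewrite He. field.
      apply Cminus_eq_contra, Hz. }
    assert (Hloc : forall z, z <> a -> exists d, 0 < d /\ forall w, Cmod (w - z)%C < d ->
      (cauchy_kernel a w * (F w - F a))%C = G w).
    { intros z Hz. exists (Cmod (z - a)%C). split.
      - apply Cmod_gt_0, Cminus_eq_contra, Hz.
      - intros w Hw. symmetry. apply HGe. intros ->.
        rewrite Cmod_minus_sym in Hw. lra. }
    assert (HGc : forall z, Cmod z < R0 -> ccont G z).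
    { intros z Hz. destruct (Ceq_dec z a) as [->|Hza].
      - apply ccont_mult; [apply ccont_id|exact Hh].
      - destruct (Hloc z Hza) as [d [Hd Hw]].
        apply (ccont_ext_loc _ _ z d Hd Hw).
        apply ccont_mult; [apply cdiff_ccont, kernel_cdiff, Hza|].
        apply ccont_minus; [auto|apply ccont_const]. }
    assert (HGd : forall z, Cmod z < R0 -> z <> 0%C -> z <> a -> cdiff G z).
    { intros z Hz Hz0 Hza. destruct (Hloc z Hza) as [d [Hd Hw]].
      apply (cdiff_ext_loc _ _ z d Hd Hw).
      apply cdiff_mult; [apply kernel_cdiff, Hza|].
      apply cdiff_minus; [auto|apply cdiff_const]. }
    pose proof (mean_value G a R0 r ltac:(lra) HGc HGd) as MV.
    assert (Hza : forall t, circ r t <> a).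
    { intros t E. pose proof (Cmod_circ r t ltac:(lra)) as E2. rewrite E in E2. lra. }
    assert (HK : forall t, rcont (fun t => cauchy_kernel a (circ r t)) t).
    { apply rcont_on_circle; [lra|]. intros z Hz. apply cdiff_ccont, kernel_cdiff.
      intros ->. lra. }
    assert (E : circle_int G r = (circle_int (fun z => cauchy_kernel a z * F z)%C r
        - F a * circle_int (cauchy_kernel a) r)%C).
    { unfold circle_int. rewrite <- Cint_scal, <- Cint_minus; try lra; auto.
      - apply Cint_ext; [lra|]. intros t _. rewrite HGe by apply Hza. ring.
      - intros t _. apply (rcont_on_circle (fun z => cauchy_kernel a z * F z)%C r); [lra|].
        intros z Hz. apply ccont_mult; [|apply HF; lra].
        apply cdiff_ccont, kernel_cdiff. intros ->. lra.
      - intros t _. apply rcont_scal, HK. }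
    rewrite MV, circle_int_kernel in E by exact Ha. unfold G in E at 1.
    replace (circle_int (fun z => cauchy_kernel a z * F z)%C r)
      with ((circle_int (fun z => cauchy_kernel a z * F z)%C r - F a * RtoC (2 * PI))
            + F a * RtoC (2 * PI))%C by ring.
    rewrite <- E. ring.
Qed.

(** * The Schwarz lemma and its rigidity *)

Lemma pow_bounded_le_1 (x B : R) : 0 <= x -> (forall n : nat, x ^ n <= B) -> x <= 1.
Proof.
  intros Hx H. apply Rnot_lt_le. intros H1.
  destruct (archimed_cor1 ((x - 1) / (Rabs B + 1))) as [N [HN HN0]].
  { apply Rdiv_lt_0_compat; [lra|]. pose proof (Rabs_pos B). lra. }
  assert (HNp : 0 < INR N) by (apply lt_0_INR; exact HN0).
  pose proof (poly N (x - 1) ltac:(lra)) as Hp.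
  replace (1 + (x - 1)) with x in Hp by ring. specialize (H N).
  pose proof (Rle_abs B). pose proof (Rabs_pos B).
  apply Rmult_lt_compat_r with (r := INR N * (Rabs B + 1)) in HN; [|nra].
  replace (/ INR N * (INR N * (Rabs B + 1))) with (Rabs B + 1) in HN by (field; lra).
  replace ((x - 1) / (Rabs B + 1) * (INR N * (Rabs B + 1))) with (INR N * (x - 1)) in HN
    by (field; lra).
  lra.
Qed.

Lemma Cmod_kernel_le (a z : C) (r : R) : Cmod a < r -> Cmod z = r ->
  Cmod (cauchy_kernel a z) <= r / (r - Cmod a).
Proof.
  intros Ha Hz. pose proof (Cmod_ge_0 a). pose proof (Cmod_triangle_rev z a) as T.
  unfold cauchy_kernel. rewrite Cmod_div by (intros E; rewrite E, Cmod_0 in T; lra).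
  rewrite Hz in *. apply Rmult_le_compat_l; [lra|apply Rinv_le_contravar; lra].
Qed.

Lemma quotient_cdiff (psi h : C -> C) (z : C) : z <> 0%C -> cdiff psi z ->
  (forall w, psi w = h w * w)%C -> cdiff h z.
Proof.
  intros Hz Hd He. assert (Hm : 0 < Cmod z) by (apply Cmod_gt_0, Hz).
  apply (cdiff_ext_loc (fun w => psi w / w)%C h z (Cmod z) Hm).
  - intros w Hw. rewrite He. field. intros ->.
    replace (0 - z)%C with (- z)%C in Hw by ring. rewrite Cmod_opp in Hw. lra.
  - apply cdiff_div; [exact Hd|apply cdiff_id|exact Hz].
Qed.

Definition disc_map (psi : C -> C) : Prop :=
  forall z, Cmod z < 1 -> cdiff psi z /\ Cmod (psi z) < 1.

Section Schwarz.

Variables (psi h : C -> C).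
Hypothesis psi_disc : disc_map psi.
Hypothesis h_cont : ccont h 0.
Hypothesis h_eq : forall w, (psi w = h w * w)%C.

Lemma h_cdiff (z : C) : Cmod z < 1 -> z <> 0%C -> cdiff h z.
Proof. intros Hz H0. apply (quotient_cdiff psi h z H0); [apply psi_disc, Hz|exact h_eq]. Qed.

Lemma h_ccont (z : C) : Cmod z < 1 -> ccont h z.
Proof.
  intros Hz. destruct (Ceq_dec z 0) as [->|H0]; [exact h_cont|].
  apply cdiff_ccont, h_cdiff; assumption.
Qed.

(* The Cauchy formula for the powers [h ^ n] loses a constant factor independent of [n]. *)
Lemma schwarz (a : C) : Cmod a < 1 -> Cmod (h a) <= 1.
Proof.
  intros Ha. pose proof (Cmod_ge_0 a) as Ha0. pose proof two_PI_pos as HPI.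
  assert (Hr : forall r, Cmod a < r < 1 -> r * Cmod (h a) <= 1).
  { intros r Hr. apply (pow_bounded_le_1 _ (r / (r - Cmod a))).
    { apply Rmult_le_pos; [lra|apply Cmod_ge_0]. }
    intros n.
    assert (Hrn : 0 < r ^ n) by (apply pow_lt; lra).
    pose proof (cauchy_formula (fun z => h z ^ n)%C a 1 r ltac:(lra) ltac:(lra)
      (fun z Hz => ccont_pow h n z (h_ccont z Hz))
      (fun z Hz H0 => cdiff_pow h n z (h_cdiff z Hz H0))) as CF.
    apply (f_equal Cmod) in CF.
    rewrite Cmod_mult, Cmod_R, Rabs_pos_eq, Cmod_pow in CF by lra.
    assert (HB : Cmod (circle_int (fun z => cauchy_kernel a z * h z ^ n)%C r)
      <= (r / (r - Cmod a) * / r ^ n) * (2 * PI - 0)).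
    { apply Cint_norm_le_const; [lra|..].
      - intros t _. apply (rcont_on_circle (fun z => cauchy_kernel a z * h z ^ n)%C r); [lra|].
        intros z Hz. apply ccont_mult.
        + apply cdiff_ccont, kernel_cdiff. intros ->. lra.
        + apply ccont_pow, h_ccont. lra.
      - intros t _. pose proof (Cmod_circ r t ltac:(lra)) as Hz. set (z := circ r t) in *.
        rewrite Cmod_mult, Cmod_pow.
        apply Rmult_le_compat; [apply Cmod_ge_0|apply pow_le, Cmod_ge_0| |].
        + apply Cmod_kernel_le; lra.
        + rewrite <- pow_inv. apply pow_incr. split; [apply Cmod_ge_0|].
          pose proof (proj2 (psi_disc z ltac:(lra))) as Hp.
          rewrite h_eq, Cmod_mult, Hz in Hp.
          apply Rmult_le_reg_r with r; [lra|]. rewrite Rinv_l by lra. lra. }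
    rewrite CF in HB. rewrite Rpow_mult_distr.
    apply Rmult_le_reg_r with (2 * PI / r ^ n).
    { apply Rdiv_lt_0_compat; lra. }
    apply Rle_trans with (2 * PI * Cmod (h a) ^ n).
    - right. field. lra.
    - apply Rle_trans with (1 := HB). right. field. split; lra. }
  apply Rnot_lt_le. intros H1. set (m := Cmod (h a)) in *.
  assert (Hm : / m < 1) by (rewrite <- Rinv_1; apply Rinv_lt_contravar; lra).
  destruct (common_pos (1 - Cmod a) (1 - / m)) as [d [Hd [L1 L2]]]; [lra..|].
  specialize (Hr (1 - d / 2) ltac:(lra)).
  apply Rmult_le_compat_r with (r := m) in L2; [|lra].
  rewrite Rmult_minus_distr_r, Rinv_l in L2 by lra. nra.
Qed.

(* With [psi'(0) = d], the mean of [|psi z - z|^2] over [|z| = r] is at most [1 + r^2 - 2 r^2 d]; the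
   kernel differences turn this into a Lipschitz bound, AM-GM replacing the Cauchy-Schwarz inequality. *)
Lemma schwarz_rigidity (d k : R) (z w : C) : h 0%C = RtoC d -> 0 <= d <= 1 -> 0 < k ->
  2 * (1 - d) < k * k -> Cmod z < 1 -> Cmod w < 1 ->
  Cmod ((psi z - z) - (psi w - w))%C <= 4 * k * Cmod (z - w)%C / ((1 - Cmod z) * (1 - Cmod w)).
Proof.
  intros Hd Hd01 Hk Hkd Hz Hw. pose proof two_PI_pos as HPI.
  pose proof (Cmod_ge_0 z) as Hz0.
  (* The first two entries keep [z] and [w] far enough inside the circle for the kernel bound [A].
     The last one spends the slack [k * k - 2 * (1 - d)]: the mean square
     [1 + r * r - 2 * (r * r) * d] is at most [2 * (1 - r) + 2 * (1 - d)]. *)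
  set (r := Rmax (Rmax ((1 + Cmod z) / 2) ((1 + Cmod w) / 2)) (1 - (k * k - 2 * (1 - d)) / 2)).
  assert (R1 : (1 + Cmod z) / 2 <= r).
  { eapply Rle_trans; [apply Rmax_l|]. apply Rmax_l. }
  assert (R2 : (1 + Cmod w) / 2 <= r).
  { eapply Rle_trans; [apply Rmax_r|]. apply Rmax_l. }
  assert (R3 : 1 - (k * k - 2 * (1 - d)) / 2 <= r) by apply Rmax_r.
  assert (R4 : r < 1) by (unfold r; repeat apply Rmax_lub_lt; lra).
  clearbody r.
  set (f := fun v : C => (psi v - v)%C).
  assert (Hf : forall v, Cmod v < 1 -> cdiff f v).
  { intros v Hv. apply cdiff_minus; [apply psi_disc, Hv|apply cdiff_id]. }
  assert (CF : forall a, Cmod a < r ->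
     circle_int (fun v => cauchy_kernel a v * f v)%C r = (RtoC (2 * PI) * f a)%C).
  { intros a Ha. apply (cauchy_formula f a 1 r); auto; try lra.
    intros v Hv. apply cdiff_ccont; auto. }
  pose proof (CF z ltac:(lra)) as Cz. pose proof (CF w ltac:(lra)) as Cw.
  assert (HKc : forall a t, Cmod a < r -> rcont (fun t => cauchy_kernel a (circ r t) * f (circ r t))%C t).
  { intros a t Ha. apply (rcont_on_circle (fun v => cauchy_kernel a v * f v)%C r);
      [pose proof (Cmod_ge_0 a); lra|].
    intros v Hv. apply ccont_mult.
    - apply cdiff_ccont, kernel_cdiff. intros ->. lra.
    - apply cdiff_ccont, Hf; lra. }
  assert (Ediff : Cint (fun t => cauchy_kernel z (circ r t) * f (circ r t)
       - cauchy_kernel w (circ r t) * f (circ r t))%C 0 (2 * PI)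
     = (RtoC (2 * PI) * (f z - f w))%C).
  { rewrite Cint_minus; try lra.
    - fold (circle_int (fun v => cauchy_kernel z v * f v)%C r).
      fold (circle_int (fun v => cauchy_kernel w v * f v)%C r).
      rewrite Cz, Cw. ring.
    - intros t _. apply HKc; lra.
    - intros t _. apply HKc; lra. }
  apply (f_equal Cmod) in Ediff.
  rewrite Cmod_mult, Cmod_R, (Rabs_pos_eq (2 * PI)) in Ediff by lra.
  set (A := 4 * Cmod (z - w)%C / ((1 - Cmod z) * (1 - Cmod w))).
  assert (HA : 0 <= A).
  { apply Rle_mult_inv_pos; [pose proof (Cmod_ge_0 (z - w)%C); lra|nra]. }
  set (e := 1 + r * r).
  (* This is [A * (k / 2 + m ^ 2 / (2 * k))] with [m ^ 2], the square of [Cmod (psi v - v)],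
     replaced by its bound [e - 2 * (r * r) * Re (h v)]. It is affine in [Re h], so the mean value
     of [h] alone determines its integral. *)
  set (g := fun t => A * (k / 2 + e / (2 * k)) + - (A * (r * r / k)) * Re (h (circ r t))).
  assert (Hhc : forall t, rcont (fun t => h (circ r t)) t).
  { apply rcont_on_circle; [lra|]. intros v Hv. apply h_ccont. lra. }
  assert (Hre : ex_RInt (fun t => Re (h (circ r t))) 0 (2 * PI)).
  { apply (ex_RInt_Re (fun t => h (circ r t))); [lra|auto]. }
  assert (Hg : ex_RInt g 0 (2 * PI)).
  { apply (ex_RInt_plus_R (fun _ => A * (k / 2 + e / (2 * k)))); [apply ex_RInt_const|].
    apply ex_RInt_scal_R, Hre. }
  assert (Ig : RInt g 0 (2 * PI) = 2 * PI * (A * (k / 2 + (e - 2 * (r * r) * d) / (2 * k)))).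
  { unfold g. rewrite (RInt_plus_R (fun _ => A * (k / 2 + e / (2 * k))));
      [|apply ex_RInt_const|apply ex_RInt_scal_R, Hre].
    rewrite RInt_const, RInt_scal_R by exact Hre.
    pose proof (mean_value h 0 1 r ltac:(lra) h_ccont (fun v Hv H0 _ => h_cdiff v Hv H0)) as MV.
    rewrite Hd in MV. apply (f_equal Re) in MV.
    change (Re (circle_int h r)) with (RInt (fun t => Re (h (circ r t))) 0 (2 * PI)) in MV.
    rewrite MV. unfold scal; simpl; unfold mult; simpl. field. lra. }
  assert (HB : Cmod (Cint (fun t => cauchy_kernel z (circ r t) * f (circ r t)
       - cauchy_kernel w (circ r t) * f (circ r t))%C 0 (2 * PI)) <= RInt g 0 (2 * PI)).
  { apply Cint_norm_le; [lra| |exact Hg|].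
    - intros t _.
      apply (rcont_on_circle (fun v => cauchy_kernel z v * f v - cauchy_kernel w v * f v)%C r); [lra|].
      intros v Hv. apply ccont_minus; (apply ccont_mult;
        [apply cdiff_ccont, kernel_cdiff; intros ->; lra|apply cdiff_ccont, Hf; lra]).
    - intros t _. pose proof (Cmod_circ r t ltac:(lra)) as Hv. unfold g. set (v := circ r t) in *.
      assert (Nz : (v - z)%C <> 0%C).
      { intros E. pose proof (Cmod_triangle_rev v z) as T. rewrite E, Cmod_0 in T. lra. }
      assert (Nw : (v - w)%C <> 0%C).
      { intros E. pose proof (Cmod_triangle_rev v w) as T. rewrite E, Cmod_0 in T. lra. }
      replace (cauchy_kernel z v * f v - cauchy_kernel w v * f v)%C
        with ((v * (z - w)) / ((v - z) * (v - w)) * f v)%C by (unfold cauchy_kernel; field; auto).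
      rewrite Cmod_mult, Cmod_div, !Cmod_mult, Hv by (apply Cmult_neq_0; auto).
      assert (HK : r * Cmod (z - w)%C / (Cmod (v - z)%C * Cmod (v - w)%C) <= A).
      { pose proof (Cmod_triangle_rev v z) as T1. pose proof (Cmod_triangle_rev v w) as T2.
        rewrite Hv in T1, T2. pose proof (Cmod_ge_0 (z - w)%C) as Hzw. unfold A.
        apply Rle_trans with (Cmod (z - w)%C / ((1 - Cmod z) / 2 * ((1 - Cmod w) / 2))).
        - apply Rmult_le_compat.
          + nra.
          + left. apply Rinv_0_lt_compat. nra.
          + nra.
          + apply Rinv_le_contravar; [nra|]. apply Rmult_le_compat; lra.
        - right. field. lra. }
      set (m := Cmod (f v)).
      assert (Hm : 0 <= m) by apply Cmod_ge_0.
      apply Rle_trans with (A * m); [apply Rmult_le_compat_r; auto|].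
      (* Expanding the square, the cross term is [Re (psi v * Cconj v)], which equals
         [r * r * Re (h v)] on the circle. *)
      assert (Hm2 : m * m <= e - 2 * (r * r) * Re (h v)).
      { assert (E1 : RtoC (m * m) = RtoC (Cmod (psi v) ^ 2 + r * r - 2 * (r * r) * Re (h v))).
        { replace (m * m) with (Cmod (f v) ^ 2) by (unfold m; ring).
          assert (E2 : (v * Cconj v)%C = RtoC (r * r)).
          { rewrite <- Cmod2_conj, Hv. f_equal. ring. }
          rewrite !RtoC_minus, RtoC_plus, !RtoC_mult.
          rewrite !Cmod2_conj. rewrite re_alt. unfold f.
          rewrite Cminus_conj, h_eq, Cmult_conj. rewrite <- RtoC_mult, <- E2.
          field. }
        apply RtoC_inj in E1. rewrite E1. unfold e.
        pose proof (proj2 (psi_disc v ltac:(lra))). pose proof (Cmod_ge_0 (psi v)). nra. }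
      assert (Ham : m <= k / 2 + (m * m) / (2 * k)).
      { apply Rmult_le_reg_r with (2 * k); [lra|].
        replace ((k / 2 + m * m / (2 * k)) * (2 * k)) with (k * k + m * m) by (field; lra).
        pose proof (Rle_0_sqr (k - m)) as Hs. unfold Rsqr in Hs. lra. }
      replace (A * (k / 2 + e / (2 * k)) + - (A * (r * r / k)) * Re (h v))
        with (A * (k / 2 + (e - 2 * (r * r) * Re (h v)) / (2 * k))) by (field; lra).
      apply Rmult_le_compat_l; [exact HA|]. apply Rle_trans with (1 := Ham).
      apply Rplus_le_compat_l. apply Rmult_le_compat_r; [|exact Hm2].
      left. apply Rinv_0_lt_compat. lra. }
  rewrite Ediff, Ig in HB. apply Rmult_le_reg_l in HB; [|lra].
  apply Rle_trans with (1 := HB).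
  replace (4 * k * Cmod (z - w)%C / ((1 - Cmod z) * (1 - Cmod w))) with (A * k)
    by (unfold A; field; lra).
  apply Rmult_le_compat_l; [exact HA|].
  assert (He : e - 2 * (r * r) * d <= k * k).
  { assert (H1 : 0 <= (1 - r * r) * (1 - d)) by (apply Rmult_le_pos; nra). unfold e. nra. }
  apply Rmult_le_reg_r with (2 * k); [lra|].
  replace ((k / 2 + (e - 2 * (r * r) * d) / (2 * k)) * (2 * k)) with (k * k + (e - 2 * (r * r) * d))
    by (field; lra).
  lra.
Qed.

End Schwarz.

(** * Automorphisms of the disc and hyperbolic distortion *)

(** The automorphism taking [p] to 0, with inverse [mob (- p)]. The distance [pseudo_hyp_dist z w]
    is convertible with [Cmod (mob w z)], which the proofs use silently. *)
Definition mob (p w : C) : C := ((w - p) / (1 - Cconj p * w))%C.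

Lemma mob_den (p w : C) : Cmod p < 1 -> Cmod w <= 1 -> (1 - Cconj p * w)%C <> 0%C.
Proof.
  intros Hp Hw E. apply (f_equal Cmod) in E. rewrite Cmod_0 in E.
  pose proof (Cmod_triangle_rev 1 (Cconj p * w)) as T.
  rewrite E, Cmod_1, Cmod_mult, Cmod_conj in T.
  pose proof (Cmod_ge_0 p). nra.
Qed.

Lemma mob_den_ge (p w : C) : 1 - Cmod p * Cmod w <= Cmod (1 - Cconj p * w)%C.
Proof.
  pose proof (Cmod_triangle_rev 1 (Cconj p * w)) as T.
  rewrite Cmod_1, Cmod_mult, Cmod_conj in T. exact T.
Qed.

Lemma mob_identity (p w : C) :
  Cmod (1 - Cconj p * w)%C ^ 2 - Cmod (w - p)%C ^ 2 = (1 - Cmod p ^ 2) * (1 - Cmod w ^ 2).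
Proof. rewrite !Cmod2_alt. destruct p as [a b], w as [x y]. simpl. ring. Qed.

Lemma mob_defect (p w : C) : Cmod p < 1 -> Cmod w <= 1 ->
  1 - Cmod (mob p w) ^ 2 = (1 - Cmod p ^ 2) * (1 - Cmod w ^ 2) / Cmod (1 - Cconj p * w)%C ^ 2.
Proof.
  intros Hp Hw. pose proof (mob_den p w Hp Hw) as H0.
  pose proof (proj1 (Cmod_gt_0 _) H0) as Hm. unfold mob.
  rewrite Cmod_div by exact H0. rewrite <- mob_identity. field. lra.
Qed.

Lemma mob_lt_1 (p w : C) : Cmod p < 1 -> Cmod w < 1 -> Cmod (mob p w) < 1.
Proof.
  intros Hp Hw. pose proof (mob_defect p w Hp ltac:(lra)) as H.
  pose proof (proj1 (Cmod_gt_0 _) (mob_den p w Hp ltac:(lra))) as Hm.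
  pose proof (Cmod_ge_0 p). pose proof (Cmod_ge_0 w).
  assert (0 < (1 - Cmod p ^ 2) * (1 - Cmod w ^ 2) / Cmod (1 - Cconj p * w)%C ^ 2).
  { apply Rdiv_lt_0_compat; [apply Rmult_lt_0_compat; nra|apply pow_lt, Hm]. }
  nra.
Qed.

Lemma mob_circle (p w : C) : Cmod p < 1 -> Cmod w = 1 -> Cmod (mob p w) = 1.
Proof.
  intros Hp Hw. pose proof (mob_defect p w Hp ltac:(lra)) as H.
  rewrite Hw in H. replace (1 - 1 ^ 2) with 0 in H by ring.
  unfold Rdiv in H. rewrite Rmult_0_r, Rmult_0_l in H.
  pose proof (Cmod_ge_0 (mob p w)). nra.
Qed.

Lemma mob_le_1 (p w : C) : Cmod p < 1 -> Cmod w <= 1 -> Cmod (mob p w) <= 1.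
Proof.
  intros Hp [Hw|Hw]; [left; apply mob_lt_1|right; apply mob_circle]; assumption.
Qed.

Lemma Cmod_1_conj (u : C) : Cmod u = 1 -> (u * Cconj u)%C = 1%C.
Proof. intros H. rewrite <- Cmod2_conj, H. f_equal. ring. Qed.

Lemma Cmod_lt_1_conj (p : C) : Cmod p < 1 -> (1 - p * Cconj p)%C <> 0%C.
Proof.
  intros H. replace (p * Cconj p)%C with (Cconj p * p)%C by ring.
  apply mob_den; lra.
Qed.

Lemma mob_mob (p w : C) : Cmod p < 1 -> Cmod w <= 1 -> mob (- p) (mob p w) = w.
Proof.
  intros Hp Hw. pose proof (mob_den p w Hp Hw) as H0. pose proof (Cmod_lt_1_conj p Hp) as H1.
  unfold mob. rewrite Copp_conj.
  assert (E : (1 - - Cconj p * ((w - p) / (1 - Cconj p * w)))%C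
     = ((1 - p * Cconj p) / (1 - Cconj p * w))%C) by (field; exact H0).
  rewrite E. field. split; assumption.
Qed.

Lemma mob_opp_mob (p w : C) : Cmod p < 1 -> Cmod w <= 1 -> mob p (mob (- p) w) = w.
Proof.
  intros Hp Hw. rewrite <- (mob_mob (- p) w) at 2 by (rewrite ?Cmod_opp; assumption).
  f_equal. ring.
Qed.

Lemma mob_self (p : C) : mob p p = 0%C.
Proof. unfold mob, Cdiv. ring. Qed.

Lemma mob_0 (p : C) : mob p 0 = (- p)%C.
Proof. unfold mob. replace (1 - Cconj p * 0)%C with (RtoC 1) by ring. field. Qed.

Lemma mob_diff (p z w : C) : Cmod p < 1 -> Cmod z <= 1 -> Cmod w <= 1 ->
  (mob p z - mob p w)%C = ((1 - p * Cconj p) * (z - w) / ((1 - Cconj p * z) * (1 - Cconj p * w)))%C.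
Proof. intros Hp Hz Hw. unfold mob. field. split; apply mob_den; assumption. Qed.

Lemma mob_conj_diff (p z w : C) : Cmod p < 1 -> Cmod z <= 1 -> Cmod w <= 1 ->
  (1 - Cconj (mob p w) * mob p z)%C
  = ((1 - p * Cconj p) * (1 - Cconj w * z) / ((1 - Cconj p * z) * Cconj (1 - Cconj p * w)))%C.
Proof.
  intros Hp Hz Hw. unfold mob.
  pose proof (mob_den p z Hp Hz) as H1. pose proof (mob_den p w Hp Hw) as H2.
  rewrite Cdiv_conj by exact H2.
  assert (H3 : Cconj (1 - Cconj p * w) <> 0%C).
  { apply Cmod_gt_0. rewrite Cmod_conj. apply Cmod_gt_0, H2. }
  assert (E : Cconj (1 - Cconj p * w) = (1 - p * Cconj w)%C)
    by (apply injective_projections; simpl; ring).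
  rewrite E in H3 |- *. rewrite Cminus_conj.
  field. split; assumption.
Qed.

Lemma pseudo_lt_1 (z w : C) : Cmod z < 1 -> Cmod w < 1 -> pseudo_hyp_dist z w < 1.
Proof. intros Hz Hw. exact (mob_lt_1 w z Hw Hz). Qed.

Lemma pseudo_ge_0 (z w : C) : 0 <= pseudo_hyp_dist z w.
Proof. apply Cmod_ge_0. Qed.

Lemma pseudo_mob (p z w : C) : Cmod p < 1 -> Cmod z < 1 -> Cmod w < 1 ->
  pseudo_hyp_dist (mob p z) (mob p w) = pseudo_hyp_dist z w.
Proof.
  intros Hp Hz Hw. unfold pseudo_hyp_dist.
  pose proof (mob_lt_1 p z Hp Hz). pose proof (mob_lt_1 p w Hp Hw).
  pose proof (mob_den p z Hp ltac:(lra)) as H1. pose proof (mob_den p w Hp ltac:(lra)) as H2.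
  pose proof (Cmod_lt_1_conj p Hp) as H3.
  rewrite !Cmod_div by (apply mob_den; lra).
  rewrite mob_diff, mob_conj_diff by lra.
  assert (H4 : Cconj (1 - Cconj p * w) <> 0%C).
  { apply Cmod_gt_0. rewrite Cmod_conj. apply Cmod_gt_0, H2. }
  rewrite !Cmod_div, !Cmod_mult, Cmod_conj by (apply Cmult_neq_0; assumption).
  pose proof (mob_den w z Hw ltac:(lra)) as H5.
  apply Cmod_gt_0 in H1, H2, H3, H5. field. lra.
Qed.

Lemma pseudo_rot (u z w : C) : Cmod u = 1 ->
  pseudo_hyp_dist (u * z)%C (u * w)%C = pseudo_hyp_dist z w.
Proof.
  intros Hu. unfold pseudo_hyp_dist.
  replace (1 - Cconj (u * w) * (u * z))%C with (1 - Cconj w * z)%C.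
  - replace ((u * z - u * w) / (1 - Cconj w * z))%C with (u * ((z - w) / (1 - Cconj w * z)))%C
      by (unfold Cdiv; ring).
    rewrite Cmod_mult, Hu. ring.
  - rewrite Cmult_conj. replace (Cconj u * Cconj w * (u * z))%C with ((u * Cconj u) * (Cconj w * z))%C by ring.
    rewrite Cmod_1_conj by exact Hu. ring.
Qed.

Lemma cdiff_mob (p w : C) : Cmod p < 1 -> Cmod w < 1 -> cdiff (mob p) w.
Proof.
  intros Hp Hw. apply cdiff_div.
  - apply cdiff_minus; [apply cdiff_id|apply cdiff_const].
  - apply cdiff_minus; [apply cdiff_const|].
    apply cdiff_mult; [apply cdiff_const|apply cdiff_id].
  - apply mob_den; lra.
Qed.

Lemma disc_map_mob (p : C) : Cmod p < 1 -> disc_map (mob p).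
Proof. intros Hp z Hz. split; [apply cdiff_mob|apply mob_lt_1]; assumption. Qed.

Lemma disc_map_comp (f g : C -> C) : disc_map f -> disc_map g -> disc_map (fun z => f (g z)).
Proof.
  intros Hf Hg z Hz. destruct (Hg z Hz) as [D1 B1]. destruct (Hf (g z) B1) as [D2 B2].
  split; [apply cdiff_comp|]; assumption.
Qed.

Lemma disc_map_rot (u : C) : Cmod u = 1 -> disc_map (fun z => u * z)%C.
Proof.
  intros Hu z Hz. split.
  - apply cdiff_mult; [apply cdiff_const|apply cdiff_id].
  - rewrite Cmod_mult, Hu. lra.
Qed.

Lemma schwarz_factor (psi : C -> C) : disc_map psi -> psi 0%C = 0%C ->
  exists h : C -> C, is_cder psi 0 (h 0%C) /\ ccont h 0 /\ forall w, (psi w = h w * w)%C.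
Proof.
  intros Hd H0. destruct (Hd 0%C ltac:(rewrite Cmod_0; lra)) as [[l [h [Hl [Hc He]]]] _].
  exists h. split; [|split; [exact Hc|]].
  - exists h. auto.
  - intros w. specialize (He w). rewrite H0 in He.
    replace (psi w) with (psi w - 0)%C by ring. rewrite He. ring.
Qed.

Lemma schwarz_pick (f : C -> C) (a b : C) : disc_map f -> Cmod a < 1 -> Cmod b < 1 ->
  pseudo_hyp_dist (f a) (f b) <= pseudo_hyp_dist a b.
Proof.
  intros Hf Ha Hb.
  set (psi := fun z => mob (f b) (f (mob (- b) z))).
  assert (Hfb : Cmod (f b) < 1) by apply Hf, Hb.
  assert (Hpsi : disc_map psi).
  { apply (disc_map_comp (mob (f b)) (fun z => f (mob (- b) z))).
    - apply disc_map_mob, Hfb.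
    - apply (disc_map_comp f (mob (- b))); [exact Hf|].
      apply disc_map_mob. rewrite Cmod_opp. exact Hb. }
  assert (H0 : psi 0%C = 0%C).
  { unfold psi. rewrite mob_0. replace (- - b)%C with b by ring. apply mob_self. }
  destruct (schwarz_factor psi Hpsi H0) as [h [_ [Hc He]]].
  pose proof (mob_lt_1 b a Hb Ha) as Hm.
  pose proof (schwarz psi h Hpsi Hc He (mob b a) Hm) as HS.
  change (Cmod (mob (f b) (f a)) <= Cmod (mob b a)).
  replace (mob (f b) (f a)) with (psi (mob b a)) by (unfold psi; rewrite mob_mob by lra; reflexivity).
  rewrite He, Cmod_mult. pose proof (Cmod_ge_0 (mob b a)). nra.
Qed.

(** Takes the place of limits: a comparison known only off a point passes to the point by continuity
    of both sides. *)
Lemma ccont_Cmod_le (f g : C -> C) (z : C) (d : R) : ccont f z -> ccont g z -> 0 < d ->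
  (forall w, w <> z -> Cmod (w - z)%C < d -> Cmod (f w) <= Cmod (g w)) -> Cmod (f z) <= Cmod (g z).
Proof.
  intros Hf Hg Hd H. apply le_epsilon. intros e He.
  destruct (Hf (e / 2)) as [d1 [Hd1 H1]]; [lra|]. destruct (Hg (e / 2)) as [d2 [Hd2 H2]]; [lra|].
  destruct (common_pos d1 d2) as [d3 [Hd3 [L1 L2]]]; auto.
  destruct (common_pos d d3) as [s [Hs [L3 L4]]]; auto.
  assert (Es : Cmod (z + RtoC (s / 2) - z)%C = s / 2).
  { replace (z + RtoC (s / 2) - z)%C with (RtoC (s / 2)) by ring. rewrite Cmod_R, Rabs_pos_eq; lra. }
  set (w := (z + RtoC (s / 2))%C) in *.
  assert (Hne : w <> z).
  { intros E. rewrite E in Es. replace (z - z)%C with (RtoC 0) in Es by ring.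
    rewrite Cmod_0 in Es. lra. }
  specialize (H w Hne ltac:(lra)). specialize (H1 w ltac:(lra)). specialize (H2 w ltac:(lra)).
  rewrite Cmod_minus_sym in H1.
  pose proof (Cmod_triangle_rev (f z) (f w)). pose proof (Cmod_triangle_rev (g w) (g z)). lra.
Qed.

(** * Distortion as the diagonal value of distance ratios *)

Section Distortion.

Variable phi : C -> C.
Hypothesis phi_holo : holomorphic_on_disc phi.
Hypothesis phi_maps : forall z : C, unit_disc z -> unit_disc (phi z).

Lemma phi_is_cder (z : C) : Cmod z < 1 -> is_cder phi z (C_derive phi z).
Proof. intros Hz. apply holomorphic_is_cder, phi_holo, Hz. Qed.

Lemma phi_disc_map : disc_map phi.
Proof.
  intros z Hz. split; [eexists; apply phi_is_cder, Hz|apply phi_maps, Hz].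
Qed.

(** [q] is the slope function of [phi] corrected by the Moebius denominators. Its modulus is the
    ratio of pseudohyperbolic distances off the diagonal, and its continuity makes the distortion
    accessible through comparisons of distances. *)
Lemma distortion_factor (z : C) : Cmod z < 1 ->
  exists q : C -> C, ccont q z /\ Cmod (q z) = hyp_distortion phi z /\
    forall w, Cmod w < 1 -> pseudo_hyp_dist (phi w) (phi z) = Cmod (q w) * pseudo_hyp_dist w z.
Proof.
  intros Hz. destruct (phi_is_cder z Hz) as [h [Hl [Hc He]]].
  assert (Hpz : Cmod (phi z) < 1) by apply phi_maps, Hz.
  assert (Hden : forall w, Cmod w < 1 -> (1 - Cconj (phi z) * phi w)%C <> 0%C).
  { intros w Hw. apply mob_den; [exact Hpz|]. left. apply phi_maps, Hw. }
  exists (fun w => h w * (1 - Cconj z * w) / (1 - Cconj (phi z) * phi w))%C. split; [|split].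
  - apply ccont_div; [| |apply Hden, Hz].
    + apply ccont_mult; [exact Hc|]. apply ccont_minus; [apply ccont_const|].
      apply ccont_mult; [apply ccont_const|apply ccont_id].
    + apply ccont_minus; [apply ccont_const|].
      apply ccont_mult; [apply ccont_const|]. exact (is_cder_ccont _ _ _ (phi_is_cder z Hz)).
  - assert (Hself : forall v, Cmod v < 1 -> Cmod (1 - Cconj v * v)%C = 1 - Cmod v ^ 2).
    { intros v Hv. replace (1 - Cconj v * v)%C with (RtoC (1 - Cmod v ^ 2)).
      - rewrite Cmod_R, Rabs_pos_eq; [reflexivity|]. pose proof (Cmod_ge_0 v). nra.
      - rewrite RtoC_minus, Cmod2_conj. ring. }
    rewrite Cmod_div, Cmod_mult by (apply Hden, Hz). rewrite !Hself by assumption.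
    rewrite Hl. unfold hyp_distortion. unfold Rdiv. ring.
  - intros w Hw. unfold pseudo_hyp_dist. rewrite He.
    pose proof (Hden w Hw) as H1. pose proof (mob_den z w Hz ltac:(lra)) as H2.
    rewrite <- Cmod_mult. f_equal. field. split; assumption.
Qed.

Lemma pseudo_pos (z w : C) : Cmod z < 1 -> Cmod w < 1 -> z <> w -> 0 < pseudo_hyp_dist z w.
Proof.
  intros Hz Hw Hne. unfold pseudo_hyp_dist. apply Cmod_gt_0. unfold Cdiv.
  apply Cmult_neq_0; [apply Cminus_eq_contra, Hne|].
  intros E. pose proof (mob_den w z Hw ltac:(lra)) as H. apply C1_nz.
  rewrite <- (Cinv_r _ H), E. ring.
Qed.

Lemma disc_nbhd (z w : C) : Cmod (w - z)%C < 1 - Cmod z -> Cmod w < 1.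
Proof.
  intros H. pose proof (Cmod_triangle_rev w z). lra.
Qed.

Lemma hyp_distortion_ge (z : C) (c d : R) : Cmod z < 1 -> 0 < d ->
  (forall w, Cmod w < 1 -> w <> z -> Cmod (w - z)%C < d ->
     c * pseudo_hyp_dist w z <= pseudo_hyp_dist (phi w) (phi z)) ->
  c <= hyp_distortion phi z.
Proof.
  intros Hz Hd H. destruct (distortion_factor z Hz) as [q [Hc [<- He]]].
  destruct (Rle_dec c 0) as [H0|H0]; [pose proof (Cmod_ge_0 (q z)); lra|].
  assert (Ec : Cmod (RtoC c) = c) by (rewrite Cmod_R, Rabs_pos_eq; lra).
  rewrite <- Ec. destruct (common_pos d (1 - Cmod z)) as [d' [Hd' [L1 L2]]]; [lra..|].
  apply (ccont_Cmod_le (fun _ => RtoC c) q z d' (ccont_const _ _) Hc Hd').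
  intros w Hne Hw. assert (Hw1 : Cmod w < 1) by (apply (disc_nbhd z); lra).
  specialize (H w Hw1 Hne ltac:(lra)). rewrite He in H by exact Hw1. rewrite Ec.
  apply Rmult_le_reg_r in H; [exact H|]. apply pseudo_pos; auto.
Qed.

Lemma hyp_distortion_le_1 (z : C) : Cmod z < 1 -> hyp_distortion phi z <= 1.
Proof.
  intros Hz. destruct (distortion_factor z Hz) as [q [Hc [<- He]]].
  rewrite <- Cmod_1. apply (ccont_Cmod_le q (fun _ => RtoC 1) z (1 - Cmod z) Hc (ccont_const _ _)); [lra|].
  intros w Hne Hw. pose proof (disc_nbhd z w Hw) as Hw1.
  pose proof (schwarz_pick phi w z phi_disc_map Hw1 Hz) as H.
  rewrite He in H by exact Hw1. pose proof (pseudo_pos w z Hw1 Hz Hne).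
  rewrite Cmod_1. apply Rmult_le_reg_r with (pseudo_hyp_dist w z); lra.
Qed.

Lemma hyp_distortion_ge_0 (z : C) : Cmod z < 1 -> 0 <= hyp_distortion phi z.
Proof.
  intros Hz. destruct (distortion_factor z Hz) as [q [_ [<- _]]]. apply Cmod_ge_0.
Qed.

(* [phi] seen from hyperbolic frames at [z0] and [phi z0], rotated so that the derivative at [0] is >= 0. *)
Definition normalized (sigma z0 u : C) (z : C) : C :=
  (Cconj u * mob (phi z0) (phi (mob (- z0) (sigma * z))))%C.

Lemma disc_map_normalized (sigma z0 u : C) : Cmod sigma = 1 -> Cmod z0 < 1 -> Cmod u = 1 ->
  disc_map (normalized sigma z0 u).
Proof.
  intros Hs Hz Hu.
  apply (disc_map_comp (fun z => Cconj u * z)%C (fun z => mob (phi z0) (phi (mob (- z0) (sigma * z))))).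
  { apply disc_map_rot. rewrite Cmod_conj. exact Hu. }
  apply (disc_map_comp (mob (phi z0)) (fun z => phi (mob (- z0) (sigma * z)))).
  { apply disc_map_mob, phi_maps, Hz. }
  apply (disc_map_comp phi (fun z => mob (- z0) (sigma * z))%C); [exact phi_disc_map|].
  apply (disc_map_comp (mob (- z0)) (fun z => sigma * z)%C).
  - apply disc_map_mob. rewrite Cmod_opp. exact Hz.
  - apply disc_map_rot, Hs.
Qed.

Lemma normalized_0 (sigma z0 u : C) : normalized sigma z0 u 0 = 0%C.
Proof.
  unfold normalized. rewrite Cmult_0_r, mob_0. replace (- - z0)%C with z0 by ring.
  rewrite mob_self. ring.
Qed.

Lemma is_cder_unique (f : C -> C) (z l m : C) : is_cder f z l -> is_cder f z m -> l = m.
Proof.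
  intros [h [Hl [Hc He]]] [k [Km [Kc Ke]]]. apply Ceq_minus, Cmod_eq_0, Rle_antisym; [|apply Cmod_ge_0].
  rewrite <- Hl, <- Km, <- Cmod_0.
  apply (ccont_Cmod_le (fun w => h w - k w)%C (fun _ => RtoC 0) z 1);
    [apply ccont_minus; assumption|apply ccont_const|lra|].
  intros w Hw _. right. f_equal.
  assert (H0 : (w - z)%C <> 0%C) by (apply Cminus_eq_contra, Hw).
  replace (h w - k w)%C with ((h w * (w - z) - k w * (w - z)) / (w - z))%C by (field; exact H0).
  rewrite <- He, <- Ke. field. exact H0.
Qed.

(** The modulus of [h 0] is found off the centre: automorphisms preserve pseudohyperbolic distance,
    so [Cmod (h w)] equals the modulus of the factor from [distortion_factor] at the corresponding
    point, and continuity gives the value at 0. The unit [u] is the phase of the unrotated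
    derivative, or 1 when that vanishes. *)
Lemma normalized_exists (sigma z0 : C) : Cmod sigma = 1 -> Cmod z0 < 1 ->
  exists u : C, Cmod u = 1 /\ exists h : C -> C,
    h 0%C = RtoC (hyp_distortion phi z0) /\ ccont h 0 /\
    forall w, (normalized sigma z0 u w = h w * w)%C.
Proof.
  intros Hs Hz.
  pose proof (disc_map_normalized sigma z0 1 Hs Hz Cmod_1) as Hn.
  destruct (schwarz_factor _ Hn (normalized_0 sigma z0 1)) as [h [_ [Hc He]]].
  assert (HL : Cmod (h 0%C) = hyp_distortion phi z0).
  { destruct (distortion_factor z0 Hz) as [q [Hqc [<- Hq]]].
    set (m := fun z : C => mob (- z0) (sigma * z)%C).
    assert (Hm : disc_map m).
    { apply (disc_map_comp (mob (- z0)) (fun z => sigma * z)%C).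
      - apply disc_map_mob. rewrite Cmod_opp. exact Hz.
      - apply disc_map_rot, Hs. }
    assert (Hm0 : m 0%C = z0).
    { unfold m. rewrite Cmult_0_r, mob_0. ring. }
    assert (Hqm : ccont (fun z => q (m z)) 0).
    { apply (ccont_comp q m).
      - apply cdiff_ccont, Hm. rewrite Cmod_0. lra.
      - rewrite Hm0. exact Hqc. }
    assert (Heq : forall w : C, w <> 0%C -> Cmod (w - 0)%C < 1 -> Cmod (h w) = Cmod (q (m w))).
    { intros w Hw0 Hw. replace (w - 0)%C with w in Hw by ring.
      pose proof (proj1 (Cmod_gt_0 w) Hw0) as Hwp.
      apply Rmult_eq_reg_r with (Cmod w); [|lra].
      rewrite <- Cmod_mult, <- He. unfold normalized. fold (m w).
      rewrite Cmod_mult, Cmod_conj, Cmod_1, Rmult_1_l.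
      change (Cmod (mob (phi z0) (phi (m w)))) with (pseudo_hyp_dist (phi (m w)) (phi z0)).
      rewrite Hq by apply Hm, Hw. f_equal.
      unfold m. rewrite <- Hm0 at 2. unfold m.
      rewrite pseudo_mob; try (rewrite ?Cmod_opp, ?Cmod_mult, ?Hs, ?Cmod_0; lra).
      rewrite pseudo_rot by exact Hs. unfold pseudo_hyp_dist. f_equal.
      rewrite Cconj_R.
      replace (1 - 0 * w)%C with (RtoC 1) by ring. field. }
    replace (q z0) with (q (m 0%C)) by (rewrite Hm0; reflexivity).
    apply Rle_antisym; [apply (ccont_Cmod_le h (fun w => q (m w)) 0 1)
      |apply (ccont_Cmod_le (fun w => q (m w)) h 0 1)]; auto; try lra;
      intros w Hw0 Hw; rewrite Heq by assumption; lra. }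
  set (L := h 0%C) in *.
  assert (Hu : exists u, Cmod u = 1 /\ (Cconj u * L)%C = RtoC (Cmod L)).
  { destruct (Ceq_dec L 0) as [->|HL0].
    - exists 1%C. split; [apply Cmod_1|]. rewrite Cmod_0. ring.
    - assert (Hm : 0 < Cmod L) by (apply Cmod_gt_0, HL0).
      assert (Hm0 : RtoC (Cmod L) <> 0%C) by (intros E; apply RtoC_inj in E; lra).
      exists (L / RtoC (Cmod L))%C. split.
      + rewrite Cmod_div, Cmod_R, Rabs_pos_eq by (auto; lra). field. lra.
      + rewrite Cdiv_conj by exact Hm0.
        rewrite Cconj_R.
        replace (Cconj L / RtoC (Cmod L) * L)%C with ((L * Cconj L) / RtoC (Cmod L))%C
          by (field; exact Hm0).
        rewrite <- Cmod2_conj, RtoC_pow. field. exact Hm0. }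
  destruct Hu as [u [Hu1 Hu2]].
  exists u. split; [exact Hu1|]. exists (fun w => Cconj u * h w)%C. split; [|split].
  - fold L. rewrite Hu2, HL. reflexivity.
  - apply ccont_mult; [apply ccont_const|exact Hc].
  - intros w. rewrite <- Cmult_assoc, <- He. unfold normalized.
    rewrite Cconj_R. ring.
Qed.

End Distortion.

(** * From weak conformality to the radial limit *)

(** The Schwarz lemma for [(G - c) / (G + Cconj c)], the half-plane coordinate change taking
    [c = G 0] to 0. Solving for [G] and differentiating at 0 gives [l = h 0 * (2 * Re c)] with
    [Cmod (h 0) <= 1]. *)
Lemma half_plane_derivative (G : C -> C) (l : C) : (forall z, Cmod z < 1 -> cdiff G z) ->
  (forall z, Cmod z < 1 -> 0 < Re (G z)) -> is_cder G 0 l -> Cmod l <= 2 * Re (G 0%C).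
Proof.
  intros HG HP Hl. assert (H01 : Cmod 0 < 1) by (rewrite Cmod_0; lra).
  pose proof (HP 0%C H01) as Hc. set (c := G 0%C) in *.
  assert (Hlt : forall z, Cmod z < 1 -> Cmod (G z - c)%C < Cmod (G z + Cconj c)%C).
  { intros z Hz. specialize (HP z Hz).
    pose proof (Cmod2_alt (G z - c)%C) as E1. pose proof (Cmod2_alt (G z + Cconj c)%C) as E2.
    pose proof (Cmod_ge_0 (G z + Cconj c)%C). destruct (G z) as [x y], c as [a b]. simpl in *.
    apply Rnot_le_lt. intros H1. nra. }
  assert (Hne : forall z, Cmod z < 1 -> (G z + Cconj c)%C <> 0%C).
  { intros z Hz. apply Cmod_gt_0. pose proof (Cmod_ge_0 (G z - c)%C). specialize (Hlt z Hz). lra. }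
  set (psi := fun z => ((G z - c) / (G z + Cconj c))%C).
  assert (Hpsi : disc_map psi).
  { intros z Hz. specialize (Hne z Hz). split.
    - apply cdiff_div; [apply cdiff_minus|apply cdiff_plus|]; auto using cdiff_const.
    - unfold psi. rewrite Cmod_div by exact Hne.
      apply div_lt; [apply Cmod_gt_0, Hne|]. rewrite Rmult_1_l. auto. }
  assert (Hpsi0 : psi 0%C = 0%C) by (unfold psi, c, Cdiv; ring).
  destruct (schwarz_factor psi Hpsi Hpsi0) as [h [Hh [Hhc He]]].
  pose proof (schwarz psi h Hpsi Hhc He 0 H01) as HS.
  assert (E : l = (0 + (h 0%C * (G 0%C + Cconj c) + psi 0%C * (l + 0)))%C).
  { apply (is_cder_unique G 0 _ _ Hl).
    apply (is_cder_ext_loc (fun z => c + psi z * (G z + Cconj c))%C G 0 _ 1); [lra| |].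
    - intros z Hz. replace (z - 0)%C with z in Hz by ring. unfold psi. field. auto.
    - apply (is_cder_plus (fun _ => c) (fun z => psi z * (G z + Cconj c))%C); [apply is_cder_const|].
      apply (is_cder_mult psi (fun z => G z + Cconj c)%C); [exact Hh|].
      apply (is_cder_plus G (fun _ => Cconj c)); [exact Hl|apply is_cder_const]. }
  rewrite Hpsi0 in E. fold c in E.
  assert (E2 : l = (h 0%C * RtoC (2 * Re c))%C).
  { rewrite E. replace (c + Cconj c)%C with (RtoC (2 * Re c)); [ring|].
    apply injective_projections; simpl; unfold Re; ring. }
  rewrite E2, Cmod_mult, Cmod_R, Rabs_pos_eq by lra. nra.
Qed.

(* A thin sector is an intersection of two half-planes bounded by lines through [0]. *)
Lemma sector_derivative (F : C -> C) (l : C) (e : R) : 0 < e ->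
  (forall z, Cmod z < 1 -> cdiff F z) ->
  (forall z, Cmod z < 1 -> 0 < Re (F z) /\ Rabs (Im (F z)) <= e * Re (F z)) ->
  is_cder F 0 l -> Cmod l <= 6 * e * Re (F 0%C).
Proof.
  intros He HF HS Hl. set (v := (RtoC (2 * e) - Ci)%C).
  assert (ER : forall w, Re (v * w)%C = 2 * e * Re w + Im w).
  { intros [x y]. simpl. ring. }
  assert (Hv : 1 <= Cmod v).
  { eapply Rle_trans; [|apply im_le_Cmod]. simpl. rewrite Rabs_left; lra. }
  pose proof (half_plane_derivative (fun z => v * F z)%C (v * l)%C) as HD.
  cbv beta in HD. rewrite Cmod_mult, ER in HD.
  assert (H : Cmod v * Cmod l <= 2 * (2 * e * Re (F 0%C) + Im (F 0%C))).
  { apply HD.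
    - intros z Hz. apply cdiff_mult; [apply cdiff_const|auto].
    - intros z Hz. rewrite ER. destruct (HS z Hz) as [H1 H2]. apply Rabs_le_between in H2. nra.
    - apply is_cder_scal, Hl. }
  destruct (HS 0%C ltac:(rewrite Cmod_0; lra)) as [H1 H2]. apply Rabs_le_between in H2.
   nra.
Qed.

Lemma Rabs_sin_le (x : R) : Rabs (sin x) <= Rabs x.
Proof.
  assert (Haux : forall y, 0 < y -> Rabs (sin y) <= y).
  { intros y Hy. pose proof (sin_lt_x y Hy). pose proof (SIN_bound y).
    apply Rabs_le. split; [|lra].
    destruct (Rle_dec y 1) as [H1|H1]; [|lra].
    pose proof PI2_3_2. pose proof (sin_ge_0 y ltac:(lra) ltac:(lra)). lra. }
  destruct (Rtotal_order x 0) as [H|[->|H]].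
  - rewrite <- (Rabs_Ropp (sin x)), <- sin_neg, <- (Rabs_Ropp x), (Rabs_pos_eq (- x)) by lra.
    apply Haux; lra.
  - rewrite sin_0; lra.
  - rewrite (Rabs_pos_eq x) by lra. apply Haux; lra.
Qed.

Lemma half_le_cos (x : R) : Rabs x <= 1 -> 1 / 2 <= cos x.
Proof.
  intros H. assert (E : cos x = cos (Rabs x)).
  { unfold Rabs. destruct (Rcase_abs x); [rewrite cos_neg|]; reflexivity. }
  rewrite E, <- cos_PI3. pose proof PI2_3_2. pose proof (Rabs_pos x).
  apply cos_decr_1; lra.
Qed.

Lemma Carg_sector (z : C) (e : R) : z <> 0%C -> e <= 1 -> Rabs (Carg z) <= e ->
  0 < Re z /\ Rabs (Im z) <= 2 * e * Re z.
Proof.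
  intros Hz He H. destruct (Carg_correct z Hz) as [_ E].
  pose proof (proj1 (Cmod_gt_0 z) Hz) as Hm.
  pose proof (half_le_cos (Carg z) ltac:(lra)) as Hc.
  pose proof (Rabs_sin_le (Carg z)) as Hs.
  set (m := Cmod z) in *. set (t := Carg z) in *.
  rewrite E. simpl. rewrite Rabs_mult, (Rabs_pos_eq m) by lra.
  pose proof (Rabs_pos (sin t)). split; [nra|].
  apply Rle_trans with (m * e); [apply Rmult_le_compat_l; lra|].
  assert (0 <= m * e) by (apply Rmult_le_pos; lra). nra.
Qed.

Lemma angular_lim_eps (f : C -> R) (sigma : C) (l M : R) :
  filterlim f (stolz_filter sigma M) (locally l) <->
  forall eps, 0 < eps -> exists del, 0 < del /\ forall z, Cmod (z - sigma)%C < del ->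
    stolz sigma M z -> Rabs (f z - l) < eps.
Proof.
  split.
  - intros H e He. pose proof (proj1 (filterlim_locally f l) H (mkposreal e He)) as H1.
    apply locally_Cmod in H1. destruct H1 as [d [Hd H1]]. exists d. split; [exact Hd|].
    intros z Hz Hs. exact (H1 z Hz Hs).
  - intros H. apply filterlim_locally. intros e.
    destruct (H e (cond_pos e)) as [d [Hd H1]]. apply locally_Cmod. exists d. split; [exact Hd|].
    intros z Hz Hs. exact (H1 z Hz Hs).
Qed.

Lemma at_left_lim_eps (f : R -> R) (l : R) :
  filterlim f (at_left 1) (locally l) <->
  forall eps, 0 < eps -> exists del, 0 < del /\ forall r, 1 - del < r < 1 -> Rabs (f r - l) < eps.
Proof.
  split.
  - intros H e He. pose proof (proj1 (filterlim_locally f l) H (mkposreal e He)) as [d Hd].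
    exists d. split; [apply cond_pos|]. intros r Hr. apply (Hd r); [|lra].
    apply Rabs_lt_between'. lra.
  - intros H. apply filterlim_locally. intros e.
    destruct (H e (cond_pos e)) as [d [Hd H1]]. exists (mkposreal d Hd).
    intros r Hr Hr1. apply H1. apply Rabs_lt_between' in Hr. simpl in Hr. lra.
Qed.

Section Conformal.

Variables (phi : C -> C) (sigma : C).
Hypothesis phi_holo : holomorphic_on_disc phi.
Hypothesis phi_maps : forall z : C, unit_disc z -> unit_disc (phi z).
Hypothesis sigma_bd : Cmod sigma = 1.

Lemma one_minus_neq_0 (u w : C) : Cmod u = 1 -> Cmod w < 1 -> (1 - Cconj u * w)%C <> 0%C.
Proof.
  intros Hu Hw E. pose proof (Cmod_triangle_rev 1 (Cconj u * w)) as T.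
  rewrite E, Cmod_0, Cmod_1, Cmod_mult, Cmod_conj, Hu in T. lra.
Qed.

(** Such a [z] is within [3 * (1 - r) / 2] of [sigma], while [1 - Cmod z] exceeds [(1 - r) / 2], so
    their ratio stays below 3. *)
Lemma stolz_of_subdisc (r : R) (z : C) : 0 < r < 1 ->
  Cmod (z - RtoC r * sigma)%C < (1 - r) / 2 -> stolz sigma 4 z /\ Cmod (z - sigma)%C < 2 * (1 - r).
Proof.
  intros Hr Hz.
  assert (E1 : Cmod (RtoC r * sigma)%C = r).
  { rewrite Cmod_mult, sigma_bd, Cmod_R, Rabs_pos_eq; lra. }
  assert (E2 : Cmod (RtoC r * sigma - sigma)%C = 1 - r).
  { replace (RtoC r * sigma - sigma)%C with (RtoC (r - 1) * sigma)%C by (rewrite RtoC_minus; ring).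
    rewrite Cmod_mult, sigma_bd, Cmod_R, Rabs_left; lra. }
  pose proof (Cmod_triangle_rev z (RtoC r * sigma)) as T1.
  pose proof (Cmod_triangle_via z (RtoC r * sigma) sigma) as T2.
  unfold stolz, unit_disc. repeat split; lra.
Qed.

(** Differentiating [1 - Cconj tau * phi z = q z * (1 - Cconj sigma * z)] at [c = r sigma] gives the
    modulus of the derivative as that of [Cconj sigma * q c - l * (1 - r)], where [l] is the
    derivative of [q]. The sector bound on a disc of radius [(1 - r) / 2] makes the second term at
    most [24 * e * Re (q c)]. On the other side [1 - Cmod (phi c) ^ 2] is at most
    [2 * (1 - r) * Re (q c)], so [Re (q c)] cancels and [(1 - r ^ 2) / (2 * (1 - r))] leaves
    [(1 + r) / 2]. *)
Lemma distortion_lower_bound (tau : C) (r e : R) : Cmod tau = 1 -> 0 < r < 1 -> 0 < e <= 1 ->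
  (forall z, Cmod (z - RtoC r * sigma)%C < (1 - r) / 2 ->
    Rabs (Carg ((1 - Cconj tau * phi z) / (1 - Cconj sigma * z))%C) <= e) ->
  (1 + r) / 2 * (1 - 24 * e) <= hyp_distortion phi (RtoC r * sigma)%C.
Proof.
  intros Ht Hr He HA. set (c := (RtoC r * sigma)%C).
  assert (Ec : Cmod c = r).
  { unfold c. rewrite Cmod_mult, sigma_bd, Cmod_R, Rabs_pos_eq; lra. }
  assert (Hin : forall z, Cmod (z - c)%C < (1 - r) / 2 -> Cmod z < 1).
  { intros z Hz. pose proof (Cmod_triangle_rev z c). lra. }
  set (q := fun z => ((1 - Cconj tau * phi z) / (1 - Cconj sigma * z))%C).
  assert (Hqd : forall z, Cmod z < 1 -> cdiff q z).
  { intros z Hz. apply cdiff_div.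
    - apply cdiff_minus; [apply cdiff_const|]. apply cdiff_mult; [apply cdiff_const|].
      eexists. apply phi_is_cder; assumption.
    - apply cdiff_minus; [apply cdiff_const|]. apply cdiff_mult; [apply cdiff_const|apply cdiff_id].
    - apply one_minus_neq_0; assumption. }
  assert (Hq0 : forall z, Cmod z < 1 -> q z <> 0%C).
  { intros z Hz E. apply (one_minus_neq_0 tau (phi z) Ht); [apply phi_maps, Hz|].
    replace (1 - Cconj tau * phi z)%C with (q z * (1 - Cconj sigma * z))%C.
    - rewrite E. ring.
    - unfold q. field. apply one_minus_neq_0; assumption. }
  assert (Hsec : forall z, Cmod (z - c)%C < (1 - r) / 2 ->
    0 < Re (q z) /\ Rabs (Im (q z)) <= 2 * e * Re (q z)).
  { intros z Hz. apply Carg_sector; [apply Hq0, Hin, Hz|lra|apply HA, Hz]. }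
  assert (Hcc : Cmod (c - c)%C < (1 - r) / 2).
  { replace (c - c)%C with (RtoC 0) by ring. rewrite Cmod_0. lra. }
  destruct (Hsec c Hcc) as [Hx Hy].
  destruct (Hqd c ltac:(lra)) as [l Hl].
  set (s := (1 - r) / 2) in *.
  pose proof (sector_derivative (fun w => q (c + RtoC s * w)%C) (l * RtoC s) (2 * e) ltac:(lra)) as SD.
  assert (Hsub : forall w, Cmod w < 1 -> Cmod (c + RtoC s * w - c)%C < s).
  { intros w Hw. replace (c + RtoC s * w - c)%C with (RtoC s * w)%C by ring.
    assert (0 < s) by (unfold s; lra).
    rewrite Cmod_mult, Cmod_R, Rabs_pos_eq by lra. nra. }
  assert (Hlin : forall w, is_cder (fun w => c + RtoC s * w)%C w (RtoC s)).
  { intros w. pose proof (is_cder_plus _ _ w _ _ (is_cder_const c w)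
      (is_cder_scal (RtoC s) _ w _ (is_cder_id w))) as X.
    cbv beta in X. replace (0 + RtoC s * 1)%C with (RtoC s) in X by ring. exact X. }
  assert (Ec0 : (c + RtoC s * 0)%C = c) by ring.
  specialize (SD (fun w Hw => cdiff_comp q _ w (ex_intro _ _ (Hlin w)) (Hqd _ (Hin _ (Hsub w Hw))))).
  specialize (SD (fun w Hw => Hsec _ (Hsub w Hw))).
  assert (Hcomp : is_cder (fun w => q (c + RtoC s * w)%C) 0 (l * RtoC s)%C).
  { apply (is_cder_comp q (fun w => c + RtoC s * w)%C); [apply Hlin|]. rewrite Ec0. exact Hl. }
  specialize (SD Hcomp). cbv beta in SD. rewrite Ec0 in SD.
  rewrite Cmod_mult, Cmod_R, Rabs_pos_eq in SD by (unfold s; lra).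
  assert (Hprod : is_cder (fun z => 1 - Cconj tau * phi z)%C c (0 - Cconj tau * C_derive phi c)%C).
  { apply is_cder_minus; [apply is_cder_const|apply is_cder_scal].
    apply phi_is_cder; [assumption|lra]. }
  assert (Hprod2 : is_cder (fun z => q z * (1 - Cconj sigma * z))%C c
     (l * (1 - Cconj sigma * c) + q c * (0 - Cconj sigma * 1))%C).
  { apply (is_cder_mult q (fun z => 1 - Cconj sigma * z)%C); [exact Hl|].
    apply is_cder_minus; [apply is_cder_const|apply is_cder_scal, is_cder_id]. }
  assert (Heqd : (0 - Cconj tau * C_derive phi c
    = l * (1 - Cconj sigma * c) + q c * (0 - Cconj sigma * 1))%C).
  { apply (is_cder_unique _ c _ _ Hprod).
    refine (is_cder_ext_loc _ _ c _ s _ _ Hprod2); [unfold s; lra|].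
    intros w Hw. unfold q. field. apply one_minus_neq_0; [assumption|]. apply Hin, Hw. }
  assert (Esc : (Cconj sigma * c)%C = RtoC r).
  { unfold c. replace (Cconj sigma * (RtoC r * sigma))%C with (RtoC r * (sigma * Cconj sigma))%C by ring.
    rewrite Cmod_1_conj by exact sigma_bd. ring. }
  assert (Ederiv : Cmod (C_derive phi c) = Cmod (Cconj sigma * q c - l * RtoC (1 - r))%C).
  { replace (Cmod (C_derive phi c)) with (Cmod (Cconj tau * C_derive phi c)%C)
      by (rewrite Cmod_mult, Cmod_conj, Ht; ring).
    f_equal.
    replace (Cconj tau * C_derive phi c)%C with (- (0 - Cconj tau * C_derive phi c))%C by ring.
    rewrite Heqd, Esc, RtoC_minus. ring. }
  assert (Hder : Re (q c) * (1 - 24 * e) <= Cmod (C_derive phi c)).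
  { rewrite Ederiv. pose proof (Cmod_triangle_rev (Cconj sigma * q c) (l * RtoC (1 - r))) as T.
    rewrite !Cmod_mult, Cmod_conj, sigma_bd, Cmod_R, (Rabs_pos_eq (1 - r)) in T by lra.
    pose proof (re_le_Cmod (q c)) as T2. pose proof (Rle_abs (Re (q c))).
    unfold s in SD. lra. }
  assert (Hmod : 1 - Cmod (phi c) ^ 2 <= 2 * (1 - r) * Re (q c)).
  { assert (E1 : (Cconj tau * phi c)%C = (1 - RtoC (1 - r) * q c)%C).
    { replace (RtoC (1 - r)) with (1 - Cconj sigma * c)%C by (rewrite Esc, RtoC_minus; ring).
      unfold q. field. apply one_minus_neq_0; [assumption|lra]. }
    replace (Cmod (phi c)) with (Cmod (Cconj tau * phi c)%C)
      by (rewrite Cmod_mult, Cmod_conj, Ht; ring).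
    rewrite E1, Cmod2_alt. destruct (q c) as [x y]. simpl.
    pose proof (Rle_0_sqr ((1 - r) * x)) as S1. pose proof (Rle_0_sqr ((1 - r) * y)) as S2.
    unfold Rsqr in S1, S2. lra. }
  assert (Hpc : Cmod (phi c) < 1) by (apply phi_maps; unfold unit_disc; lra).
  unfold hyp_distortion. fold c. rewrite Ec.
  assert (Hpos : 0 < 1 - Cmod (phi c) ^ 2) by (pose proof (Cmod_ge_0 (phi c)); nra).
  apply Rmult_le_reg_r with (1 - Cmod (phi c) ^ 2); [exact Hpos|].
  replace ((1 - r ^ 2) * (Cmod (C_derive phi c) / (1 - Cmod (phi c) ^ 2)) * (1 - Cmod (phi c) ^ 2))
    with ((1 - r ^ 2) * Cmod (C_derive phi c)) by (field; lra).
  destruct (Rle_dec (1 - 24 * e) 0) as [Hneg|Hneg].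
  - apply Rle_trans with 0.
    + assert (0 <= (1 + r) / 2 * (1 - Cmod (phi c) ^ 2)) by nra. nra.
    + pose proof (Cmod_ge_0 (C_derive phi c)). apply Rmult_le_pos; nra.
  - apply Rnot_le_lt in Hneg.
    apply Rle_trans with ((1 + r) / 2 * (1 - 24 * e) * (2 * (1 - r) * Re (q c))).
    + apply Rmult_le_compat_l; [nra|exact Hmod].
    + replace ((1 + r) / 2 * (1 - 24 * e) * (2 * (1 - r) * Re (q c)))
        with ((1 - r ^ 2) * (Re (q c) * (1 - 24 * e))) by field.
      apply Rmult_le_compat_l; [nra|exact Hder].
Qed.

Lemma conformal_distortion : weakly_conformal_at phi sigma ->
  filterlim (fun r : R => hyp_distortion phi (RtoC r * sigma)%C) (at_left 1) (locally 1).
Proof.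
  intros [tau [Ht [_ HA]]]. apply at_left_lim_eps. intros e He.
  destruct (common_pos 1 (e / 64)) as [k [Hk [Hk1 Hk2]]]; [lra..|].
  specialize (HA 4 ltac:(lra)). destruct (proj1 (angular_lim_eps _ _ _ _) HA k Hk) as [d [Hd H]].
  destruct (common_pos (1 / 2) (e / 2)) as [d1 [Hd1 [L1 L2]]]; [lra..|].
  destruct (common_pos d1 (d / 2)) as [d2 [Hd2 [L3 L4]]]; [lra..|].
  exists d2. split; [exact Hd2|]. intros r Hr.
  assert (Hr1 : 0 < r < 1) by lra.
  pose proof (distortion_lower_bound tau r k Ht Hr1 ltac:(lra)) as HL.
  assert (Hm : Cmod (RtoC r * sigma)%C < 1).
  { rewrite Cmod_mult, sigma_bd, Cmod_R, Rabs_pos_eq; lra. }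
  pose proof (hyp_distortion_le_1 phi phi_holo phi_maps _ Hm) as HU.
  assert (HL' : (1 + r) / 2 * (1 - 24 * k) <= hyp_distortion phi (RtoC r * sigma)%C).
  { apply HL. intros z Hz. destruct (stolz_of_subdisc r z Hr1 Hz) as [Hs Hz2].
    specialize (H z ltac:(lra) Hs). rewrite Rminus_0_r in H. lra. }
  apply Rabs_lt_between'. split; [|lra].
  assert (r * k <= k) by nra. lra.
Qed.

End Conformal.

(** * Hyperbolic distance in half-plane coordinates *)

Lemma ln_le_compat (x y : R) : 0 < x -> x <= y -> ln x <= ln y.
Proof.
  intros Hx [H| ->]; [left; apply ln_increasing; assumption|right; reflexivity].
Qed.

Lemma ratio_le (s t : R) : s <= t -> t < 1 -> (1 + s) / (1 - s) <= (1 + t) / (1 - t).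
Proof.
  intros Hst Ht. apply Rmult_le_reg_r with ((1 - s) * (1 - t)); [nra|].
  replace ((1 + s) / (1 - s) * ((1 - s) * (1 - t))) with ((1 + s) * (1 - t)) by (field; lra).
  replace ((1 + t) / (1 - t) * ((1 - s) * (1 - t))) with ((1 + t) * (1 - s)) by (field; lra).
  nra.
Qed.

Lemma ln_ge_1_minus_inv (x : R) : 0 < x -> 1 - / x <= ln x.
Proof.
  intros Hx. pose proof (exp_ineq1_le (ln (/ x))) as H.
  rewrite exp_ln in H by (apply Rinv_0_lt_compat, Hx). rewrite ln_Rinv in H by exact Hx. lra.
Qed.

Lemma ln_le_minus_1 (x : R) : 0 < x -> ln x <= x - 1.
Proof.
  intros Hx. pose proof (exp_ineq1_le (ln x)) as H. rewrite exp_ln in H by exact Hx. lra.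
Qed.

Lemma pseudo_sym (z w : C) : Cmod z < 1 -> Cmod w < 1 ->
  pseudo_hyp_dist z w = pseudo_hyp_dist w z.
Proof.
  intros Hz Hw. unfold pseudo_hyp_dist.
  rewrite !Cmod_div by (apply mob_den; lra). f_equal; [apply Cmod_minus_sym|].
  rewrite <- Cmod_conj. f_equal. apply injective_projections; simpl; ring.
Qed.

Lemma hyp_dist_pos (z w : C) : Cmod z < 1 -> Cmod w < 1 -> z <> w -> 0 < hyp_dist z w.
Proof.
  intros Hz Hw Hne. pose proof (pseudo_pos z w Hz Hw Hne). pose proof (pseudo_lt_1 z w Hz Hw).
  unfold hyp_dist. set (s := pseudo_hyp_dist z w) in *.
  rewrite <- ln_1. apply ln_increasing; [lra|].
  apply lt_div; lra.
Qed.

(* With [s = rho], the difference of the logarithms is at most [2 t s / (1 - s)], while [hyp_dist >= s]. *)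
Lemma hyp_dist_ratio (z w z' w' : C) (t : R) : Cmod z < 1 -> Cmod w < 1 -> z <> w -> 0 <= t ->
  (1 - t) * pseudo_hyp_dist z w <= pseudo_hyp_dist z' w' ->
  pseudo_hyp_dist z' w' <= pseudo_hyp_dist z w ->
  (1 - 2 * t / (1 - pseudo_hyp_dist z w)) * hyp_dist z w <= hyp_dist z' w'.
Proof.
  intros Hz Hw Hne Ht H1 H2. unfold hyp_dist.
   pose proof (pseudo_lt_1 z w Hz Hw) as Hs1.
  pose proof (pseudo_ge_0 z' w') as Hs'.
  set (s := pseudo_hyp_dist z w) in *. set (s' := pseudo_hyp_dist z' w') in *.
  set (a := (1 + s) / (1 - s)). set (a' := (1 + s') / (1 - s')).
  assert (Ha : 0 < a) by (apply Rdiv_lt_0_compat; lra).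
  assert (Ha' : 0 < a') by (apply Rdiv_lt_0_compat; lra).
  assert (Hl : s <= ln a).
  { eapply Rle_trans; [|apply ln_ge_1_minus_inv, Ha].
    replace (1 - / a) with (2 * s / (1 + s)) by (unfold a; field; lra).
    apply le_div; nra. }
  assert (Hd : ln a - ln a' <= 2 * t * s / (1 - s)).
  { rewrite <- ln_div by assumption.
    eapply Rle_trans; [apply ln_le_minus_1, Rdiv_lt_0_compat; assumption|].
    replace (a / a' - 1) with (2 * (s - s') / (1 - s) * / (1 + s')) by (unfold a, a'; field; lra).
    assert (Hi : / (1 + s') <= 1).
    { rewrite <- Rinv_1. apply Rinv_le_contravar; lra. }
    apply Rle_trans with (2 * (s - s') / (1 - s) * 1).
    - apply Rmult_le_compat_l; [apply Rle_mult_inv_pos; lra|exact Hi].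
    - rewrite Rmult_1_r. apply Rmult_le_compat_r; [left; apply Rinv_0_lt_compat; lra|]. lra. }
  assert (Hk : 2 * t * s / (1 - s) <= 2 * t / (1 - s) * ln a).
  { replace (2 * t * s / (1 - s)) with (2 * t / (1 - s) * s) by (field; lra).
    apply Rmult_le_compat_l; [apply Rle_mult_inv_pos; lra|exact Hl]. }
  lra.
Qed.

Lemma hyp_dist_mono (z w z' w' : C) : pseudo_hyp_dist z w < 1 ->
  pseudo_hyp_dist z' w' <= pseudo_hyp_dist z w -> hyp_dist z' w' <= hyp_dist z w.
Proof.
  intros H1 H2. pose proof (pseudo_ge_0 z' w'). unfold hyp_dist. apply ln_le_compat.
  - apply Rdiv_lt_0_compat; lra.
  - apply ratio_le; lra.
Qed.

(* The half-plane coordinate sending [tau] to infinity. *)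
Definition cayley (tau z : C) : C := ((tau + z) / (tau - z))%C.

Lemma Cmod_lt_neq (x w : C) : Cmod w < Cmod x -> (x - w)%C <> 0%C.
Proof.
  intros H E. pose proof (Cmod_triangle_rev x w) as T. rewrite E, Cmod_0 in T. lra.
Qed.

Lemma Cconj_unit (tau : C) : Cmod tau = 1 -> Cconj tau = (/ tau)%C.
Proof.
  intros H. assert (H0 : tau <> 0%C) by (apply Cmod_gt_0; lra).
  rewrite <- (Cmult_1_r (Cconj tau)), <- (Cinv_r tau H0).
  replace (Cconj tau * (tau * / tau))%C with ((tau * Cconj tau) * / tau)%C by ring.
  rewrite Cmod_1_conj by exact H. ring.
Qed.

Lemma Re_cayley (tau z : C) : Cmod tau = 1 -> Cmod z < 1 ->
  Re (cayley tau z) = (1 - Cmod z ^ 2) / Cmod (tau - z)%C ^ 2.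
Proof.
  intros Ht Hz. pose proof (Cmod_lt_neq tau z ltac:(lra)) as H0.
  pose proof (proj1 (Cmod_gt_0 _) H0) as Hm.
  apply RtoC_inj. rewrite re_alt. unfold cayley. rewrite Cdiv_conj by exact H0.
  rewrite RtoC_div by (apply pow_nonzero; lra).
  rewrite RtoC_minus, !Cmod2_conj.
  assert (H1 : Cconj (tau - z) <> 0%C).
  { apply Cmod_gt_0. rewrite Cmod_conj. exact Hm. }
  rewrite Cplus_conj. rewrite Cminus_conj in H1 |- *.
  rewrite <- (Cmod_1_conj tau Ht). field. split; assumption.
Qed.

Lemma Re_cayley_pos (tau z : C) : Cmod tau = 1 -> Cmod z < 1 -> 0 < Re (cayley tau z).
Proof.
  intros Ht Hz. rewrite Re_cayley by assumption.
  pose proof (proj1 (Cmod_gt_0 _) (Cmod_lt_neq tau z ltac:(lra))).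
  pose proof (Cmod_ge_0 z).
  apply Rdiv_lt_0_compat; [nra|apply pow_lt; assumption].
Qed.

(* Changing the base point of the half-plane coordinate is an affine map with positive dilation factor. *)
Lemma cayley_mob (tau p y u : C) : Cmod tau = 1 -> Cmod u = 1 -> Cmod p < 1 -> Cmod y < 1 ->
  cayley tau y = (RtoC (Re (cayley tau p)) * cayley (u * mob p tau) (u * mob p y)
                  + Ci * RtoC (Im (cayley tau p)))%C.
Proof.
  intros Ht Hu Hp Hy.
  assert (Ht0 : tau <> 0%C) by (apply Cmod_gt_0; lra).
  assert (Hu0 : u <> 0%C) by (apply Cmod_gt_0; lra).
  pose proof (Cmod_lt_neq tau p ltac:(lra)) as N1.
  pose proof (Cmod_lt_neq tau y ltac:(lra)) as N2.
  pose proof (mob_den p tau Hp ltac:(lra)) as N3. pose proof (mob_den p y Hp ltac:(lra)) as N4.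
  pose proof (Cmod_lt_1_conj p Hp) as N5.
  assert (N6 : (mob p tau - mob p y)%C <> 0%C).
  { rewrite mob_diff by lra. unfold Cdiv.
    apply Cmult_neq_0; [apply Cmult_neq_0; assumption|].
    intros E. apply C1_nz. rewrite <- (Cinv_r ((1 - Cconj p * tau) * (1 - Cconj p * y))%C), E.
    - ring.
    - apply Cmult_neq_0; assumption. }
  assert (E1 : cayley (u * mob p tau) (u * mob p y) =
     (((tau - p) * (1 - Cconj p * y) + (y - p) * (1 - Cconj p * tau))
      / ((1 - p * Cconj p) * (tau - y)))%C).
  { unfold cayley.
    replace (u * mob p tau - u * mob p y)%C with (u * (mob p tau - mob p y))%C by ring.
    rewrite mob_diff in N6 |- * by lra. unfold mob. field. repeat split; assumption. }
  rewrite E1, re_alt, im_alt.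
  assert (HI : forall X J : C, J <> 0%C -> (J * (X / (2 * J)))%C = (X / 2)%C).
  { intros X J HJ. field. exact HJ. }
  rewrite HI by exact Ci_nz.
  unfold cayley. rewrite Cdiv_conj by exact N1.
  rewrite Cplus_conj, Cminus_conj, (Cconj_unit tau Ht).
  assert (E2 : ((/ tau + Cconj p) / (/ tau - Cconj p) = (1 + Cconj p * tau) / (1 - Cconj p * tau))%C).
  { field. repeat split; assumption. }
  rewrite E2. field. repeat split; assumption.
Qed.

Lemma cayley_le (x s : C) : Cmod x = 1 -> Cmod s < 1 ->
  Cmod (cayley x s) <= (1 + Cmod s) / (1 - Cmod s).
Proof.
  intros Hx Hs. unfold cayley. rewrite Cmod_div by (apply Cmod_lt_neq; lra).
  pose proof (Cmod_triangle_rev x s). pose proof (Cmod_triangle x s). rewrite Hx in *.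
  apply Rmult_le_compat; [apply Cmod_ge_0|left; apply Rinv_0_lt_compat; lra|lra|].
  apply Rinv_le_contravar; lra.
Qed.

(** Up to sign, [ln (Re (cayley tau z))] is the Busemann function of [tau], hence 1-Lipschitz:
    [cayley_mob] moves [b] to 0, and the quotient becomes the real part of a half-plane coordinate
    of [mob b a]. *)
Lemma hyp_dist_ge_busemann (tau a b : C) : Cmod tau = 1 -> Cmod a < 1 -> Cmod b < 1 ->
  ln (Re (cayley tau a) / Re (cayley tau b)) <= hyp_dist a b.
Proof.
  intros Ht Ha Hb. pose proof (Re_cayley_pos tau a Ht Ha) as Pa.
  pose proof (Re_cayley_pos tau b Ht Hb) as Pb.
  pose proof (cayley_mob tau b a 1 Ht Cmod_1 Hb Ha) as E.
  assert (H1 : Re (cayley tau a) = Re (cayley tau b) * Re (cayley (1 * mob b tau) (1 * mob b a))).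
  { rewrite E at 1. simpl. ring. }
  unfold hyp_dist. apply ln_le_compat; [apply Rdiv_lt_0_compat; assumption|].
  rewrite H1. replace (Re (cayley tau b) * Re (cayley (1 * mob b tau) (1 * mob b a)) / Re (cayley tau b))
    with (Re (cayley (1 * mob b tau) (1 * mob b a))) by (field; lra).
  eapply Rle_trans; [apply Rle_abs|]. eapply Rle_trans; [apply re_le_Cmod|].
  rewrite !Cmult_1_l. apply cayley_le.
  - apply mob_circle; assumption.
  - apply mob_lt_1; assumption.
Qed.

Lemma cayley_plus_conj (sigma z w : C) : Cmod sigma = 1 -> Cmod z < 1 -> Cmod w < 1 ->
  (cayley sigma z + Cconj (cayley sigma w)
   = 2 * (1 - Cconj w * z) / ((sigma - z) * Cconj (sigma - w)))%C.
Proof.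
  intros Hs Hz Hw.
  pose proof (Cmod_lt_neq sigma z ltac:(lra)) as N1. pose proof (Cmod_lt_neq sigma w ltac:(lra)) as N2.
  assert (N3 : Cconj (sigma - w) <> 0%C).
  { apply Cmod_gt_0. rewrite Cmod_conj. apply Cmod_gt_0, N2. }
  unfold cayley. rewrite Cdiv_conj by exact N2.
  rewrite Cplus_conj. rewrite Cminus_conj in N3 |- *. rewrite <- (Cmod_1_conj sigma Hs).
  field. split; assumption.
Qed.

(** In half-plane coordinates [1 - rho ^ 2] is [4 * Re X * Re Y] over the square of
    [Cmod (X + Cconj Y)]. The sector conditions bound it below by [c * c * Cmod Y / Cmod X], and [(1
    + rho) / (1 - rho) = (1 + rho) ^ 2 / (1 - rho ^ 2)] accounts for the 4. *)
Lemma hyp_dist_le_cayley (sigma z w : C) (c : R) : Cmod sigma = 1 -> Cmod z < 1 -> Cmod w < 1 ->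
  0 < c -> c * Cmod (cayley sigma z) <= Re (cayley sigma z) ->
  c * Cmod (cayley sigma w) <= Re (cayley sigma w) ->
  Cmod (cayley sigma w) <= Cmod (cayley sigma z) -> 0 < Cmod (cayley sigma w) ->
  hyp_dist z w <= ln (4 * Cmod (cayley sigma z) / (c * c * Cmod (cayley sigma w))).
Proof.
  intros Hs Hz Hw Hc Cz Cw Hle Hpos.
  set (X := cayley sigma z) in *. set (Y := cayley sigma w) in *.
  pose proof (pseudo_lt_1 z w Hz Hw) as Hr1. pose proof (pseudo_ge_0 z w) as Hr0.
  assert (E : (1 - pseudo_hyp_dist z w ^ 2) * Cmod (X + Cconj Y)%C ^ 2 = 4 * Re X * Re Y).
  { pose proof (mob_defect w z Hw ltac:(lra)) as D.
    change (Cmod (mob w z)) with (pseudo_hyp_dist z w) in D. rewrite D.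
    unfold X, Y. rewrite cayley_plus_conj, !Re_cayley by assumption.
    pose proof (Cmod_lt_neq sigma z ltac:(lra)) as N1. pose proof (Cmod_lt_neq sigma w ltac:(lra)) as N2.
    assert (N3 : Cconj (sigma - w) <> 0%C).
    { apply Cmod_gt_0. rewrite Cmod_conj. apply Cmod_gt_0, N2. }
    pose proof (mob_den w z Hw ltac:(lra)) as N4.
    rewrite Cmod_div by (apply Cmult_neq_0; assumption). rewrite !Cmod_mult, Cmod_conj, Cmod_R.
    rewrite (Rabs_pos_eq 2) by lra.
    apply Cmod_gt_0 in N1, N2, N4. field. lra. }
  assert (Hsum : Cmod (X + Cconj Y)%C <= 2 * Cmod X).
  { eapply Rle_trans; [apply Cmod_triangle|]. rewrite Cmod_conj. lra. }
  pose proof (Cmod_ge_0 (X + Cconj Y)%C) as Hs0.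
  set (r := pseudo_hyp_dist z w) in *. unfold hyp_dist. fold r.
  apply ln_le_compat; [apply Rdiv_lt_0_compat; lra|].
  assert (Hlow : c * c * Cmod Y <= (1 - r ^ 2) * Cmod X).
  { apply Rmult_le_reg_r with (4 * Cmod X); [lra|].
    apply Rle_trans with (4 * Re X * Re Y).
    - replace (c * c * Cmod Y * (4 * Cmod X)) with (4 * (c * Cmod X * (c * Cmod Y))) by ring.
      assert (c * Cmod X * (c * Cmod Y) <= Re X * Re Y) by (apply Rmult_le_compat; nra). lra.
    - rewrite <- E. replace ((1 - r ^ 2) * Cmod X * (4 * Cmod X)) with ((1 - r ^ 2) * (2 * Cmod X) ^ 2) by ring.
      apply Rmult_le_compat_l; [nra|]. apply pow_incr. lra. }
  apply Rmult_le_reg_r with ((1 - r) * (c * c * Cmod Y)).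
  { apply Rmult_lt_0_compat; [lra|]. apply Rmult_lt_0_compat; nra. }
  replace ((1 + r) / (1 - r) * ((1 - r) * (c * c * Cmod Y))) with ((1 + r) * (c * c * Cmod Y))
    by (field; lra).
  replace (4 * Cmod X / (c * c * Cmod Y) * ((1 - r) * (c * c * Cmod Y))) with (4 * Cmod X * (1 - r))
    by (field; lra).
  apply Rle_trans with ((1 + r) * ((1 - r ^ 2) * Cmod X)).
  - apply Rmult_le_compat_l; lra.
  - replace ((1 + r) * ((1 - r ^ 2) * Cmod X)) with ((1 + r) ^ 2 * (Cmod X * (1 - r))) by ring.
    replace (4 * Cmod X * (1 - r)) with (4 * (Cmod X * (1 - r))) by ring.
    apply Rmult_le_compat_r; [nra|]. nra.
Qed.

(** A Lipschitz bound for [psi z - z] instead of a bound on its size: it survives division by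
    [Cmod (z - w)], so it controls distance ratios of pairs that are arbitrarily close. *)
Definition near_id (psi : C -> C) (k : R) : Prop :=
  forall z w, Cmod z < 1 -> Cmod w < 1 ->
    Cmod ((psi z - z) - (psi w - w))%C <= 4 * k * Cmod (z - w)%C / ((1 - Cmod z) * (1 - Cmod w)).

Lemma near_id_at (psi : C -> C) (k : R) (z : C) : near_id psi k -> psi 0%C = 0%C -> Cmod z < 1 ->
  Cmod (psi z - z)%C <= 4 * k * Cmod z / (1 - Cmod z).
Proof.
  intros H H0 Hz. specialize (H z 0%C Hz ltac:(rewrite Cmod_0; lra)).
  rewrite H0, Cmod_0 in H.
  replace (psi z - z - (0 - 0))%C with (psi z - z)%C in H by ring.
  replace (z - 0)%C with z in H by ring.
  replace ((1 - Cmod z) * (1 - 0)) with (1 - Cmod z) in H by ring. exact H.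
Qed.

(** With [t = k / (s * s)] the numerator of the pseudohyperbolic distance loses at most the factor
    [1 - 4 * t] and the denominator gains at most [1 + 8 * t]; the 12 comes from
    [(1 - 12 * t) * (1 + 8 * t) <= 1 - 4 * t]. *)
Lemma near_id_pseudo (psi : C -> C) (k s : R) (z w : C) : near_id psi k -> psi 0%C = 0%C ->
  disc_map psi -> 0 < k -> 0 < s -> Cmod z <= 1 - s -> Cmod w <= 1 - s ->
  (1 - 12 * k / (s * s)) * pseudo_hyp_dist z w <= pseudo_hyp_dist (psi z) (psi w).
Proof.
  intros H H0 Hpsi Hk Hs Hz Hw.
  pose proof (Cmod_ge_0 z) as Hz0.
  assert (Hss : 0 < s * s) by nra.
  set (t := k / (s * s)).
  assert (Ht : 0 < t) by (apply Rdiv_lt_0_compat; lra).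
  replace (12 * k / (s * s)) with (12 * t) by (unfold t; field; lra).
  pose proof (proj2 (Hpsi z ltac:(lra))) as Bz. pose proof (proj2 (Hpsi w ltac:(lra))) as Bw.
  assert (H1 : forall v, Cmod v <= 1 - s -> Cmod (psi v - v)%C <= 4 * t * s).
  { intros v Hv.
    eapply Rle_trans; [apply (near_id_at psi k v H H0); lra|].
    apply div_le; [lra|].
    apply Rle_trans with (4 * t * s * s); [|apply Rmult_le_compat_l; nra].
    replace (4 * t * s * s) with (4 * k) by (unfold t; field; lra). nra. }
  assert (H2 : Cmod (z - w)%C * (1 - 4 * t) <= Cmod (psi z - psi w)%C).
  { pose proof (H z w ltac:(lra) ltac:(lra)) as HH.
    assert (HB : 4 * k * Cmod (z - w)%C / ((1 - Cmod z) * (1 - Cmod w)) <= 4 * t * Cmod (z - w)%C).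
    { pose proof (Cmod_ge_0 (z - w)%C).
      replace (4 * t * Cmod (z - w)%C) with (4 * k * Cmod (z - w)%C / (s * s)) by (unfold t; field; lra).
      apply Rmult_le_compat_l; [nra|]. apply Rinv_le_contravar; [exact Hss|].
      apply Rmult_le_compat; lra. }
    pose proof (Cmod_triangle_rev (z - w) ((z - psi z) - (w - psi w))) as T.
    replace (z - w - (z - psi z - (w - psi w)))%C with (psi z - psi w)%C in T by ring.
    replace (z - psi z - (w - psi w))%C with (- (psi z - z - (psi w - w)))%C in T by ring.
    rewrite Cmod_opp in T. lra. }
  unfold pseudo_hyp_dist.
  pose proof (mob_den w z ltac:(lra) ltac:(lra)) as N1.
  pose proof (mob_den (psi w) (psi z) ltac:(lra) ltac:(lra)) as N2.
  rewrite !Cmod_div by assumption.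
  apply Cmod_gt_0 in N1, N2.
  pose proof (mob_den_ge w z) as D1.
  set (D := Cmod (1 - Cconj w * z)%C) in *. set (D' := Cmod (1 - Cconj (psi w) * psi z)%C) in *.
  assert (HD : s <= D) by nra.
  assert (HD' : D' <= D * (1 + 8 * t)).
  { assert (T : D' <= D + (Cmod (psi z - z)%C + Cmod (psi w - w)%C)).
    { unfold D', D.
      replace (1 - Cconj (psi w) * psi z)%C
        with ((1 - Cconj w * z) + (- (Cconj (psi w) * (psi z - z)) + - (Cconj (psi w - w) * z)))%C
        by (rewrite Cminus_conj; ring).
      eapply Rle_trans; [apply Cmod_triangle|]. apply Rplus_le_compat_l.
      eapply Rle_trans; [apply Cmod_triangle|]. rewrite !Cmod_opp, !Cmod_mult, !Cmod_conj.
      pose proof (Cmod_ge_0 (psi z - z)%C). pose proof (Cmod_ge_0 (psi w - w)%C). nra. }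
    pose proof (H1 z Hz). pose proof (H1 w Hw). nra. }
  pose proof (Cmod_ge_0 (z - w)%C) as Hd.
  set (d := Cmod (z - w)%C) in *. set (d' := Cmod (psi z - psi w)%C) in *.
  destruct (Rle_dec (1 - 12 * t) 0) as [Hneg|Hneg].
  - apply Rle_trans with 0.
    + assert (0 <= d / D) by (apply Rle_mult_inv_pos; lra). nra.
    + apply Rle_mult_inv_pos; [apply Cmod_ge_0|exact N2].
  - apply Rnot_le_lt in Hneg.
    apply Rmult_le_reg_r with (D * D'); [nra|].
    replace ((1 - 12 * t) * (d / D) * (D * D')) with ((1 - 12 * t) * d * D') by (field; lra).
    replace (d' / D' * (D * D')) with (d' * D) by (field; lra).
    apply Rle_trans with ((1 - 12 * t) * d * (D * (1 + 8 * t))).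
    + apply Rmult_le_compat_l; [nra|exact HD'].
    + replace ((1 - 12 * t) * d * (D * (1 + 8 * t))) with (d * ((1 - 12 * t) * (1 + 8 * t)) * D) by ring.
      apply Rmult_le_compat_r; [lra|]. eapply Rle_trans; [|exact H2].
      apply Rmult_le_compat_l; [exact Hd|]. nra.
Qed.

(** In the defect formula the numerator is at least [s * s] and the denominator at most 4; a further
    2 is lost in passing from [1 - rho ^ 2] to [1 - rho]. *)
Lemma pseudo_gap (z w : C) (s : R) : 0 < s -> Cmod z <= 1 - s -> Cmod w <= 1 - s ->
  s * s / 8 <= 1 - pseudo_hyp_dist z w.
Proof.
  intros Hs Hz Hw. pose proof (Cmod_ge_0 z). pose proof (Cmod_ge_0 w).
  pose proof (mob_defect w z ltac:(lra) ltac:(lra)) as D.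
  change (Cmod (mob w z)) with (pseudo_hyp_dist z w) in D.
  set (r := pseudo_hyp_dist z w) in *.
  pose proof (proj1 (Cmod_gt_0 _) (mob_den w z ltac:(lra) ltac:(lra))) as N.
  assert (T : Cmod (1 - Cconj w * z)%C <= 2).
  { eapply Rle_trans; [apply Cmod_triangle_minus|]. rewrite Cmod_1, Cmod_mult, Cmod_conj. nra. }
  set (q := Cmod (1 - Cconj w * z)%C) in *.
  assert (E : (1 - r ^ 2) * q ^ 2 = (1 - Cmod w ^ 2) * (1 - Cmod z ^ 2)).
  { rewrite D. field. lra. }
  assert (L : s * s <= (1 - Cmod w ^ 2) * (1 - Cmod z ^ 2)) by (apply Rmult_le_compat; nra).
  assert (q ^ 2 <= 4) by nra. assert (0 <= 1 - r ^ 2) by nra.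
  assert (s * s <= (1 - r ^ 2) * 4).
  { rewrite <- E in L. eapply Rle_trans; [exact L|]. apply Rmult_le_compat_l; assumption. }
  nra.
Qed.

Lemma Carg_scal (t : R) (z : C) : 0 < t -> Carg (RtoC t * z)%C = Carg z.
Proof.
  intros Ht. unfold Carg. rewrite re_scal_l, im_scal_l, Cmod_mult, Cmod_R, Rabs_pos_eq by lra.
  assert (E : t * Re z / (t * Cmod z) = Re z / Cmod z).
  { destruct (Req_dec (Cmod z) 0) as [E|E].
    - apply Cmod_eq_0 in E. subst z. simpl. unfold Rdiv. ring.
    - field. split; lra. }
  rewrite E.
  destruct (Rle_dec 0 (t * Im z)), (Rle_dec 0 (Im z)); try reflexivity; exfalso; nra.
Qed.

Lemma Carg_near_1 (e : R) : 0 < e -> exists d, 0 < d /\ forall z, Cmod (z - 1)%C <= d -> Rabs (Carg z) < e.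
Proof.
  intros He. destruct (common_pos e 1) as [e' [He' [Hee He1]]]; [lra..|]. pose proof PI2_3_2 as HPI.
  assert (Hc : cos e' < 1) by (rewrite <- cos_0; apply cos_decreasing_1; lra).
  pose proof (half_le_cos e' ltac:(rewrite Rabs_pos_eq; lra)) as Hc2.
  exists ((1 - cos e') / 4). split; [lra|]. intros z Hz.
  pose proof (Cmod_triangle_rev z 1) as T. rewrite Cmod_1 in T.
  pose proof (re_le_Cmod (z - 1)%C) as HR. change (Re (z - 1)%C) with (Re z - 1) in HR.
  assert (HR2 : Rabs (Re z - 1) <= (1 - cos e') / 4) by lra. apply Rabs_le_between in HR2.
  pose proof (re_le_Cmod z) as HZ. apply Rabs_le_between in HZ.
  assert (Ht : cos e' < Re z / Cmod z) by (apply lt_div; nra).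
  assert (Ht1 : Re z / Cmod z <= 1) by (apply div_le; lra).
  assert (EA : Rabs (Carg z) = acos (Re z / Cmod z)).
  { pose proof (acos_bound (Re z / Cmod z)). unfold Carg.
    destruct (Rle_dec 0 (Im z)); rewrite ?Rabs_Ropp; apply Rabs_pos_eq; lra. }
  rewrite EA. apply Rnot_le_lt. intros HH. pose proof (acos_bound (Re z / Cmod z)).
  pose proof (cos_decr_1 e' (acos (Re z / Cmod z)) ltac:(lra) ltac:(lra) ltac:(lra) ltac:(lra) ltac:(lra)) as D.
  rewrite cos_acos in D by lra. lra.
Qed.

(** * Disc automorphisms near a hyperbolic translation *)

Lemma cayley_inj (sigma z w : C) : Cmod sigma = 1 -> Cmod z < 1 -> Cmod w < 1 ->
  cayley sigma z = cayley sigma w -> z = w.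
Proof.
  intros Hs Hz Hw E. assert (Hs0 : sigma <> 0%C) by (apply Cmod_gt_0; lra).
  pose proof (Cmod_lt_neq sigma z ltac:(lra)) as N1. pose proof (Cmod_lt_neq sigma w ltac:(lra)) as N2.
  unfold cayley in E.
  apply Ceq_minus.
  assert (E2 : (2 * sigma * (z - w) = 0)%C).
  { replace (2 * sigma * (z - w))%C
      with (((sigma + z) / (sigma - z) - (sigma + w) / (sigma - w)) * ((sigma - z) * (sigma - w)))%C
      by (field; split; assumption).
    rewrite E. ring. }
  replace (z - w)%C with ((2 * sigma * (z - w)) * (/ (2 * sigma)))%C by (field; assumption).
  rewrite E2. ring.
Qed.

(** The rotation taking 1 to [sigma], followed by the hyperbolic translation along the diameter
    through [sigma] that takes 0 to [r sigma]. In half-plane coordinates it is a dilation. *)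
Definition axis_shift (sigma : C) (r : R) (z : C) : C := mob (- (RtoC r * sigma)) (sigma * z).

Lemma axis_point (sigma : C) (r : R) : Cmod sigma = 1 -> 0 <= r < 1 -> Cmod (RtoC r * sigma)%C = r.
Proof. intros Hs Hr. rewrite Cmod_mult, Hs, Cmod_R, Rabs_pos_eq; lra. Qed.

Lemma axis_shift_lt_1 (sigma : C) (r : R) (z : C) : Cmod sigma = 1 -> 0 <= r < 1 -> Cmod z < 1 ->
  Cmod (axis_shift sigma r z) < 1.
Proof.
  intros Hs Hr Hz. apply mob_lt_1.
  - rewrite Cmod_opp, axis_point; auto; lra.
  - rewrite Cmod_mult, Hs. lra.
Qed.

Lemma cayley_axis_shift (sigma : C) (r : R) (z : C) : Cmod sigma = 1 -> 0 <= r < 1 -> Cmod z < 1 ->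
  cayley sigma (axis_shift sigma r z) = (RtoC ((1 + r) / (1 - r)) * cayley 1 z)%C.
Proof.
  intros Hs Hr Hz. assert (Hs0 : sigma <> 0%C) by (apply Cmod_gt_0; lra).
  assert (N1 : (1 - z)%C <> 0%C) by (apply Cmod_lt_neq; rewrite Cmod_1; exact Hz).
  assert (N2 : (1 - RtoC r)%C <> 0%C).
  { apply Cmod_lt_neq. rewrite Cmod_1, Cmod_R, Rabs_pos_eq; lra. }
  assert (N3 : (1 + RtoC r * z)%C <> 0%C).
  { replace (1 + RtoC r * z)%C with (1 - (- (RtoC r * z)))%C by ring.
    apply Cmod_lt_neq. rewrite Cmod_1, Cmod_opp, Cmod_mult, Cmod_R, Rabs_pos_eq by lra.
     nra. }
  assert (E : axis_shift sigma r z = (sigma * ((z + RtoC r) / (1 + RtoC r * z)))%C).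
  { unfold axis_shift, mob. rewrite Copp_conj, Cmult_conj.
    rewrite Cconj_R.
    replace (1 - - (RtoC r * Cconj sigma) * (sigma * z))%C
      with (1 + RtoC r * ((sigma * Cconj sigma) * z))%C by ring.
    rewrite Cmod_1_conj, Cmult_1_l by exact Hs. field. exact N3. }
  rewrite E, RtoC_div, RtoC_plus, RtoC_minus by lra. unfold cayley.
  assert (N4 : (sigma - sigma * ((z + RtoC r) / (1 + RtoC r * z)))%C
     = (sigma * ((1 - z) * (1 - RtoC r)) / (1 + RtoC r * z))%C) by (field; exact N3).
  rewrite N4. field. repeat split; assumption.
Qed.

(** The parameter 1/2 makes the dilation factor [(1 + 1 / 2) / (1 - 1 / 2) = 3]. *)
Definition half_shift (w : C) : C := axis_shift 1 (1 / 2) w.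

Lemma half_shift_eq (w : C) : half_shift w = ((w + RtoC (1 / 2)) / (1 + RtoC (1 / 2) * w))%C.
Proof.
  unfold half_shift, axis_shift, mob. rewrite Copp_conj, Cmult_conj.
  rewrite !Cconj_R.
  f_equal; ring.
Qed.

Lemma half_den (w : C) : Cmod w <= 1 -> 1 / 2 <= Cmod (1 + RtoC (1 / 2) * w)%C.
Proof.
  intros Hw. pose proof (Cmod_triangle_rev 1 (- (RtoC (1 / 2) * w))) as T.
  replace (1 - - (RtoC (1 / 2) * w))%C with (1 + RtoC (1 / 2) * w)%C in T by ring.
  rewrite Cmod_1, Cmod_opp, Cmod_mult, Cmod_R, Rabs_pos_eq in T by lra. lra.
Qed.

(* [1 - T w = (1 - w) / (2 + w)] for the shift [T]; the domain lies in [Re w >= 0]. *)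
Lemma half_shift_contract (w : C) : Cmod w <= 1 -> Cmod (1 - w)%C <= 1 ->
  Cmod (1 - half_shift w)%C <= 1 / 2 * Cmod (1 - w)%C.
Proof.
  intros Hw H1. pose proof (half_den w Hw) as Hd.
  assert (N : (1 + RtoC (1 / 2) * w)%C <> 0%C) by (apply Cmod_gt_0; lra).
  assert (HD : 1 <= Cmod (1 + RtoC (1 / 2) * w)%C).
  { eapply Rle_trans; [|apply re_le_Cmod]. eapply Rle_trans; [|apply Rle_abs].
    pose proof (re_le_Cmod (1 - w)%C) as HR. destruct w as [x y]. simpl in *.
    apply Rle_trans with (r3 := 1) in HR; [|exact H1]. apply Rabs_le_between in HR. lra. }
  rewrite half_shift_eq.
  replace (1 - (w + RtoC (1 / 2)) / (1 + RtoC (1 / 2) * w))%C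
    with (RtoC (1 / 2) * (1 - w) / (1 + RtoC (1 / 2) * w))%C.
  - rewrite Cmod_div, Cmod_mult, Cmod_R, Rabs_pos_eq by (auto; lra).
    pose proof (Cmod_ge_0 (1 - w)%C).
    apply Rle_trans with (1 / 2 * Cmod (1 - w)%C / 1); [|right; field].
    apply Rmult_le_compat_l; [lra|]. apply Rinv_le_contravar; lra.
  - replace (1 - (w + RtoC (1 / 2)) / (1 + RtoC (1 / 2) * w))%C
      with (((1 - RtoC (1 / 2)) - (1 - RtoC (1 / 2)) * w) / (1 + RtoC (1 / 2) * w))%C by (field; exact N).
    replace (1 - RtoC (1 / 2))%C with (RtoC (1 / 2)) by (rewrite <- RtoC_minus; f_equal; field).
    unfold Cdiv. ring.
Qed.

Lemma Cmod_sum3 (a b c : C) : Cmod (a + b + c)%C <= Cmod a + Cmod b + Cmod c.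
Proof.
  eapply Rle_trans; [apply Cmod_triangle|]. apply Rplus_le_compat_r, Cmod_triangle.
Qed.

(* At [0] and [1/2] the shift [w -> (w + 1/2) / (1 + w/2)] takes the values [1/2] and [4/5]; a disc
   automorphism with almost the same values is almost the same map. *)
Lemma automorphism_near_half_shift (b v w1 e w : C) (k : R) : 0 < k <= 1 / 1000 -> Cmod v = 1 ->
  Cmod (w1 - RtoC (1 / 2))%C <= 4 * k -> Cmod (b - RtoC (1 / 2))%C <= 4 * k ->
  Cmod (e - RtoC (4 / 5))%C <= 16 * k ->
  (e * (1 + Cconj b * (v * w1)) = v * w1 + b)%C -> Cmod w <= 1 ->
  Cmod (mob (- b) (v * w) - half_shift w)%C <= 1590 * k.
Proof.
  intros Hk Hv Hw1 Hb He Heq Hw.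
  set (h := RtoC (1 / 2)) in *.
  assert (Hh : Cmod h = 1 / 2) by (unfold h; rewrite Cmod_R, Rabs_pos_eq; lra).
  assert (Hhc : Cconj h = h) by apply Cconj_R.
  pose proof (Cmod_triangle_rev b h) as Tb. rewrite Hh in Tb.
  assert (Hbc : Cmod (Cconj b - h)%C <= 4 * k).
  { rewrite <- Hhc, <- Cminus_conj, Cmod_conj. exact Hb. }
  assert (Heb : Cmod e <= 1).
  { pose proof (Cmod_triangle_rev e (RtoC (4 / 5))) as T.
    rewrite (Cmod_R (4 / 5)), Rabs_pos_eq in T by lra. lra. }
  (* The hypothesis reads [v * m = e - b] with [m = w1 * (1 - e * Cconj b)]. Both [v * m] and [m]
     are near [3 / 10], the first as [4 / 5 - 1 / 2], the second as [1 / 2 * (1 - 4 / 5 * 1 / 2)];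
     as [m] is not small, [v] is near 1. *)
  assert (K1 : Cmod (v * w1 * (1 - e * Cconj b) - RtoC (3 / 10))%C <= 20 * k).
  { replace (v * w1 * (1 - e * Cconj b))%C with (e - b)%C.
    - replace (e - b - RtoC (3 / 10))%C with ((e - RtoC (4 / 5)) - (b - h))%C.
      + eapply Rle_trans; [apply Cmod_triangle_minus|]. lra.
      + replace (RtoC (3 / 10)) with (RtoC (4 / 5) - h)%C; [ring|].
        unfold h. rewrite <- RtoC_minus. f_equal. field.
    - replace (v * w1 * (1 - e * Cconj b))%C with ((v * w1 + b) - b - e * (Cconj b * (v * w1)))%C by ring.
      rewrite <- Heq. ring. }
  assert (K2 : Cmod (w1 * (1 - e * Cconj b) - RtoC (3 / 10))%C <= 14 * k).
  { assert (E0 : RtoC (3 / 10) = (h * (1 - RtoC (4 / 5) * h))%C).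
    { unfold h. rewrite <- !RtoC_mult, <- RtoC_minus, <- RtoC_mult. f_equal. field. }
    rewrite E0.
    replace (w1 * (1 - e * Cconj b) - h * (1 - RtoC (4 / 5) * h))%C
      with ((w1 - h) * (1 - e * Cconj b) + - (h * (e * (Cconj b - h))) + - (h * ((e - RtoC (4 / 5)) * h)))%C
      by ring.
    eapply Rle_trans; [apply Cmod_sum3|].
    rewrite !Cmod_opp, !Cmod_mult, Hh.
    assert (A1 : Cmod (1 - e * Cconj b)%C <= 2).
    { eapply Rle_trans; [apply Cmod_triangle_minus|].
      rewrite Cmod_1, Cmod_mult, Cmod_conj. pose proof (Cmod_ge_0 e). nra. }
    assert (A2 : Cmod (w1 - h)%C * Cmod (1 - e * Cconj b)%C <= 4 * k * 2).
    { apply Rmult_le_compat; auto using Cmod_ge_0. }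
    assert (A3 : Cmod e * Cmod (Cconj b - h)%C <= 1 * (4 * k)).
    { apply Rmult_le_compat; auto using Cmod_ge_0. }
    lra. }
  assert (K3 : Cmod (v - 1)%C <= 136 * k).
  { set (m := (w1 * (1 - e * Cconj b))%C) in *.
    assert (M1 : 1 / 4 <= Cmod m).
    { pose proof (Cmod_triangle_rev (RtoC (3 / 10)) m) as T.
      rewrite Cmod_minus_sym, Cmod_R, Rabs_pos_eq in T by lra.
      assert (Cmod (m - RtoC (3 / 10))%C <= 14 * k) by exact K2. rewrite Cmod_minus_sym in H.
      rewrite (Cmod_minus_sym m) in T. lra. }
    assert (M2 : Cmod (v - 1)%C * Cmod m <= 34 * k).
    { rewrite <- Cmod_mult.
      replace ((v - 1) * m)%C with ((v * w1 * (1 - e * Cconj b) - RtoC (3 / 10)) - (m - RtoC (3 / 10)))%C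
        by (unfold m; ring).
      eapply Rle_trans; [apply Cmod_triangle_minus|]. lra. }
     nra. }
  rewrite half_shift_eq. fold h. unfold mob. rewrite Copp_conj.
  pose proof (half_den w Hw) as D1. fold h in D1.
  assert (D2 : 2 / 5 <= Cmod (1 - - Cconj b * (v * w))%C).
  { pose proof (Cmod_triangle_rev 1 (- Cconj b * (v * w))) as T.
    rewrite Cmod_1, !Cmod_mult, Cmod_opp, Cmod_conj, Hv in T.
    pose proof (Cmod_ge_0 w). nra. }
  assert (N1 : (1 + h * w)%C <> 0%C) by (apply Cmod_gt_0; lra).
  assert (N2 : (1 - - Cconj b * (v * w))%C <> 0%C) by (apply Cmod_gt_0; lra).
  replace ((v * w - - b) / (1 - - Cconj b * (v * w)) - (w + h) / (1 + h * w))%C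
    with (((((v - 1) * w + (b - h)) * (1 + h * w)) + (w + h) * (w * ((h - Cconj b) * v + h * (1 - v))))
      / ((1 - - Cconj b * (v * w)) * (1 + h * w)))%C.
  2: { field. split; [exact N1|].
       replace (1 + Cconj b * v * w)%C with (1 - - Cconj b * (v * w))%C by ring. exact N2. }
  rewrite Cmod_div by (apply Cmult_neq_0; assumption). rewrite Cmod_mult.
  (* Here [318 = (140 + 72) * 3 / 2]. The denominator is at least [1 / 2 * 2 / 5], whence
     [1590 = 5 * 318]. *)
  assert (Num : Cmod ((((v - 1) * w + (b - h)) * (1 + h * w))
      + (w + h) * (w * ((h - Cconj b) * v + h * (1 - v))))%C <= 318 * k).
  { eapply Rle_trans; [apply Cmod_triangle|]. rewrite !Cmod_mult.
    assert (B1 : Cmod ((v - 1) * w + (b - h))%C <= 140 * k).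
    { eapply Rle_trans; [apply Cmod_triangle|]. rewrite Cmod_mult.
      pose proof (Cmod_ge_0 (v - 1)%C). nra. }
    assert (B2 : Cmod (1 + h * w)%C <= 3 / 2).
    { eapply Rle_trans; [apply Cmod_triangle|]. rewrite Cmod_1, Cmod_mult, Hh. lra. }
    assert (B3 : Cmod (w + h)%C <= 3 / 2).
    { eapply Rle_trans; [apply Cmod_triangle|]. lra. }
    assert (B4 : Cmod ((h - Cconj b) * v + h * (1 - v))%C <= 72 * k).
    { eapply Rle_trans; [apply Cmod_triangle|]. rewrite !Cmod_mult, Hv, Hh.
      rewrite (Cmod_minus_sym h), (Cmod_minus_sym 1 v). lra. }
    assert (C1 : Cmod ((v - 1) * w + (b - h))%C * Cmod (1 + h * w)%C <= 140 * k * (3 / 2)).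
    { apply Rmult_le_compat; auto using Cmod_ge_0. }
    assert (C2 : Cmod w * Cmod ((h - Cconj b) * v + h * (1 - v))%C <= 1 * (72 * k)).
    { apply Rmult_le_compat; auto using Cmod_ge_0. }
    assert (C3 : Cmod (w + h)%C * (Cmod w * Cmod ((h - Cconj b) * v + h * (1 - v))%C) <= 3 / 2 * (1 * (72 * k))).
    { apply Rmult_le_compat; auto using Cmod_ge_0.
      apply Rmult_le_pos; apply Cmod_ge_0. }
    lra. }
  apply div_le; [nra|]. eapply Rle_trans; [exact Num|].
  assert (1 / 5 <= Cmod (1 - - Cconj b * (v * w))%C * Cmod (1 + h * w)%C) by nra. nra.
Qed.

Lemma mob_rot (s p w : C) : Cmod s = 1 -> mob (s * p) (s * w) = (s * mob p w)%C.
Proof.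
  intros Hs. unfold mob. rewrite Cmult_conj.
  replace (Cconj s * Cconj p * (s * w))%C with ((s * Cconj s) * (Cconj p * w))%C by ring.
  rewrite Cmod_1_conj, Cmult_1_l by exact Hs. unfold Cdiv. ring.
Qed.

(** Changing the centre from [p'] to [p] is a disc automorphism taking 0 to [mob p p'], hence a
    rotation followed by a single [mob]; the rotation is made explicit. *)
Lemma mob_change (p p' y : C) : Cmod p < 1 -> Cmod p' < 1 -> Cmod y <= 1 ->
  mob p y = mob (- mob p p') ((1 - p * Cconj p') / (1 - Cconj p * p') * mob p' y).
Proof.
  intros Hp Hp' Hy.
  pose proof (mob_den p p' Hp ltac:(lra)) as N1. pose proof (mob_den p y Hp Hy) as N2.
  pose proof (mob_den p' y Hp' Hy) as N3.
  assert (N4 : (1 - p * Cconj p')%C <> 0%C).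
  { replace (p * Cconj p')%C with (Cconj p' * p)%C by ring. apply mob_den; lra. }
  pose proof (Cmod_lt_1_conj p' Hp') as N5.
  assert (Ec : Cconj (mob p p') = ((Cconj p' - Cconj p) / (1 - p * Cconj p'))%C).
  { unfold mob. rewrite Cdiv_conj by exact N1. rewrite !Cminus_conj, Cmult_conj, Cconj_conj.
    rewrite Cconj_R. reflexivity. }
  unfold mob at 2. rewrite Copp_conj, Ec. unfold mob.
  assert (E : (1 - - ((Cconj p' - Cconj p) / (1 - p * Cconj p')) *
     ((1 - p * Cconj p') / (1 - Cconj p * p') * ((y - p') / (1 - Cconj p' * y))))%C
    = ((1 - Cconj p * y) * (1 - p' * Cconj p') / ((1 - Cconj p * p') * (1 - Cconj p' * y)))%C).
  { field. repeat split; assumption. }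
  rewrite E. field. repeat split; assumption.
Qed.

Lemma Cmod_change_factor (p p' : C) : Cmod p < 1 -> Cmod p' < 1 ->
  Cmod ((1 - p * Cconj p') / (1 - Cconj p * p'))%C = 1.
Proof.
  intros Hp Hp'. pose proof (mob_den p p' Hp ltac:(lra)) as N1.
  rewrite Cmod_div by exact N1.
  replace (1 - p * Cconj p')%C with (Cconj (1 - Cconj p * p'))
    by (apply injective_projections; simpl; ring).
  rewrite Cmod_conj. apply Cmod_gt_0 in N1. field. lra.
Qed.

Lemma pow3_unbounded (B : R) : exists N, forall n, (N <= n)%nat -> B < 3 ^ n.
Proof.
  destruct (Pow_x_infinity 3 ltac:(rewrite Rabs_pos_eq; lra) (B + 1)) as [N HN].
  exists N. intros n Hn. specialize (HN n Hn). rewrite Rabs_pos_eq in HN by (apply pow_le; lra). lra.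
Qed.

Lemma half_pow_small (e : R) : 0 < e -> exists N, forall n, (N <= n)%nat -> (1 / 2) ^ n < e.
Proof.
  intros He. destruct (pow_lt_1_zero (1 / 2) ltac:(rewrite Rabs_pos_eq; lra) e He) as [N HN].
  exists N. intros n Hn. specialize (HN n Hn). rewrite Rabs_pos_eq in HN by (apply pow_le; lra). lra.
Qed.

(** Bolzano-Weierstrass for the real parts, then for the imaginary parts along a subsequence on
    which the real parts already converge at the rate [/ (m + 1)]. *)
Lemma cluster_point (p : nat -> C) : (forall n, Cmod (p n) < 1) ->
  exists tau, Cmod tau <= 1 /\
    forall e N, 0 < e -> exists n, (N <= n)%nat /\ Cmod (p n - tau)%C < e.
Proof.
  intros Hp.
  assert (Hx : forall n, -1 <= Re (p n) <= 1).
  { intros n. apply Rabs_le_between. eapply Rle_trans; [apply re_le_Cmod|]. left; apply Hp. }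
  assert (Hy : forall n, -1 <= Im (p n) <= 1).
  { intros n. apply Rabs_le_between. eapply Rle_trans; [apply im_le_Cmod|]. left; apply Hp. }
  destruct (Bolzano_Weierstrass (fun n => Re (p n)) (fun x => -1 <= x <= 1) (compact_P3 (-1) 1) Hx)
    as [x Vx].
  assert (Hsub : forall m : nat, exists n, (m <= n)%nat /\ Rabs (Re (p n) - x) < / (INR m + 1)).
  { intros m. assert (Hpos : 0 < / (INR m + 1)).
    { apply Rinv_0_lt_compat. pose proof (pos_INR m). lra. }
    destruct (Vx (fun t => Rabs (t - x) < / (INR m + 1)) m) as [n [Hn1 Hn2]].
    - exists (mkposreal _ Hpos). intros t Ht. exact Ht.
    - exists n. split; assumption. }
  set (f := fun m => proj1_sig (constructive_indefinite_description _ (Hsub m))).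
  assert (Hf : forall m, (m <= f m)%nat /\ Rabs (Re (p (f m)) - x) < / (INR m + 1)).
  { intros m. unfold f. apply proj2_sig. }
  clearbody f.
  destruct (Bolzano_Weierstrass (fun m => Im (p (f m))) (fun x => -1 <= x <= 1) (compact_P3 (-1) 1)
    (fun m => Hy (f m))) as [y Vy].
  assert (Hcl : forall e N, 0 < e -> exists n, (N <= n)%nat /\ Cmod (p n - ((x, y) : C))%C < e).
  { intros e N He. destruct (archimed_cor1 (e / 2) ltac:(lra)) as [K [HK HK0]].
    destruct (Vy (fun t => Rabs (t - y) < e / 2) (Nat.max N K)) as [m [Hm1 Hm2]].
    - exists (mkposreal (e / 2) ltac:(lra)). intros t Ht. exact Ht.
    - destruct (Hf m) as [F1 F2]. exists (f m). split; [lia|].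
      assert (F3 : / (INR m + 1) <= / INR K).
      { apply Rinv_le_contravar; [apply lt_0_INR, HK0|].
        assert (INR K <= INR m) by (apply le_INR; lia). lra. }
      eapply Rle_lt_trans; [apply Cmod_le_Re_Im|].
      change (Re (p (f m) - ((x, y) : C))%C) with (Re (p (f m)) - x).
      change (Im (p (f m) - ((x, y) : C))%C) with (Im (p (f m)) - y). lra. }
  exists ((x, y) : C). split; [|exact Hcl].
  apply le_epsilon. intros e He. destruct (Hcl e 0%nat He) as [n [_ Hn]].
  pose proof (Cmod_triangle_rev ((x, y) : C) (p n)) as T. rewrite Cmod_minus_sym in T.
  specialize (Hp n). lra.
Qed.

(** * Moving frames along the radius *)

(* Radii with hyperbolic spacing ln 3, so that in the half-plane coordinate they are the points 3^n. *)
Definition rad (n : nat) : R := (3 ^ n - 1) / (3 ^ n + 1).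

Lemma pow3_ge_1 (n : nat) : 1 <= 3 ^ n.
Proof. apply pow_R1_Rle. lra. Qed.

Lemma rad_bounds (n : nat) : 0 <= rad n < 1.
Proof.
  pose proof (pow3_ge_1 n). unfold rad. split.
  - apply Rle_mult_inv_pos; lra.
  - apply div_lt; lra.
Qed.

Lemma rad_ratio (n : nat) : (1 + rad n) / (1 - rad n) = 3 ^ n.
Proof. pose proof (pow3_ge_1 n). unfold rad. field. lra. Qed.

Lemma rad_to_1 (d : R) : 0 < d -> exists N, forall n, (N <= n)%nat -> 1 - d < rad n.
Proof.
  intros Hd. destruct (pow3_unbounded (2 / d)) as [N HN]. exists N. intros n Hn.
  specialize (HN n Hn). pose proof (pow3_ge_1 n).
  assert (E : 1 - rad n = 2 / (3 ^ n + 1)) by (unfold rad; field; lra).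
  apply Rlt_div_l in HN; [|exact Hd].
  assert (2 / (3 ^ n + 1) < d) by (apply div_lt; nra).
  lra.
Qed.

(** Handles a contraction whose perturbations are small but never stop: after [m] steps they have
    contributed at most [e] in total, however large the starting value. *)
Lemma halving_limit (x : nat -> R) (e : R) : 0 < e -> (forall n, 0 <= x n) ->
  (exists N, forall n, (N <= n)%nat -> x (S n) <= (x n + e) / 2) ->
  exists N, forall n, (N <= n)%nat -> x n <= 2 * e.
Proof.
  intros He Hx [N HN].
  assert (H : forall m, x (N + m)%nat <= x N * (1 / 2) ^ m + e).
  { induction m as [|m IH].
    - rewrite Nat.add_0_r. simpl. lra.
    - rewrite Nat.add_succ_r. specialize (HN (N + m)%nat ltac:(lia)). simpl. lra. }
  pose proof (Hx N) as HxN.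
  destruct (half_pow_small (e / (x N + 1))) as [K HK]; [apply Rdiv_lt_0_compat; lra|].
  exists (N + K)%nat. intros n Hn. specialize (H (n - N)%nat).
  replace (N + (n - N))%nat with n in H by lia.
  specialize (HK (n - N)%nat ltac:(lia)).
  apply Rlt_div_r in HK; nra.
Qed.

Section Frames.

Variables (phi : C -> C) (sigma : C).
Hypothesis phi_holo : holomorphic_on_disc phi.
Hypothesis phi_maps : forall z : C, unit_disc z -> unit_disc (phi z).
Hypothesis sigma_bd : Cmod sigma = 1.
Hypothesis radial :
  filterlim (fun r : R => hyp_distortion phi (RtoC r * sigma)%C) (at_left 1) (locally 1).

Definition base (n : nat) : C := (RtoC (rad n) * sigma)%C.

Lemma base_lt_1 (n : nat) : Cmod (base n) < 1.
Proof. pose proof (rad_bounds n). unfold base. rewrite axis_point; lra. Qed.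

Lemma frames_exist : exists u : nat -> C, forall n, Cmod (u n) = 1 /\ exists h : C -> C,
  h 0%C = RtoC (hyp_distortion phi (base n)) /\ ccont h 0 /\
  forall w, (normalized phi sigma (base n) (u n) w = h w * w)%C.
Proof.
  exists (fun n => proj1_sig (constructive_indefinite_description _
    (normalized_exists phi phi_holo phi_maps sigma (base n) sigma_bd (base_lt_1 n)))).
  intros n. apply proj2_sig.
Qed.

Variable u : nat -> C.
Hypothesis u_frame : forall n, Cmod (u n) = 1 /\ exists h : C -> C,
  h 0%C = RtoC (hyp_distortion phi (base n)) /\ ccont h 0 /\
  forall w, (normalized phi sigma (base n) (u n) w = h w * w)%C.

Definition psi (n : nat) : C -> C := normalized phi sigma (base n) (u n).
Definition img (n : nat) : C := phi (base n).
(** Isometric coordinate on the image side, centred at [img n] and rotated by the normalizing unit.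
    It extends to the closed disc, so boundary points have coordinates too; [shift n] is the
    parametrization on the source side. *)
Definition frame (n : nat) (y : C) : C := (Cconj (u n) * mob (img n) y)%C.
Definition shift (n : nat) (z : C) : C := axis_shift sigma (rad n) z.

Lemma u_unit (n : nat) : Cmod (u n) = 1.
Proof. apply u_frame. Qed.

Lemma img_lt_1 (n : nat) : Cmod (img n) < 1.
Proof. apply phi_maps, base_lt_1. Qed.

Lemma psi_eq (n : nat) (z : C) : psi n z = frame n (phi (shift n z)).
Proof. reflexivity. Qed.

Lemma psi_disc (n : nat) : disc_map (psi n).
Proof.
  apply disc_map_normalized; auto; [apply base_lt_1|apply u_unit].
Qed.

Lemma psi_0 (n : nat) : psi n 0%C = 0%C.
Proof. apply normalized_0. Qed.

Lemma shift_lt_1 (n : nat) (z : C) : Cmod z < 1 -> Cmod (shift n z) < 1.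
Proof. apply axis_shift_lt_1; [exact sigma_bd|apply rad_bounds]. Qed.

Lemma cayley_shift (n : nat) (z : C) : Cmod z < 1 ->
  cayley sigma (shift n z) = (RtoC (3 ^ n) * cayley 1 z)%C.
Proof.
  intros Hz. unfold shift. rewrite cayley_axis_shift by (auto using rad_bounds).
  rewrite rad_ratio. reflexivity.
Qed.

Lemma half_shift_lt_1 (z : C) : Cmod z < 1 -> Cmod (half_shift z) < 1.
Proof. apply axis_shift_lt_1; [apply Cmod_1|lra]. Qed.

(** On the source side the change of frame is the same map for every [n], which is what the image
    side is compared with; in half-plane coordinates it is [3 ^ (n + 1) = 3 ^ n * 3]. *)
Lemma shift_step (n : nat) (z : C) : Cmod z < 1 -> shift (S n) z = shift n (half_shift z).
Proof.
  intros Hz. apply (cayley_inj sigma); auto using shift_lt_1, half_shift_lt_1.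
  rewrite !cayley_shift by auto using half_shift_lt_1.
  unfold half_shift. rewrite cayley_axis_shift by (auto using Cmod_1; lra).
  replace ((1 + 1 / 2) / (1 - 1 / 2)) with 3 by field.
  rewrite Cmult_assoc, <- RtoC_mult. do 2 f_equal. simpl. ring.
Qed.

Lemma shift_0 (n : nat) : shift n 0%C = base n.
Proof. unfold shift, axis_shift. rewrite Cmult_0_r, mob_0. unfold base. ring. Qed.

Lemma frame_img (n : nat) : frame n (img n) = 0%C.
Proof. unfold frame. rewrite mob_self. ring. Qed.

Lemma frame_le_1 (n : nat) (y : C) : Cmod y <= 1 -> Cmod (frame n y) <= 1.
Proof.
  intros Hy. unfold frame. rewrite Cmod_mult, Cmod_conj, u_unit, Rmult_1_l.
  apply mob_le_1; [apply img_lt_1|exact Hy].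
Qed.

(** A distortion above [1 - k * k / 4] gives [2 * (1 - d) < k * k], as [schwarz_rigidity] requires.
    The radial limit enters the study of frames only here. *)
Lemma psi_near_id (k : R) : 0 < k -> exists N, forall n, (N <= n)%nat -> near_id (psi n) k.
Proof.
  intros Hk. destruct (proj1 (at_left_lim_eps _ _) radial (k * k / 4)) as [d [Hd H]]; [nra|].
  destruct (rad_to_1 d Hd) as [N HN]. exists N. intros n Hn.
  pose proof (rad_bounds n) as Hr. specialize (H (rad n) ltac:(specialize (HN n Hn); lra)).
  destruct (u_frame n) as [_ [h [Hh [Hc He]]]].
  apply Rabs_lt_between' in H.
  pose proof (hyp_distortion_le_1 phi phi_holo phi_maps (base n) (base_lt_1 n)) as H1.
  pose proof (hyp_distortion_ge_0 phi phi_holo phi_maps (base n) (base_lt_1 n)) as H0.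
  intros z w Hz Hw.
  apply (schwarz_rigidity (psi n) h (psi_disc n) Hc He (hyp_distortion phi (base n)) k z w); auto.
  change (RtoC (rad n) * sigma)%C with (base n) in H. nra.
Qed.

Lemma psi_close (e s : R) : 0 < e -> 0 < s -> exists N, forall n z, (N <= n)%nat ->
  Cmod z <= 1 - s -> Cmod (psi n z - z)%C <= e.
Proof.
  intros He Hs. destruct (psi_near_id (e * s / 4)) as [N HN]; [nra|].
  exists N. intros n z Hn Hz.
  eapply Rle_trans; [apply (near_id_at (psi n) (e * s / 4) z (HN n Hn) (psi_0 n)); lra|].
  apply div_le; [lra|].
  assert (e * s * Cmod z <= e * s * 1) by (apply Rmult_le_compat_l; nra). nra.
Qed.

(** Closeness of [psi] to the identity holds only on compact sets, but the change of image frames is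
    an automorphism. It is determined by its behaviour at two interior points, and so the comparison
    extends to the closed disc, where [tau] will lie. *)
Lemma transition (n : nat) (k : R) (y : C) : 0 < k <= 1 / 1000 ->
  near_id (psi n) k -> near_id (psi (S n)) k -> Cmod y <= 1 ->
  Cmod (frame n y - half_shift (frame (S n) y))%C <= 1590 * k.
Proof.
  intros Hk H1 H2 Hy.
  set (p := img n). set (p' := img (S n)).
  pose proof (img_lt_1 n) as Hp. pose proof (img_lt_1 (S n)) as Hp'. fold p in Hp. fold p' in Hp'.
  pose proof (u_unit n) as Hu. pose proof (u_unit (S n)) as Hu'.
  set (c := ((1 - p * Cconj p') / (1 - Cconj p * p'))%C).
  assert (Hc : Cmod c = 1) by (apply Cmod_change_factor; assumption).
  set (v := (Cconj (u n) * (c * u (S n)))%C).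
  assert (Hv : Cmod v = 1).
  { unfold v. rewrite !Cmod_mult, Cmod_conj, Hu, Hu', Hc. ring. }
  assert (HB : forall y, Cmod y <= 1 -> frame n y = mob (- frame n p') (v * frame (S n) y)).
  { intros y0 Hy0. unfold frame. fold p p'. rewrite (mob_change p p' y0) by assumption. fold c.
    rewrite <- mob_rot by (rewrite Cmod_conj; exact Hu). f_equal.
    - ring.
    - unfold v. replace (Cconj (u n) * (c * u (S n)) * (Cconj (u (S n)) * mob p' y0))%C
        with (Cconj (u n) * (c * ((u (S n) * Cconj (u (S n))) * mob p' y0)))%C by ring.
      rewrite Cmod_1_conj by exact Hu'. ring. }
  assert (Hhalf : Cmod (RtoC (1 / 2)) = 1 / 2) by (rewrite Cmod_R, Rabs_pos_eq; lra).
  assert (Hhh : half_shift (RtoC (1 / 2)) = RtoC (4 / 5)).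
  { rewrite half_shift_eq. rewrite <- RtoC_mult, <- !RtoC_plus, <- RtoC_div by lra. f_equal. field. }
  assert (Hh0 : half_shift 0 = RtoC (1 / 2)).
  { rewrite half_shift_eq. replace (1 + RtoC (1 / 2) * 0)%C with (RtoC 1) by ring. field. }
  (* These are the coordinates of one image point in two frames: [half_shift] takes 1/2 to 4/5. The
     errors of [near_id_at] are [4 * k] at 1/2 and [16 * k] at 4/5. *)
  set (w1 := psi (S n) (RtoC (1 / 2))). set (e := psi n (RtoC (4 / 5))).
  assert (Hb : frame n p' = psi n (RtoC (1 / 2))).
  { rewrite psi_eq, <- Hh0, <- shift_step, shift_0 by (rewrite Cmod_0; lra). reflexivity. }
  assert (Hshift : shift (S n) (RtoC (1 / 2)) = shift n (RtoC (4 / 5))).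
  { rewrite shift_step by lra. rewrite Hhh. reflexivity. }
  assert (He : e = mob (- frame n p') (v * w1)).
  { unfold e, w1. rewrite (psi_eq n), (psi_eq (S n)), Hshift. apply HB.
    left. apply phi_maps. unfold unit_disc. apply shift_lt_1. rewrite Cmod_R, Rabs_pos_eq; lra. }
  rewrite HB by exact Hy.
  assert (Hw1d : Cmod w1 < 1) by (apply psi_disc; lra).
  assert (Hbd : Cmod (frame n p') < 1) by (rewrite Hb; apply psi_disc; lra).
  apply (automorphism_near_half_shift (frame n p') v w1 e); auto.
  - eapply Rle_trans; [apply (near_id_at (psi (S n)) k); auto; [apply psi_0|lra]|].
    rewrite Hhalf. right. field.
  - rewrite Hb. eapply Rle_trans; [apply (near_id_at (psi n) k); auto; [apply psi_0|lra]|].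
    rewrite Hhalf. right. field.
  - assert (H45 : Cmod (RtoC (4 / 5)) = 4 / 5) by (rewrite Cmod_R, Rabs_pos_eq; lra).
    eapply Rle_trans; [apply (near_id_at (psi n) k); auto; [apply psi_0|lra]|].
    rewrite H45. right. field.
  - rewrite He. unfold mob. rewrite Copp_conj.
    assert (N : (1 - - Cconj (frame n p') * (v * w1))%C <> 0%C).
    { rewrite <- Copp_conj. apply mob_den; [rewrite Cmod_opp; exact Hbd|].
      rewrite Cmod_mult, Hv. lra. }
    replace (1 + Cconj (frame n p') * (v * w1))%C with (1 - - Cconj (frame n p') * (v * w1))%C by ring.
    field. replace (1 + Cconj (frame n p') * v * w1)%C with (1 - - Cconj (frame n p') * (v * w1))%C by ring.
    exact N.
  - apply frame_le_1, Hy.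
Qed.

(** The frame moves backwards while the point stays fixed. In its own frame the point is at 0, at
    distance 1 from the attracting point; each earlier frame halves that distance and adds at most
    [e]. The bound by 1 is carried along because [half_shift_contract] needs it. *)
Lemma forward_images (e : R) : 0 < e <= 1 / 2 -> exists N, forall n m, (N <= n)%nat ->
  Cmod (1 - frame n (img (n + m)))%C <= (1 / 2) ^ m + 2 * e.
Proof.
  intros He. destruct (common_pos (1 / 1000) (e / 1590)) as [k [Hk [Hk1 Hk2]]]; [lra..|].
  destruct (psi_near_id k Hk) as [N HN]. exists N.
  assert (H : forall m n, (N <= n)%nat -> Cmod (1 - frame n (img (n + m)))%C <= 1 /\
     Cmod (1 - frame n (img (n + m)))%C <= (1 / 2) ^ m + 2 * e).
  { induction m as [|m IH]; intros n Hn.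
    - rewrite Nat.add_0_r, frame_img. replace (1 - 0)%C with (RtoC 1) by ring.
      rewrite Cmod_1. simpl. lra.
    - destruct (IH (S n) ltac:(lia)) as [I1 I2].
      replace (S n + m)%nat with (n + S m)%nat in I1, I2 by lia.
      set (y := img (n + S m)) in *.
      assert (Hy : Cmod y <= 1) by (left; apply img_lt_1).
      pose proof (transition n k y ltac:(lra) (HN n Hn) (HN (S n) ltac:(lia)) Hy) as T.
      pose proof (half_shift_contract (frame (S n) y) (frame_le_1 (S n) y Hy) I1) as Hc.
      pose proof (Cmod_triangle_via 1 (half_shift (frame (S n) y)) (frame n y)) as V.
      rewrite (Cmod_minus_sym (half_shift (frame (S n) y))) in V.
      simpl. split; lra. }
  intros n m Hn. apply H, Hn.
Qed.

(** [tau] is any cluster point of the images. For a fixed [n] the map [frame n] is continuous at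
    [tau], so the bound for [img m] with [m] large passes to [tau], uniformly in [n]. *)
Lemma boundary_point : exists tau, Cmod tau = 1 /\
  forall e, 0 < e -> exists N, forall n, (N <= n)%nat -> Cmod (1 - frame n tau)%C <= e.
Proof.
  destruct (cluster_point img img_lt_1) as [tau [Ht Hcl]].
  assert (Hlim : forall e, 0 < e -> exists N, forall n, (N <= n)%nat -> Cmod (1 - frame n tau)%C <= e).
  { intros e He. destruct (common_pos (1 / 2) (e / 4)) as [e' [He' [He1 He2]]]; [lra..|].
    destruct (forward_images e' ltac:(lra)) as [N HN]. exists N. intros n Hn.
    assert (Hcf : ccont (frame n) tau).
    { apply ccont_mult; [apply ccont_const|]. apply ccont_div.
      - apply ccont_minus; [apply ccont_id|apply ccont_const].
      - apply ccont_minus; [apply ccont_const|]. apply ccont_mult; [apply ccont_const|apply ccont_id].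
      - apply mob_den; [apply img_lt_1|exact Ht]. }
    destruct (Hcf (e / 4) ltac:(lra)) as [d [Hd Hc]].
    destruct (half_pow_small (e / 4) ltac:(lra)) as [K HK].
    destruct (Hcl d (n + K)%nat Hd) as [m [Hm1 Hm2]].
    specialize (Hc _ Hm2). specialize (HN n (m - n)%nat Hn). specialize (HK (m - n)%nat ltac:(lia)).
    replace (n + (m - n))%nat with m in HN by lia.
    pose proof (Cmod_triangle_via 1 (frame n (img m)) (frame n tau)) as V. lra. }
  exists tau. split; [|exact Hlim].
  apply Rle_antisym; [exact Ht|]. apply Rnot_lt_le. intros Hlt.
  (* An interior [tau] would be close to [img n] for arbitrarily large [n], so its coordinate in
     those frames would be close to the centre 0 and not to 1. *)
  destruct (Hlim (1 / 4) ltac:(lra)) as [N HN].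
  destruct (Hcl ((1 - Cmod tau) / 4) N ltac:(lra)) as [n [Hn1 Hn2]].
  specialize (HN n Hn1). pose proof (img_lt_1 n) as Hp.
  assert (Hf : Cmod (frame n tau) <= 1 / 4).
  { unfold frame. rewrite Cmod_mult, Cmod_conj, u_unit, Rmult_1_l. unfold mob.
    pose proof (mob_den (img n) tau Hp Ht) as N1. rewrite Cmod_div by exact N1.
    apply Cmod_gt_0 in N1. pose proof (mob_den_ge (img n) tau) as D.
    rewrite Cmod_minus_sym in Hn2.
    apply div_le; [exact N1|].
    pose proof (Cmod_ge_0 tau).
    assert (Cmod (img n) * Cmod tau <= 1 * Cmod tau) by (apply Rmult_le_compat_r; lra). lra. }
  pose proof (Cmod_triangle_rev 1 (frame n tau)) as T. rewrite Cmod_1 in T. lra.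
Qed.

(** * Heights and slopes of the image points *)

Variable tau : C.
Hypothesis tau_bd : Cmod tau = 1.
Hypothesis tau_lim : forall e, 0 < e -> exists N, forall n, (N <= n)%nat -> Cmod (1 - frame n tau)%C <= e.

(** Together with [slope] it writes the half-plane coordinate of [img n] as
    [height n * (1 + i * slope n)]. A slope tending to 0 means that the images lie asymptotically on
    the axis of [tau]. *)
Definition height (n : nat) : R := Re (cayley tau (img n)).
Definition slope (n : nat) : R := Im (cayley tau (img n)) / height n.

Lemma height_pos (n : nat) : 0 < height n.
Proof. apply Re_cayley_pos; [exact tau_bd|apply img_lt_1]. Qed.

Lemma cayley_frame (n : nat) (y : C) : Cmod y < 1 ->
  cayley tau y = (RtoC (height n) * (cayley (frame n tau) (frame n y) + Ci * RtoC (slope n)))%C.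
Proof.
  intros Hy. pose proof (height_pos n) as Hh.
  rewrite (cayley_mob tau (img n) y (Cconj (u n))); auto using img_lt_1.
  2: { rewrite Cmod_conj. apply u_unit. }
  fold (height n). fold (frame n tau). fold (frame n y).
  replace (Im (cayley tau (img n))) with (height n * slope n) by (unfold slope; field; lra).
  rewrite RtoC_mult. ring.
Qed.

Lemma cayley_close (e s : R) : 0 < e -> 0 < s -> exists N, forall n z, (N <= n)%nat ->
  Cmod z <= 1 - s -> Cmod (cayley (frame n tau) (psi n z) - cayley 1 z)%C <= e.
Proof.
  intros He Hs. destruct (common_pos (s / 4) (e * (s * s) / 8)) as [d [Hd [Hd1 Hd2]]];
    [lra|assert (0 < s * s) by nra; nra|].
  destruct (tau_lim d Hd) as [N1 H1]. destruct (psi_close d s Hd Hs) as [N2 H2].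
  exists (Nat.max N1 N2). intros n z Hn Hz.
  specialize (H1 n ltac:(lia)). specialize (H2 n z ltac:(lia) Hz).
  pose proof (Cmod_ge_0 z) as Hz0.
   set (x := frame n tau) in *. set (w := psi n z) in *.
  pose proof (Cmod_triangle_rev 1 z) as T1. rewrite Cmod_1 in T1.
  assert (D2 : s / 2 <= Cmod (x - w)%C).
  { pose proof (Cmod_triangle_rev (1 - z) ((1 - x) + (w - z))) as T2.
    replace (1 - z - (1 - x + (w - z)))%C with (x - w)%C in T2 by ring.
    pose proof (Cmod_triangle (1 - x) (w - z)). lra. }
  assert (N3 : (x - w)%C <> 0%C) by (apply Cmod_gt_0; lra).
  assert (N4 : (1 - z)%C <> 0%C) by (apply Cmod_gt_0; lra).
  unfold cayley.
  replace ((x + w) / (x - w) - (1 + z) / (1 - z))%C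
    with (2 * ((w - z) + z * (1 - x)) / ((x - w) * (1 - z)))%C by (field; split; assumption).
  rewrite Cmod_div by (apply Cmult_neq_0; assumption). rewrite !Cmod_mult, Cmod_R, Rabs_pos_eq by lra.
  assert (Hn1 : Cmod (w - z + z * (1 - x))%C <= 2 * d).
  { eapply Rle_trans; [apply Cmod_triangle|]. rewrite Cmod_mult.
     nra. }
  assert (Hden : s * s / 2 <= Cmod (x - w)%C * Cmod (1 - z)%C).
  { replace (s * s / 2) with (s / 2 * s) by field. apply Rmult_le_compat; lra. }
  apply div_le; [nra|].
  apply Rle_trans with (e * (s * s / 2)); [lra|]. apply Rmult_le_compat_l; lra.
Qed.

(** The coordinate of [img (S n)] in the half-plane based at frame [n]; for the exact shift it would
    be [cayley 1 (1 / 2) = 3]. *)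
Definition step_factor (n : nat) : C := cayley (frame n tau) (psi n (RtoC (1 / 2))).

Lemma img_succ (n : nat) : img (S n) = phi (shift n (RtoC (1 / 2))).
Proof.
  unfold img. rewrite <- shift_0, shift_step by (rewrite Cmod_0; lra). do 2 f_equal.
  rewrite half_shift_eq. replace (1 + RtoC (1 / 2) * 0)%C with (RtoC 1) by ring. field.
Qed.

Lemma step_factor_lim (e : R) : 0 < e -> exists N, forall n, (N <= n)%nat ->
  3 - e <= Re (step_factor n) /\ Rabs (Im (step_factor n)) <= e.
Proof.
  intros He. destruct (cayley_close e (1 / 2) He ltac:(lra)) as [N HN]. exists N. intros n Hn.
  specialize (HN n (RtoC (1 / 2)) Hn ltac:(rewrite Cmod_R, Rabs_pos_eq; lra)).
  fold (step_factor n) in HN.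
  assert (E : cayley 1 (RtoC (1 / 2)) = RtoC 3).
  { unfold cayley. rewrite <- RtoC_plus, <- RtoC_minus, <- RtoC_div by lra. f_equal. field. }
  rewrite E in HN.
  pose proof (re_le_Cmod (step_factor n - RtoC 3)%C) as HR.
  pose proof (im_le_Cmod (step_factor n - RtoC 3)%C) as HI.
  change (Re (step_factor n - RtoC 3)%C) with (Re (step_factor n) - 3) in HR.
  change (Im (step_factor n - RtoC 3)%C) with (Im (step_factor n) + - 0) in HI.
  rewrite Ropp_0, Rplus_0_r in HI. split; [|lra].
  assert (Hx : Rabs (Re (step_factor n) - 3) <= e) by lra. apply Rabs_le_between in Hx. lra.
Qed.

Lemma height_succ (n : nat) : height (S n) = height n * Re (step_factor n).
Proof.
  unfold height at 1. rewrite img_succ, (cayley_frame n).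
  - rewrite <- psi_eq. fold (step_factor n). rewrite re_scal_l. f_equal.
    destruct (step_factor n). simpl. ring.
  - apply phi_maps, shift_lt_1. rewrite Cmod_R, Rabs_pos_eq; lra.
Qed.

Lemma Im_succ (n : nat) :
  Im (cayley tau (img (S n))) = height n * (Im (step_factor n) + slope n).
Proof.
  rewrite img_succ, (cayley_frame n).
  - rewrite <- psi_eq. fold (step_factor n). rewrite im_scal_l. f_equal.
    destruct (step_factor n). simpl. ring.
  - apply phi_maps, shift_lt_1. rewrite Cmod_R, Rabs_pos_eq; lra.
Qed.

(** [slope (S n)] is [(Im F + slope n) / Re F] with [F = step_factor n] near 3. A denominator of at
    least 2 already halves the old slope, and [halving_limit] absorbs the small terms [Im F]. *)
Lemma slope_lim (e : R) : 0 < e -> exists N, forall n, (N <= n)%nat -> Rabs (slope n) <= e.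
Proof.
  intros He. destruct (halving_limit (fun n => Rabs (slope n)) (e / 2) ltac:(lra)) as [N HN].
  - intros n. apply Rabs_pos.
  - destruct (common_pos 1 (e / 2)) as [k [Hk [Hk1 Hk2]]]; [lra..|].
    destruct (step_factor_lim k Hk) as [N HN]. exists N. intros n Hn.
    destruct (HN n Hn) as [S1 S2]. pose proof (height_pos n).
    assert (E : slope (S n) = (Im (step_factor n) + slope n) / Re (step_factor n)).
    { unfold slope at 1. rewrite height_succ, Im_succ. field. lra. }
    rewrite E. unfold Rdiv at 1. rewrite Rabs_mult, Rabs_inv, (Rabs_pos_eq (Re (step_factor n))) by lra.
    apply Rmult_le_compat; [apply Rabs_pos|left; apply Rinv_0_lt_compat; lra| |].
    + eapply Rle_trans; [apply Rabs_triang|]. lra.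
    + apply Rinv_le_contravar; lra.
  - exists N. intros n Hn. specialize (HN n Hn). cbv beta in HN. lra.
Qed.

(** The ratios tend to 3 without a rate, so only growth like [q ^ m] for each [q < 3] can be
    claimed. *)
Lemma height_growth (q : R) : 0 < q < 3 -> exists N, forall n m, (N <= n)%nat ->
  height n * q ^ m <= height (n + m).
Proof.
  intros Hq. destruct (step_factor_lim (3 - q) ltac:(lra)) as [N HN]. exists N.
  intros n m Hn. induction m as [|m IH].
  - rewrite Nat.add_0_r. simpl. lra.
  - rewrite Nat.add_succ_r, height_succ. destruct (HN (n + m)%nat ltac:(lia)) as [S1 _].
    pose proof (height_pos (n + m)). cbn [pow].
    apply Rle_trans with (height (n + m) * q).
    + replace (height n * (q * q ^ m)) with (height n * q ^ m * q) by ring.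
      apply Rmult_le_compat_r; lra.
    + apply Rmult_le_compat_l; lra.
Qed.

Lemma height_unbounded (B : R) : exists N, forall n, (N <= n)%nat -> B < height n.
Proof.
  destruct (height_growth 2 ltac:(lra)) as [N HN].
  pose proof (height_pos N) as Hh.
  destruct (Pow_x_infinity 2 ltac:(rewrite Rabs_pos_eq; lra) (B / height N + 1)) as [K HK].
  exists (N + K)%nat. intros n Hn.
  specialize (HN N (n - N)%nat ltac:(lia)). replace (N + (n - N))%nat with n in HN by lia.
  specialize (HK (n - N)%nat ltac:(lia)). rewrite Rabs_pos_eq in HK by (apply pow_le; lra).
  apply Rge_le in HK. apply Rmult_le_compat_l with (r := height N) in HK; [|lra].
  replace (height N * (B / height N + 1)) with (B + height N) in HK by (field; lra). lra.
Qed.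

(** Since the source coordinate of [shift n z] is [3 ^ n * cayley 1 z], this says that near scale
    [n] the map [phi] is multiplication by [height n / 3 ^ n], up to a small relative error on
    compact sets of the frame. *)
Lemma cayley_asymptotics (e s : R) : 0 < e -> 0 < s -> exists N, forall n z, (N <= n)%nat ->
  Cmod z <= 1 - s -> exists err, Cmod err <= e /\
    cayley tau (phi (shift n z)) = (RtoC (height n) * (cayley 1 z + err))%C.
Proof.
  intros He Hs. destruct (cayley_close (e / 2) s ltac:(lra) Hs) as [N1 H1].
  destruct (slope_lim (e / 2) ltac:(lra)) as [N2 H2].
  exists (Nat.max N1 N2). intros n z Hn Hz.
  specialize (H1 n z ltac:(lia) Hz). specialize (H2 n ltac:(lia)).
  exists (cayley (frame n tau) (psi n z) - cayley 1 z + Ci * RtoC (slope n))%C. split.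
  - eapply Rle_trans; [apply Cmod_triangle|]. rewrite Cmod_mult, Cmod_Ci, Cmod_R. lra.
  - rewrite (cayley_frame n), psi_eq.
    + f_equal. ring.
    + apply phi_maps, shift_lt_1. lra.
Qed.

(** * Stolz regions in frame coordinates and weak conformality *)

Lemma frame_coordinate (n : nat) (z : C) : Cmod z < 1 ->
  exists w, w = (Cconj sigma * mob (base n) z)%C /\ Cmod w < 1 /\ shift n w = z.
Proof.
  intros Hz. eexists. split; [reflexivity|]. split.
  - rewrite Cmod_mult, Cmod_conj, sigma_bd, Rmult_1_l. apply mob_lt_1; [apply base_lt_1|exact Hz].
  - unfold shift, axis_shift. fold (base n).
    replace (sigma * (Cconj sigma * mob (base n) z))%C with ((sigma * Cconj sigma) * mob (base n) z)%C
      by ring.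
    rewrite Cmod_1_conj, Cmult_1_l by exact sigma_bd. apply mob_mob; [apply base_lt_1|lra].
Qed.

Lemma pseudo_shift (n : nat) (z w : C) : Cmod z < 1 -> Cmod w < 1 ->
  pseudo_hyp_dist (shift n z) (shift n w) = pseudo_hyp_dist z w.
Proof.
  intros Hz Hw. unfold shift, axis_shift. rewrite pseudo_mob, pseudo_rot; auto.
  - rewrite Cmod_opp. apply base_lt_1.
  - rewrite Cmod_mult, sigma_bd. lra.
  - rewrite Cmod_mult, sigma_bd. lra.
Qed.

Lemma pseudo_psi (n : nat) (z w : C) : Cmod z < 1 -> Cmod w < 1 ->
  pseudo_hyp_dist (psi n z) (psi n w) = pseudo_hyp_dist (phi (shift n z)) (phi (shift n w)).
Proof.
  intros Hz Hw. rewrite !psi_eq. unfold frame.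
  rewrite pseudo_rot by (rewrite Cmod_conj; apply u_unit).
  apply pseudo_mob; [apply img_lt_1|apply phi_maps, shift_lt_1; auto..].
Qed.

(** From [Cmod (sigma + z) <= 2] and the Stolz inequality. A Stolz region thus lies in a sector of
    the half-plane, a description that the dilations between frames preserve. *)
Lemma stolz_cayley (M : R) (z : C) : 1 < M -> stolz sigma M z ->
  1 / (2 * M) * Cmod (cayley sigma z) <= Re (cayley sigma z).
Proof.
  intros HM [Hz Hs]. unfold unit_disc in Hz.
  pose proof (Cmod_lt_neq sigma z ltac:(lra)) as N. pose proof (Cmod_ge_0 z) as Hz0.
  rewrite Re_cayley by assumption. unfold cayley. rewrite Cmod_div by exact N.
  rewrite Cmod_minus_sym in Hs. apply Cmod_gt_0 in N.
  pose proof (Cmod_triangle sigma z) as T. rewrite sigma_bd in T.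
  set (d := Cmod (sigma - z)%C) in *. set (s := Cmod (sigma + z)%C) in *.
  assert (Hs0 : 0 <= s) by apply Cmod_ge_0.
  apply Rmult_le_reg_r with (2 * M * d ^ 2); [assert (0 < d ^ 2) by (apply pow_lt; lra); nra|].
  replace (1 / (2 * M) * (s / d) * (2 * M * d ^ 2)) with (s * d) by (field; lra).
  replace ((1 - Cmod z ^ 2) / d ^ 2 * (2 * M * d ^ 2)) with ((1 - Cmod z ^ 2) * (2 * M)) by (field; lra).
  apply Rle_trans with (2 * (M * (1 - Cmod z))).
  - apply Rmult_le_compat; lra.
  - nra.
Qed.

Lemma cayley_large (z : C) (d : R) : 0 < d <= 1 -> Cmod z < 1 -> Cmod (z - sigma)%C < d ->
  / d <= Cmod (cayley sigma z).
Proof.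
  intros Hd Hz Hs. pose proof (Cmod_lt_neq sigma z ltac:(lra)) as N.
  unfold cayley. rewrite Cmod_div by exact N. rewrite Cmod_minus_sym in Hs. apply Cmod_gt_0 in N.
  pose proof (Cmod_triangle_rev (2 * sigma) (sigma - z)) as T.
  replace (2 * sigma - (sigma - z))%C with (sigma + z)%C in T by ring.
  rewrite Cmod_mult, sigma_bd, Cmod_R, Rabs_pos_eq in T by lra.
  assert (Hi : 0 < / Cmod (sigma - z)%C) by (apply Rinv_0_lt_compat; exact N).
  apply Rle_trans with (/ Cmod (sigma - z)%C).
  - apply Rinv_le_contravar; lra.
  - unfold Rdiv. nra.
Qed.

Lemma pow3_floor (x : R) : 1 <= x -> exists n, 3 ^ n <= x < 3 ^ S n.
Proof.
  intros Hx. destruct (pow3_unbounded x) as [N HN]. specialize (HN N (le_n N)).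
  induction N as [|N IH]; [simpl in HN; lra|].
  destruct (Rlt_dec x (3 ^ N)) as [H|H]; [auto|]. exists N. lra.
Qed.

Lemma stolz_index (M : R) (N : nat) : 1 < M -> exists d, 0 < d /\
  forall z, Cmod (z - sigma)%C < d -> stolz sigma M z ->
    exists n, (N <= n)%nat /\ 3 ^ n <= Cmod (cayley sigma z) < 3 ^ S n.
Proof.
  intros HM. pose proof (pow3_ge_1 N) as HN. exists (/ 3 ^ N). split; [apply Rinv_0_lt_compat; lra|].
  intros z Hz [Hd Hs].
  pose proof (cayley_large z (/ 3 ^ N)) as HL. rewrite Rinv_inv in HL.
  assert (Hle : / 3 ^ N <= 1) by (rewrite <- Rinv_1; apply Rinv_le_contravar; lra).
  specialize (HL ltac:(split; [apply Rinv_0_lt_compat; lra|exact Hle]) Hd Hz).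
  destruct (pow3_floor (Cmod (cayley sigma z)) ltac:(lra)) as [n Hn].
  exists n. split; [|exact Hn].
  apply Nat.nlt_ge. intros Hlt.
  assert (3 ^ S n <= 3 ^ N) by (apply Rle_pow; [lra|lia]). lra.
Qed.

(** [cayley 1 z + 1 = 2 / (1 - z)] bounds [Cmod (1 - z)] below by [2 / (B + 1)], and the sector
    condition turns this into a lower bound for [1 - Cmod z ^ 2]: a truncated sector is compact in
    the disc. *)
Lemma cayley_gap (z : C) (c B : R) : Cmod z < 1 -> 0 < c ->
  c * Cmod (cayley 1 z) <= Re (cayley 1 z) -> 1 <= Cmod (cayley 1 z) <= B ->
  Cmod z <= 1 - 2 * c / (B + 1) ^ 2.
Proof.
  intros Hz Hc HS HB.
  pose proof (Cmod_lt_neq 1 z ltac:(rewrite Cmod_1; lra)) as N.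
  assert (E : Cmod (cayley 1 z + 1)%C * Cmod (1 - z)%C = 2).
  { rewrite <- Cmod_mult. replace ((cayley 1 z + 1) * (1 - z))%C with (RtoC 2).
    - rewrite Cmod_R, Rabs_pos_eq; lra.
    - unfold cayley. field. exact N. }
  rewrite (Re_cayley 1 z Cmod_1 Hz) in HS. apply Cmod_gt_0 in N.
  pose proof (Cmod_triangle (cayley 1 z) 1) as T. rewrite Cmod_1 in T.
  set (d := Cmod (1 - z)%C) in *. set (X := Cmod (cayley 1 z)) in *.
  assert (Hd : 2 <= (B + 1) * d).
  { rewrite <- E. apply Rmult_le_compat_r; lra. }
  assert (Hdd : 4 <= ((B + 1) * d) ^ 2) by nra.
  assert (Hdp : 0 < d ^ 2) by (apply pow_lt; lra).
  assert (H1 : c * d ^ 2 <= 1 - Cmod z ^ 2).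
  { apply Rle_div_r in HS; [|lra].
    apply Rle_trans with (2 := HS). apply Rmult_le_compat_r; nra. }
  assert (HB2 : 0 < (B + 1) ^ 2) by (apply pow_lt; lra).
  assert (H2 : 2 * c / (B + 1) ^ 2 <= c * d ^ 2 / 2).
  { apply div_le; [exact HB2|].
    replace (c * d ^ 2 / 2 * (B + 1) ^ 2) with (c * ((B + 1) * d) ^ 2 / 2) by field. nra. }
  nra.
Qed.

Lemma stolz_coordinate (m : nat) (z : C) (c B : R) : Cmod z < 1 -> 0 < c ->
  c * Cmod (cayley sigma z) <= Re (cayley sigma z) ->
  3 ^ m <= Cmod (cayley sigma z) <= 3 ^ m * B ->
  exists w, Cmod w < 1 /\ Cmod w <= 1 - 2 * c / (B + 1) ^ 2 /\ shift m w = z /\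
    cayley sigma z = (RtoC (3 ^ m) * cayley 1 w)%C /\ 1 <= Cmod (cayley 1 w) <= B /\
    c * Cmod (cayley 1 w) <= Re (cayley 1 w).
Proof.
  intros Hz Hc HS HB. pose proof (pow3_ge_1 m) as Hm.
  destruct (frame_coordinate m z Hz) as [w [_ [Hw Hs]]].
  pose proof (cayley_shift m w Hw) as E. rewrite Hs in E. rewrite E in HS, HB.
  rewrite Cmod_mult, Cmod_R, Rabs_pos_eq in HS, HB by lra. rewrite re_scal_l in HS.
  assert (HB' : 1 <= Cmod (cayley 1 w) <= B).
  { split; apply Rmult_le_reg_l with (3 ^ m); lra. }
  assert (HS' : c * Cmod (cayley 1 w) <= Re (cayley 1 w)).
  { apply Rmult_le_reg_l with (3 ^ m); lra. }
  exists w. repeat split; auto; try tauto.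
  apply cayley_gap; auto.
Qed.

(** Converts the ratio whose argument appears in weak conformality into a quotient of half-plane
    coordinates, each increased by 1. *)
Lemma one_minus_cayley (t z : C) : Cmod t = 1 -> Cmod z < 1 ->
  ((1 - Cconj t * z) * (cayley t z + 1) = 2)%C.
Proof.
  intros Ht Hz. assert (Ht0 : t <> 0%C) by (apply Cmod_gt_0; lra).
  pose proof (Cmod_lt_neq t z ltac:(lra)) as N. rewrite (Cconj_unit t Ht).
  unfold cayley. field. split; assumption.
Qed.

(** With [X = cayley 1 w] in frame [n], the coordinates of [z] and [phi z] are [3 ^ n * X] and
    nearly [height n * X], so the ratio is close to [3 ^ n / height n]. This number depends on the
    scale of [z], but it is positive, and multiplying by its inverse [t] leaves the argument
    unchanged. *)
Lemma angular_behaviour (M e : R) : 1 < M -> 0 < e <= 1 / 4 -> exists d, 0 < d /\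
  forall z, Cmod (z - sigma)%C < d -> stolz sigma M z ->
    Cmod (1 - Cconj tau * phi z)%C <= 4 * e /\
    exists t, 0 < t /\
      Cmod (RtoC t * ((1 - Cconj tau * phi z) / (1 - Cconj sigma * z)) - 1)%C <= 6 * e.
Proof.
  intros HM He. set (c := 1 / (2 * M)).
  assert (Hc : 0 < c) by (apply Rdiv_lt_0_compat; lra).
  destruct (cayley_asymptotics e (2 * c / (3 + 1) ^ 2) ltac:(lra)) as [N1 H1]; [lra|].
  destruct (height_unbounded (/ e)) as [N2 H2]. destruct (pow3_unbounded (/ e)) as [N3 H3].
  destruct (stolz_index M (Nat.max N1 (Nat.max N2 N3)) HM) as [d [Hd HI]].
  exists d. split; [exact Hd|]. intros z Hzd Hst.
  destruct (HI z Hzd Hst) as [n [Hn Hn3]].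
  pose proof (stolz_cayley M z HM Hst) as HS. fold c in HS.
  assert (Hz : Cmod z < 1) by apply Hst.
  destruct (stolz_coordinate n z c 3 Hz Hc HS ltac:(cbn [pow] in Hn3; lra))
    as [w [Hw [Hws [Hsh [EZ [HX HXS]]]]]].
  destruct (H1 n w ltac:(lia) Hws) as [err [Herr EW]]. rewrite Hsh in EW.
  specialize (H2 n ltac:(lia)). specialize (H3 n ltac:(lia)).
  pose proof (one_minus_cayley tau (phi z) tau_bd (phi_maps z Hz)) as Qt.
  pose proof (one_minus_cayley sigma z sigma_bd Hz) as Qs.
  assert (Hie : 4 <= / e).
  { replace 4 with (/ (1 / 4)) by field. apply Rinv_le_contravar; lra. }
  set (P := height n) in *. set (X := cayley 1 w) in *.
   set (T := 3 ^ n) in *.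
  assert (HiP : / P <= e).
  { rewrite <- (Rinv_inv e). apply Rinv_le_contravar; lra. }
  assert (HiT : / T <= e).
  { rewrite <- (Rinv_inv e). apply Rinv_le_contravar; lra. }
  assert (HiP0 : 0 < / P) by (apply Rinv_0_lt_compat; lra).
  assert (HiT0 : 0 < / T) by (apply Rinv_0_lt_compat; lra).
  assert (NP : RtoC P <> 0%C) by (intros E; apply RtoC_inj in E; lra).
  assert (NT : RtoC T <> 0%C) by (intros E; apply RtoC_inj in E; lra).
  (* Chosen so that [cayley tau (phi z) + 1 = P * Y]. As [err] and [/ P] are at most 1/4 each and
     [Cmod X >= 1], [Y] stays away from 0. *)
  set (Y := (X + err + RtoC (/ P))%C).
  assert (HY : 1 / 2 <= Cmod Y).
  { pose proof (Cmod_triangle_rev X (- (err + RtoC (/ P)))) as T1.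
    replace (X - - (err + RtoC (/ P)))%C with Y in T1 by (unfold Y; ring).
    rewrite Cmod_opp in T1. pose proof (Cmod_triangle err (RtoC (/ P))) as T2.
    rewrite Cmod_R, Rabs_pos_eq in T2 by lra. lra. }
  assert (NY : Y <> 0%C) by (apply Cmod_gt_0; lra).
  assert (EWY : (cayley tau (phi z) + 1)%C = (RtoC P * Y)%C).
  { rewrite EW. unfold Y. rewrite RtoC_inv by lra. field. exact NP. }
  assert (EZY : (cayley sigma z + 1)%C = (RtoC T * (X + RtoC (/ T)))%C).
  { rewrite EZ. rewrite RtoC_inv by lra. field. exact NT. }
  rewrite EWY in Qt. rewrite EZY in Qs.
  assert (Et : (1 - Cconj tau * phi z)%C = (2 / (RtoC P * Y))%C).
  { rewrite <- Qt. field. split; assumption. }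
  assert (NS : (1 - Cconj sigma * z)%C <> 0%C) by (apply one_minus_neq_0; assumption).
  split.
  - rewrite Et, Cmod_div, Cmod_mult, !Cmod_R, !Rabs_pos_eq by (try apply Cmult_neq_0; auto; lra).
    apply Rle_trans with (4 * / P); [|lra].
    apply div_le; [nra|].
    replace (4 * / P * (P * Cmod Y)) with (4 * Cmod Y) by (field; lra). lra.
  - exists (P / T). split; [apply Rdiv_lt_0_compat; lra|].
    assert (E : (RtoC (P / T) * ((1 - Cconj tau * phi z) / (1 - Cconj sigma * z)) - 1)%C
       = ((RtoC (/ T) - err - RtoC (/ P)) / Y)%C).
    { assert (Ei : (/ (1 - Cconj sigma * z))%C = (RtoC T * (X + RtoC (/ T)) / 2)%C).
      { set (A := (1 - Cconj sigma * z)%C) in *. set (D := (RtoC T * (X + RtoC (/ T)))%C) in *.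
        assert (ED : D = (2 / A)%C) by (rewrite <- Qs; field; exact NS).
        rewrite ED. field. exact NS. }
      unfold Cdiv at 1. rewrite Ei, Et, RtoC_div by lra.
      replace (RtoC (/ T) - err - RtoC (/ P))%C with ((X + RtoC (/ T)) - Y)%C by (unfold Y; ring).
      field. repeat split; assumption. }
    rewrite E, Cmod_div by exact NY.
    assert (Num : Cmod (RtoC (/ T) - err - RtoC (/ P))%C <= 3 * e).
    { eapply Rle_trans; [apply Cmod_triangle_minus|].
      pose proof (Cmod_triangle_minus (RtoC (/ T)) err) as T1.
      rewrite Cmod_R, Rabs_pos_eq in T1 by lra. rewrite (Cmod_R (/ P)), Rabs_pos_eq by lra. lra. }
    apply div_le; nra.
Qed.

Lemma conformal_of_frames : weakly_conformal_at phi sigma.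
Proof.
  exists tau. split; [exact tau_bd|]. split.
  - intros M HM P HP. apply locally_Cmod in HP. destruct HP as [r [Hr HP]].
    destruct (common_pos (1 / 4) (r / 8)) as [e [He [He1 He2]]]; [lra..|].
    destruct (angular_behaviour M e HM ltac:(lra)) as [d [Hd H]].
    unfold filtermap, stolz_filter, within. apply locally_Cmod. exists d. split; [exact Hd|].
    intros z Hz Hst. apply HP. destruct (H z Hz Hst) as [H1 _].
    replace (phi z - tau)%C with (- (tau * (1 - Cconj tau * phi z)))%C.
    + rewrite Cmod_opp, Cmod_mult, tau_bd. lra.
    + replace (tau * (1 - Cconj tau * phi z))%C with (tau - (tau * Cconj tau) * phi z)%C by ring.
      rewrite Cmod_1_conj by exact tau_bd. ring.
  - intros M HM. apply angular_lim_eps. intros e He.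
    destruct (Carg_near_1 e He) as [k [Hk HC]].
    destruct (common_pos (1 / 4) (k / 6)) as [e' [He' [He1 He2]]]; [lra..|].
    destruct (angular_behaviour M e' HM ltac:(lra)) as [d [Hd H]].
    exists d. split; [exact Hd|]. intros z Hz Hst.
    destruct (H z Hz Hst) as [_ [t [Ht H1]]].
    rewrite Rminus_0_r, <- (Carg_scal t) by exact Ht. apply HC. lra.
Qed.

(** * The quotient of hyperbolic distances *)

Lemma quotient_le_1 (z w : C) : Cmod z < 1 -> Cmod w < 1 -> hyp_quotient phi z w <= 1.
Proof.
  intros Hz Hw. unfold hyp_quotient. destruct (Ceq_dec z w) as [_|Hne].
  - apply hyp_distortion_le_1; assumption.
  - pose proof (hyp_dist_pos z w Hz Hw Hne) as Hp.
    apply div_le; [exact Hp|]. rewrite Rmult_1_l.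
    apply hyp_dist_mono; [apply pseudo_lt_1; assumption|].
    apply schwarz_pick; auto. apply phi_disc_map; assumption.
Qed.

Lemma quotient_sym (z w : C) : Cmod z < 1 -> Cmod w < 1 ->
  hyp_quotient phi z w = hyp_quotient phi w z.
Proof.
  intros Hz Hw. unfold hyp_quotient.
  destruct (Ceq_dec z w) as [E|H1].
  { subst w. destruct (Ceq_dec z z); congruence. }
  destruct (Ceq_dec w z) as [H2|_]; [congruence|].
  unfold hyp_dist. rewrite (pseudo_sym z w), (pseudo_sym (phi z) (phi w)); auto.
  - apply phi_maps, Hz.
  - apply phi_maps, Hw.
Qed.

(** The constant is [2 * 12 * 8], with 2 from [hyp_dist_ratio], 12 from [near_id_pseudo] and 8 from
    [pseudo_gap]. On the diagonal the distortion is bounded through nearby pairs in the disc of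
    radius [1 - s / 2], which costs only a factor 4. *)
Lemma quotient_near (m : nat) (k s : R) (z w : C) : near_id (psi m) k -> 0 < k -> 0 < s <= 1 ->
  Cmod z <= 1 - s -> Cmod w <= 1 - s ->
  1 - 192 * k / s ^ 4 <= hyp_quotient phi (shift m z) (shift m w).
Proof.
  intros Hid Hk Hs Hz Hw.
  assert (Hs2 : 0 < s * s) by nra. assert (Hs4 : 0 < s ^ 4) by (apply pow_lt; lra).
  pose proof (shift_lt_1 m z ltac:(lra)) as Sz. pose proof (shift_lt_1 m w ltac:(lra)) as Sw.
  unfold hyp_quotient. destruct (Ceq_dec (shift m z) (shift m w)) as [_|Hne].
  - apply Rle_trans with (1 - 12 * k / (s / 2 * (s / 2))).
    { assert (48 * k / (s * s) <= 192 * k / s ^ 4).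
      { apply Rmult_le_reg_r with (s ^ 4); [exact Hs4|].
        replace (48 * k / (s * s) * s ^ 4) with (48 * k * (s * s)) by (field; lra).
        replace (192 * k / s ^ 4 * s ^ 4) with (192 * k) by (field; lra).
        assert (k * (s * s) <= k * 1) by (apply Rmult_le_compat_l; nra). lra. }
      replace (12 * k / (s / 2 * (s / 2))) with (48 * k / (s * s)) by (field; lra). lra. }
    assert (Hcc : ccont (fun y => Cconj sigma * mob (base m) y)%C (shift m z)).
    { apply ccont_mult; [apply ccont_const|]. apply cdiff_ccont, cdiff_mob; [apply base_lt_1|exact Sz]. }
    destruct (Hcc (s / 2) ltac:(lra)) as [d [Hd Hc]].
    apply (hyp_distortion_ge phi phi_holo phi_maps (shift m z) _ d Sz Hd).
    intros y Hy _ Hyd. specialize (Hc y Hyd).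
    destruct (frame_coordinate m y Hy) as [y' [Ey [Hy' Hsy]]].
    assert (Ez : z = (Cconj sigma * mob (base m) (shift m z))%C).
    { unfold shift, axis_shift. fold (base m). rewrite mob_opp_mob.
      - replace (Cconj sigma * (sigma * z))%C with ((sigma * Cconj sigma) * z)%C by ring.
        rewrite Cmod_1_conj by exact sigma_bd. ring.
      - apply base_lt_1.
      - rewrite Cmod_mult, sigma_bd. lra. }
    rewrite <- Ey, <- Ez in Hc.
    assert (Hy2 : Cmod y' <= 1 - s / 2).
    { pose proof (Cmod_triangle_rev y' z). lra. }
    rewrite <- Hsy, pseudo_shift, <- pseudo_psi by (auto; lra).
    apply near_id_pseudo; auto; try lra; [apply psi_0|apply psi_disc].
  -
    pose proof (hyp_dist_pos _ _ Sz Sw Hne) as Hp.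
    pose proof (near_id_pseudo (psi m) k s z w Hid (psi_0 m) (psi_disc m) Hk ltac:(lra) Hz Hw) as HN.
    rewrite pseudo_psi in HN by lra. rewrite <- (pseudo_shift m z w) in HN by lra.
    assert (Ht : 0 <= 12 * k / (s * s)) by (apply Rle_mult_inv_pos; lra).
    pose proof (hyp_dist_ratio _ _ _ _ _ Sz Sw Hne Ht HN
      (schwarz_pick phi _ _ (phi_disc_map phi phi_holo phi_maps) Sz Sw)) as HR.
    pose proof (pseudo_gap z w s ltac:(lra) Hz Hw) as HG.
    rewrite pseudo_shift in HR by lra.
    set (g := 1 - pseudo_hyp_dist z w) in *.
    apply le_div; [exact Hp|].
    apply Rle_trans with (2 := HR). apply Rmult_le_compat_r; [lra|].
    assert (2 * (12 * k / (s * s)) / g <= 192 * k / s ^ 4); [|lra].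
    apply Rmult_le_reg_r with (g * s ^ 4); [nra|].
    replace (2 * (12 * k / (s * s)) / g * (g * s ^ 4)) with (24 * k * (s * s)) by (field; lra).
    replace (192 * k / s ^ 4 * (g * s ^ 4)) with (192 * k * g) by (field; lra).
    assert (k * (s * s / 8) <= k * g) by (apply Rmult_le_compat_l; lra). lra.
Qed.

Lemma one_le_ln_3 : 1 <= ln 3.
Proof. rewrite <- (ln_exp 1). apply ln_le_compat; [apply exp_pos|apply exp_le_3]. Qed.

Lemma ln_pow_nat (x : R) (n : nat) : 0 < x -> ln (x ^ n) = INR n * ln x.
Proof.
  intros Hx. induction n as [|n IH]; [simpl; rewrite ln_1; ring|].
  rewrite S_INR. simpl. rewrite ln_mult, IH by (auto using pow_lt). ring.
Qed.

(* With [x = j ln 3]: the numerator is at least [(1 - e) x - C1] and the denominator at most [x + C2]. *)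
Lemma quotient_far (c e : R) : 0 < c <= 1 -> 0 < e <= 1 / 2 -> exists N L, forall m j z w,
  (N <= m)%nat -> (L <= j)%nat -> Cmod z < 1 -> Cmod w < 1 ->
  c * Cmod (cayley sigma z) <= Re (cayley sigma z) ->
  c * Cmod (cayley sigma w) <= Re (cayley sigma w) ->
  3 ^ (m + j) <= Cmod (cayley sigma z) < 3 ^ S (m + j) ->
  3 ^ m <= Cmod (cayley sigma w) < 3 ^ S m ->
  1 - 2 * e <= hyp_quotient phi z w.
Proof.
  intros Hc He. pose proof one_le_ln_3 as Hln3.
  (* [q = 3 ^ (1 - e)] stays below the limiting ratio 3 of consecutive heights, and [ln q] is the
     gain per step in the numerator. *)
  set (q := exp ((1 - e) * ln 3)).
  assert (Hq : 0 < q < 3).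
  { split; [apply exp_pos|]. rewrite <- (exp_ln 3) by lra. apply exp_increasing. nra. }
  assert (Hlnq : ln q = (1 - e) * ln 3) by apply ln_exp.
  destruct (height_growth q Hq) as [N1 H1].
  destruct (cayley_asymptotics (c / 2) (2 * c / (3 + 1) ^ 2) ltac:(lra)) as [N2 H2]; [lra|].
  set (C1 := - ln (c / 8)). set (C2 := ln (12 / (c * c))).
  assert (Hcc : 0 < c * c <= 1) by nra.
  assert (HC1 : 0 <= C1).
  { unfold C1. assert (ln (c / 8) <= ln 1) by (apply ln_le_compat; lra). rewrite ln_1 in H. lra. }
  assert (H12 : 12 <= 12 / (c * c)).
  { apply le_div; lra. }
  assert (HC2 : 0 <= C2).
  { unfold C2. rewrite <- ln_1. apply ln_le_compat; lra. }
  assert (HL : exists L, forall j, (L <= j)%nat -> C1 + C2 <= e * INR j).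
  { destruct (INR_unbounded ((C1 + C2) / e)) as [L HL]. exists L. intros j Hj.
    apply le_INR in Hj. apply Rgt_lt in HL.
    apply Rlt_div_l in HL; [|lra]. assert (INR L * e <= INR j * e) by (apply Rmult_le_compat_r; lra). lra. }
  destruct HL as [L HL].
  (* [S L] forces [j >= 1] and so [3 ^ j >= 3]: the scales of [z] and [w] are then disjoint, with
     the larger coordinate at [z], and in particular [z <> w]. *)
  exists (Nat.max N1 N2), (S L). intros m j z w Hm Hj Hz Hw Sz Sw Bz Bw.
  pose proof (pow3_ge_1 m) as Hpm.
  destruct (stolz_coordinate (m + j) z c 3 Hz ltac:(lra) Sz ltac:(cbn [pow] in Bz; lra))
    as [z' [_ [Gz [Ez [_ [HXz SXz]]]]]].
  destruct (stolz_coordinate m w c 3 Hw ltac:(lra) Sw ltac:(cbn [pow] in Bw; lra))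
    as [w' [_ [Gw [Ew [_ [HXw SXw]]]]]].
  destruct (H2 (m + j)%nat z' ltac:(lia) Gz) as [rz [Hrz Wz]].
  destruct (H2 m w' ltac:(lia) Gw) as [rw [Hrw Ww]].
  rewrite Ez in Wz. rewrite Ew in Ww.
  pose proof (height_pos m) as HPm. pose proof (height_pos (m + j)) as HPmj.
  specialize (H1 m j ltac:(lia)).
  assert (HBz : height (m + j) * (c / 2) <= Re (cayley tau (phi z))).
  { rewrite Wz, re_scal_l. apply Rmult_le_compat_l; [lra|].
    change (Re (cayley 1 z' + rz)%C) with (Re (cayley 1 z') + Re rz).
    pose proof (re_le_Cmod rz) as T. apply Rle_trans with (r3 := c / 2) in T; [|exact Hrz].
    apply Rabs_le_between in T. nra. }
  assert (HBw : Re (cayley tau (phi w)) <= height m * 4).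
  { rewrite Ww, re_scal_l. apply Rmult_le_compat_l; [lra|].
    change (Re (cayley 1 w' + rw)%C) with (Re (cayley 1 w') + Re rw).
    pose proof (re_le_Cmod rw). pose proof (re_le_Cmod (cayley 1 w')).
    pose proof (Rle_abs (Re rw)). pose proof (Rle_abs (Re (cayley 1 w'))). lra. }
  assert (Hpz : Cmod (phi z) < 1) by apply phi_maps, Hz.
  assert (Hpw : Cmod (phi w) < 1) by apply phi_maps, Hw.
  pose proof (Re_cayley_pos tau (phi w) tau_bd Hpw) as HRw.
  assert (Hqj : 0 < q ^ j) by (apply pow_lt; lra).
  assert (Hlow : INR j * ((1 - e) * ln 3) - C1 <= hyp_dist (phi z) (phi w)).
  { eapply Rle_trans; [|apply (hyp_dist_ge_busemann tau); auto].
    (* [c / 8] is the lower bound [c / 2] for the real part at [z] over the upper bound 4 at [w],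
       each measured in units of its height. *)
    replace (INR j * ((1 - e) * ln 3) - C1) with (ln (q ^ j * (c / 8))).
    - apply ln_le_compat; [nra|].
      apply le_div; [exact HRw|].
      apply Rle_trans with (2 := HBz).
      apply Rle_trans with (q ^ j * (c / 8) * (height m * 4)).
      + apply Rmult_le_compat_l; [nra|exact HBw].
      + replace (q ^ j * (c / 8) * (height m * 4)) with (height m * q ^ j * (c / 2)) by field.
        apply Rmult_le_compat_r; lra.
    - rewrite ln_mult, ln_pow_nat, Hlnq by lra. unfold C1. ring. }
  assert (Emj : 3 ^ (m + j) = 3 ^ m * 3 ^ j) by apply pow_add.
  assert (Hj1 : 3 <= 3 ^ j).
  { replace j with (S (pred j)) by lia. cbn [pow]. pose proof (pow3_ge_1 (pred j)). lra. }
  assert (Hwz : Cmod (cayley sigma w) <= Cmod (cayley sigma z)).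
  { cbn [pow] in Bw. nra. }
  assert (Hne : z <> w).
  { intros E. rewrite E in Bz. cbn [pow] in Bw. nra. }
  pose proof (hyp_dist_pos z w Hz Hw Hne) as Hdp.
  assert (Hup : hyp_dist z w <= INR j * ln 3 + C2).
  { eapply Rle_trans; [apply (hyp_dist_le_cayley sigma z w c); auto; lra|].
    (* The 12 is the 4 of [hyp_dist_le_cayley] times the 3 by which the coordinate of [z] may exceed
       [3 ^ (m + j)]. *)
    replace (INR j * ln 3 + C2) with (ln (3 ^ j * (12 / (c * c)))).
    - apply ln_le_compat.
      + apply Rdiv_lt_0_compat; [lra|]. apply Rmult_lt_0_compat; lra.
      + apply div_le; [apply Rmult_lt_0_compat; lra|].
        replace (3 ^ j * (12 / (c * c)) * (c * c * Cmod (cayley sigma w)))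
          with (12 * (3 ^ j * Cmod (cayley sigma w))) by (field; lra).
        cbn [pow] in Bz. assert (3 ^ j * 3 ^ m <= 3 ^ j * Cmod (cayley sigma w)) by nra. lra.
    - rewrite ln_mult, ln_pow_nat by lra. unfold C2. ring. }
  unfold hyp_quotient. destruct (Ceq_dec z w) as [E|_]; [contradiction|].
  apply le_div; [exact Hdp|].
  apply Rle_trans with (2 := Hlow).
  apply Rle_trans with ((1 - 2 * e) * (INR j * ln 3 + C2)).
  - apply Rmult_le_compat_l; lra.
  - specialize (HL j ltac:(lia)).
    assert (e * INR j <= e * (INR j * ln 3)) by (apply Rmult_le_compat_l; nra).
    assert (0 <= e * C2) by (apply Rmult_le_pos; lra). lra.
Qed.

(** Scales at least [L] apart are left to [quotient_far]. Closer pairs lie in one compact set of the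
    frame of the smaller scale, whose size depends only on [L] and the aperture; so the closeness
    [k] to the identity is chosen after [L], and the distance [d] last. *)
Lemma quotient_lower (M e : R) : 1 < M -> 0 < e <= 1 / 2 -> exists d, 0 < d /\
  forall z w, Cmod (z - sigma)%C < d -> Cmod (w - sigma)%C < d ->
    stolz sigma M z -> stolz sigma M w -> 1 - 2 * e <= hyp_quotient phi z w.
Proof.
  intros HM He. set (c := 1 / (2 * M)).
  assert (Hc : 0 < c <= 1).
  { unfold c. split; [apply Rdiv_lt_0_compat; lra|].
    apply div_le; lra. }
  destruct (quotient_far c e Hc He) as [N1 [L HF]].
  set (B := 3 ^ S L). assert (HB : 1 <= B) by apply pow3_ge_1.
  set (s := 2 * c / (B + 1) ^ 2).
  assert (HB2 : 4 <= (B + 1) ^ 2) by nra.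
  assert (Hs : 0 < s <= 1).
  { unfold s. split; [apply Rdiv_lt_0_compat; lra|].
    apply div_le; lra. }
  assert (Hs4 : 0 < s ^ 4) by (apply pow_lt; lra).
  set (k := e * s ^ 4 / 192).
  assert (Hk : 0 < k) by (apply Rdiv_lt_0_compat; [apply Rmult_lt_0_compat|]; lra).
  destruct (psi_near_id k Hk) as [N2 HN].
  destruct (stolz_index M (Nat.max N1 N2) HM) as [d [Hd HI]].
  exists d. split; [exact Hd|].
  assert (H : forall z w n m, stolz sigma M z -> stolz sigma M w ->
    (Nat.max N1 N2 <= m)%nat -> (m <= n)%nat ->
    3 ^ n <= Cmod (cayley sigma z) < 3 ^ S n -> 3 ^ m <= Cmod (cayley sigma w) < 3 ^ S m ->
    1 - 2 * e <= hyp_quotient phi z w).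
  { intros z w n m Tz Tw Hm Hnm Bz Bw.
    pose proof (stolz_cayley M z HM Tz) as Sz. pose proof (stolz_cayley M w HM Tw) as Sw.
    fold c in Sz, Sw.
    assert (Hz : Cmod z < 1) by apply Tz. assert (Hw : Cmod w < 1) by apply Tw.
    destruct (Nat.le_gt_cases L (n - m)) as [Hfar|Hnear].
    - apply (HF m (n - m)%nat z w); auto; [lia|]. replace (m + (n - m))%nat with n by lia. exact Bz.
    -
      assert (HBz : 3 ^ m <= Cmod (cayley sigma z) <= 3 ^ m * B).
      { assert (3 ^ m <= 3 ^ n) by (apply Rle_pow; [lra|lia]).
        assert (3 ^ S n <= 3 ^ m * B).
        { unfold B. rewrite <- pow_add. apply Rle_pow; [lra|lia]. }
        lra. }
      assert (HBw : 3 ^ m <= Cmod (cayley sigma w) <= 3 ^ m * B).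
      { assert (3 ^ S m <= 3 ^ m * B).
        { unfold B. rewrite <- pow_add. apply Rle_pow; [lra|lia]. }
        lra. }
      destruct (stolz_coordinate m z c B Hz ltac:(lra) Sz HBz) as [z' [_ [Gz [Ez _]]]].
      destruct (stolz_coordinate m w c B Hw ltac:(lra) Sw HBw) as [w' [_ [Gw [Ew _]]]].
      fold s in Gz, Gw.
      pose proof (quotient_near m k s z' w' (HN m ltac:(lia)) Hk Hs Gz Gw) as HQ.
      rewrite Ez, Ew in HQ.
      replace (192 * k / s ^ 4) with e in HQ by (unfold k; field; lra). lra. }
  intros z w Hzd Hwd Tz Tw.
  destruct (HI z Hzd Tz) as [n [Hn Bz]]. destruct (HI w Hwd Tw) as [m [Hm Bw]].
  destruct (Nat.le_gt_cases m n) as [Hmn|Hmn].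
  - apply (H z w n m); auto.
  - rewrite quotient_sym by (apply Tz || apply Tw). apply (H w z m n); auto. lia.
Qed.

Lemma quotient_limit : is_angular_lim2 (hyp_quotient phi) sigma 1.
Proof.
  intros M HM. apply filterlim_locally. intros eps.
  pose proof (cond_pos eps) as Heps.
  destruct (common_pos (1 / 2) (eps / 4)) as [e [He [He1 He2]]]; [lra..|].
  destruct (quotient_lower M e HM ltac:(lra)) as [d [Hd H]].
  assert (HQ : stolz_filter sigma M (fun z => stolz sigma M z /\ Cmod (z - sigma)%C < d)).
  { apply locally_Cmod. exists d. split; [exact Hd|]. intros z Hz Hst. split; assumption. }
  apply (Filter_prod _ _ _ _ _ HQ HQ). intros z w [Tz Hz] [Tw Hw].
  specialize (H z w Hz Hw Tz Tw).
  pose proof (quotient_le_1 z w ltac:(apply Tz) ltac:(apply Tw)) as H1.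
  change (Rabs (hyp_quotient phi z w - 1) < eps). apply Rabs_def1; lra.
Qed.

End Frames.

(** * Return to the radius and the equivalences *)

Lemma diagonal_limit (phi : C -> C) (sigma : C) : Cmod sigma = 1 ->
  is_angular_lim2 (hyp_quotient phi) sigma 1 ->
  filterlim (fun r : R => hyp_distortion phi (RtoC r * sigma)%C) (at_left 1) (locally 1).
Proof.
  intros Hs Hb. apply at_left_lim_eps. intros e He.
  assert (HP : locally (1 : R) (fun x : R => Rabs (x - 1) < e)).
  { exists (mkposreal e He). intros x Hx. exact Hx. }
  (* The aperture 2 is one admissible choice: radial points satisfy [Cmod (z - sigma) = 1 - Cmod z].
     A set of the product filter contains the pairs [(z, z)] near the vertex, where the quotient is
     the distortion. *)
  destruct (Hb 2 ltac:(lra) _ HP) as [Q R' HQ HR H].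
  unfold stolz_filter, within in HQ, HR. apply locally_Cmod in HQ, HR.
  destruct HQ as [d1 [Hd1 HQ]]. destruct HR as [d2 [Hd2 HR]].
  destruct (common_pos d1 d2) as [d3 [Hd3 [L1 L2]]]; auto.
  destruct (common_pos 1 d3) as [d [Hd [L3 L4]]]; [lra..|].
  exists d. split; [exact Hd|]. intros r Hr.
  assert (E1 : Cmod (RtoC r * sigma)%C = r) by (apply axis_point; lra).
  assert (E2 : Cmod (RtoC r * sigma - sigma)%C = 1 - r).
  { replace (RtoC r * sigma - sigma)%C with (RtoC (r - 1) * sigma)%C by (rewrite RtoC_minus; ring).
    rewrite Cmod_mult, Hs, Cmod_R, Rabs_left; lra. }
  assert (Hst : stolz sigma 2 (RtoC r * sigma)%C).
  { unfold stolz, unit_disc. rewrite E1, E2. lra. }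
  specialize (H _ _ (HQ _ ltac:(rewrite E2; lra) Hst) (HR _ ltac:(rewrite E2; lra) Hst)).
  change (Rabs (hyp_quotient phi (RtoC r * sigma)%C (RtoC r * sigma)%C - 1) < e) in H.
  unfold hyp_quotient in H. destruct (Ceq_dec (RtoC r * sigma)%C (RtoC r * sigma)%C); [exact H|congruence].
Qed.

Theorem theorem1 (phi : C -> C) (sigma : C)
  (phi_holo : holomorphic_on_disc phi)
  (phi_maps : forall z : C, unit_disc z -> unit_disc (phi z))
  (sigma_bd : unit_circle sigma) :
  let a := filterlim (fun r : R => hyp_distortion phi (RtoC r * sigma)%C)
             (at_left 1) (locally 1) in
  let b := is_angular_lim2 (hyp_quotient phi) sigma 1 in
  let c := weakly_conformal_at phi sigma in
  (a <-> b) /\ (b <-> c) /\ (a <-> c).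
Proof.
  intros a b c.
  assert (ab : a -> b /\ c).
  { intros Ha.
    destruct (frames_exist phi sigma phi_holo phi_maps sigma_bd) as [u Hu].
    destruct (boundary_point phi sigma phi_holo phi_maps sigma_bd Ha u Hu) as [tau [Ht Hl]].
    split.
    - exact (quotient_limit phi sigma phi_holo phi_maps sigma_bd Ha u Hu tau Ht Hl).
    - exact (conformal_of_frames phi sigma phi_holo phi_maps sigma_bd Ha u Hu tau Ht Hl). }
  assert (ba : b -> a) by (apply diagonal_limit; exact sigma_bd).
  assert (ca : c -> a) by (apply conformal_distortion; assumption).
  tauto.
Qed.
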